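(* Let $R$ be a Cohen–Macaulay local ring containing a field $k$, and let $\underline a=a_1,\dots,a_r$ be an $R$-regular sequence with $r>0$. Let $S=R[T_1,\dots,T_m]$ with $T_1,\dots,T_m$ indeterminates over $R$, and let $\psi$ be an $r\times s$ matrix with entries in $k[T_1,\dots,T_m]$ such that the entries of each column are homogeneous elements of one and the same positive degree. If $(\underline a\cdot\psi):_S(\underline a)^\infty$ is a prime ideal of height $s$, then $I_r(\psi)$ is a prime ideal of $k[T_1,\dots,T_m]$ of height $\max\{0,s-r+1\}$, $(\underline a\cdot\psi):_S(\underline a)$ is a geometric residual intersection, and \[(\underline a\cdot\psi):_S(\underline a)^\infty=(\underline a\cdot\psi):_S(\underline a)=(\underline a\cdot\psi)+I_r(\psi).\]
   Context: $(\underline a\cdot\psi)$ denotes the $S$-ideal generated by the entries of the $1\times s$ matrix $[a_1\cdots a_r]\cdot\psi$; $(\underline a)=(a_1,\dots,a_r)S$; $J:\mathfrak b^\infty=\bigcup_t (J:\mathfrak b^t)$. $I_r(\psi)$ is the ideal generated by the $r\times r$ minors of $\psi$ (zero if $s<r$). An ideal $J=\mathfrak c:\mathfrak b$ with $\mathfrak c\subseteq \mathfrak b$ generated by $s$ elements is an $s$-residual intersection of $\mathfrak b$ if $\operatorname{ht}J\ge s$; it is geometric if moreover $\operatorname{ht}(\mathfrak b+J)\ge s+1$. *)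

(* Defs.v *)
From HB Require Import structures.
From mathcomp Require Import all_boot all_order all_algebra.
From mathcomp Require Export mpoly.
Set Implicit Arguments. Unset Strict Implicit. Unset Printing Implicit Defensive.
Import GRing.Theory.
Local Open Scope ring_scope.

Section Ideals.
Variable A : comRingType.

Definition subid (I J : A -> Prop) : Prop := forall x, I x -> J x.
Definition same_ideal (I J : A -> Prop) : Prop := forall x, I x <-> J x.

Definition is_ideal (I : A -> Prop) : Prop :=
  [/\ I 0, (forall x y, I x -> I y -> I (x + y)) &
      (forall r x, I x -> I (r * x))].

Definition ideal_gen (G : A -> Prop) : A -> Prop :=
  fun x => forall I, is_ideal I -> subid G I -> I x.

Definition ideal_of (n : nat) (g : 'I_n -> A) : A -> Prop :=
  ideal_gen (fun x => exists i, x = g i).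

Definition ideal_sum (I J : A -> Prop) : A -> Prop :=
  ideal_gen (fun x => I x \/ J x).

Definition prime_ideal (P : A -> Prop) : Prop :=
  [/\ is_ideal P, ~ P 1 & forall x y, P (x * y) -> P x \/ P y].

Definition colon (I J : A -> Prop) : A -> Prop :=
  fun x => forall y, J y -> I (x * y).

Fixpoint ideal_pow (J : A -> Prop) (t : nat) : A -> Prop :=
  match t with
  | 0%N => fun _ => True
  | t'.+1 => ideal_gen (fun x => exists a b,
                 [/\ ideal_pow J t' a, J b & x = a * b])
  end.

Definition saturation (I J : A -> Prop) : A -> Prop :=
  fun x => exists t, colon I (ideal_pow J t) x.

Definition prime_chain (c : nat -> A -> Prop) (n : nat) : Prop :=
  (forall i, (i <= n)%N -> prime_ideal (c i)) /\
  (forall i, (i < n)%N -> subid (c i) (c i.+1) /\ ~ subid (c i.+1) (c i)).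

Definition prime_height_ge (P : A -> Prop) (n : nat) : Prop :=
  exists c, prime_chain c n /\ same_ideal (c n) P.

(* height of an ideal (min of heights of primes containing it) is >= n;
   vacuously true for the unit ideal (height +oo) *)
Definition height_ge (I : A -> Prop) (n : nat) : Prop :=
  forall P, prime_ideal P -> subid I P -> prime_height_ge P n.

Definition height (I : A -> Prop) (n : nat) : Prop :=
  height_ge I n /\ ~ height_ge I n.+1.

Definition dim_ge (n : nat) : Prop := exists c, prime_chain c n.
Definition krull_dim (n : nat) : Prop := dim_ge n /\ ~ dim_ge n.+1.

Definition noetherian : Prop :=
  forall I, is_ideal I -> exists n (g : 'I_n -> A), same_ideal I (ideal_of g).

Definition local_ring_with (m : A -> Prop) : Prop :=
  [/\ is_ideal m, ~ m 1 & forall x, ~ m x -> exists y, x * y = 1].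

Definition regular_seq (r : nat) (a : 'I_r -> A) : Prop :=
  ~ ideal_of a 1 /\
  forall i : 'I_r, forall y,
    ideal_gen (fun x => exists j : 'I_r, (j < i)%N /\ x = a j) (a i * y) ->
    ideal_gen (fun x => exists j : 'I_r, (j < i)%N /\ x = a j) y.

Definition depth_ge (m : A -> Prop) (n : nat) : Prop :=
  exists a : 'I_n -> A, (forall i, m (a i)) /\ regular_seq a.

Definition CM_local : Prop :=
  noetherian /\ exists m, local_ring_with m /\
    exists d, krull_dim d /\ depth_ge m d /\ ~ depth_ge m d.+1.

Definition residual_intersection (J b : A -> Prop) (s : nat) : Prop :=
  exists c : 'I_s -> A, subid (ideal_of c) b /\
    same_ideal J (colon (ideal_of c) b) /\ height_ge J s.

Definition geometric_residual_intersection (J b : A -> Prop) (s : nat) : Prop :=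
  exists c : 'I_s -> A, [/\ subid (ideal_of c) b,
    same_ideal J (colon (ideal_of c) b), height_ge J s &
    height_ge (ideal_sum b J) s.+1].

End Ideals.

Definition minors_ideal (B : comRingType) (r s : nat) (psi : 'M[B]_(r, s)) :
  B -> Prop :=
  ideal_gen (fun x => exists g : 'I_r -> 'I_s,
                injective g /\ x = \det (colsub g psi)).

(* Main.v *)
(* Let B = k[T], S = R[T], C = B[x_1, ..., x_r] and let alpha_j = sum_i x_i psi_ij, so that
   x_i |-> a_i maps (alpha) onto the ideal generated by the entries of a.psi.

   Heights. Let q be a prime of B containing I_r(psi), rho < r the rank of psi modulo q, and
   z_1, ..., z_n local generators of q with n = ht q.  A prime of S minimal over (a, z) has
   height r + n, whereas z together with rho suitable entries of a.psi generates a.psi up to an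
   element outside q; by Krull's height theorem some prime over these n + rho elements does not
   contain a, hence contains the saturation, and s <= ht q + rho.  Consequently every prime of C
   that contains (alpha) but not all x_l has height at least s.

   Torsion in C/(alpha). Since C is regular, such primes contain long locally regular sequences,
   and a chase through the Koszul complex of alpha shows that its homology in positive degrees
   is killed by powers of every x_l.  A second chase, along powers of x_1, ..., x_r, compares
   the x-gradings: the x-torsion of C/(alpha) vanishes in positive x-degree, and in x-degree 0
   it consists of the r-fold contractions with the rows of psi, i.e. of I_r(psi).  Hence
   (alpha) : (x)^infinity = (alpha) + I_r(psi) C.

   Descent to S. Elements of S are expanded in powers of a with coefficients of the form
   sum_l e_l b_l, where b_l lies in B and the family e in R is independent over k modulo (a);
   the b_l are unique because a is regular.  This gives sat <= (a.psi) + I_r(psi) S + (a)^n for all n.  Krull's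
   intersection theorem and the T-grading (R is local and a lies in its maximal ideal) remove
   (a)^n.  The ideal I_r(psi) is then the contraction of the prime sat, and its height is
   bounded above by Krull's height theorem for a minimal prime of (alpha) lying over I_r(psi),
   modulo which psi has rank r - 1 for degree reasons. *)
Require Import Defs.
From HB Require Import structures.
From Stdlib Require Import Classical ClassicalEpsilon.
From mathcomp Require Import all_boot all_order all_algebra.
From mathcomp Require Import fingroup perm mpoly ring zify.
Set Implicit Arguments.
Unset Strict Implicit.
Unset Printing Implicit Defensive.
Import GRing.Theory.
Local Open Scope ring_scope.

(** * Ideals and prime ideals *)

Section IdealBasics.
Variable A : comNzRingType.
Implicit Types (I J L P Q : A -> Prop) (x y z u v : A).

(** Two rings divide the work. The hypothesis lives in [S], which need not be regular; long regular
    sequences are therefore sought in [C], a polynomial ring over a field, where every prime is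
    locally generated by such a sequence. The hypothesis passes from [S] to [C] only through primes
    [q] of [B], as an inequality between [s], the height of [q] and the rank modulo [q]; the
    conclusion passes back through expansions along [a]. Both passages rest on the freeness of [S]
    over [B] modulo [(a)], used through finite families in [R] independent over [k], so that neither
    a basis nor a tensor product is chosen. Localizations are not formed either: a statement at a
    prime [P] is one up to a multiplier outside [P]. Three chases through the Koszul complex (at an
    associated prime, along powers of the variables, along the variables themselves) are instances
    of one abstract induction, which explains its many parameters. Positivity of the column degrees
    is what excludes a rank below [r - 1] modulo a nonzero prime ideal of maximal minors. *)

Lemma ideal0 I : is_ideal I -> I 0. Proof. by case. Qed.
Lemma idealD {I x y }: is_ideal I -> I x -> I y -> I (x + y).
Proof. by case=> _ + _; apply. Qed.
Lemma idealMl {I x y }: is_ideal I -> I y -> I (x * y).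
Proof. by case=> _ _; apply. Qed.
Lemma idealMr {I x y }: is_ideal I -> I x -> I (x * y).
Proof. by move=> iI Ix; rewrite mulrC; apply: idealMl. Qed.
Lemma idealN {I x }: is_ideal I -> I x -> I (- x).
Proof. by move=> iI Ix; rewrite -mulN1r; apply: idealMl. Qed.
Lemma idealB {I x y }: is_ideal I -> I x -> I y -> I (x - y).
Proof. by move=> iI Ix Iy; apply: idealD => //; apply: idealN. Qed.
Lemma ideal_bigsum I (iI : is_ideal I) (T : Type) (r : seq T) (Q : pred T) (F : T -> A) :
  (forall i, Q i -> I (F i)) -> I (\sum_(i <- r | Q i) F i).
Proof.
move=> IF; elim/big_rec: _ => [|i x Qi Ix]; first exact: ideal0.
by apply: idealD => //; apply: IF.
Qed.
Lemma idealBl {I x y }: is_ideal I -> I y -> I (x - y) -> I x.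
Proof. by move=> iI Iy Ixy; rewrite -(subrK y x); apply: idealD. Qed.
Lemma idealBr {I x y }: is_ideal I -> I x -> I (x - y) -> I y.
Proof.
move=> iI Iy Ixy; have -> : y = x - (x - y) by ring.
exact: idealB.
Qed.

Definition zero_ideal : A -> Prop := fun x => x = 0.

Lemma zero_idealP : is_ideal zero_ideal.
Proof.
by split=> [|x y -> ->|r x ->]; rewrite /zero_ideal ?addr0 ?mulr0.
Qed.

Lemma zero_ideal_sub I : is_ideal I -> subid zero_ideal I.
Proof. by move=> iI x ->; apply: ideal0. Qed.

Lemma is_ideal_ext I J : same_ideal I J -> is_ideal I -> is_ideal J.
Proof.
move=> IJ [I0 ID IM]; split=> [|x y|r x]; rewrite -!IJ //; first exact: ID.
exact: IM.
Qed.

(** The sum [J + (y)] with the cofactor of [y] kept explicit, because later arguments divide by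
    [y]. *)
Definition ideal_adj J y : A -> Prop := fun x => exists g, J (x - y * g).
(* The contraction to [A] of the extension of [J] to the localization at [P]. *)
Definition loc P J : A -> Prop := fun x => exists u, ~ P u /\ J (u * x).
Definition gens J (zs : seq A) : A -> Prop := foldl ideal_adj J zs.

Lemma ideal_adjP J y : is_ideal J -> is_ideal (ideal_adj J y).
Proof.
move=> iJ; split=> [|a b [g Jg] [h Jh]|r a [g Jg]].
- by exists 0; rewrite mulr0 subrr; apply: ideal0.
- exists (g + h); have -> : a + b - y * (g + h) = (a - y * g) + (b - y * h) by ring.
  exact: idealD.
- exists (r * g); have -> : r * a - y * (r * g) = r * (a - y * g) by ring.
  exact: idealMl.
Qed.

Lemma ideal_adjl J y : subid J (ideal_adj J y).
Proof. by move=> x Jx; exists 0; rewrite mulr0 subr0. Qed.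

Lemma ideal_adjr J y g : is_ideal J -> ideal_adj J y (y * g).
Proof. by move=> iJ; exists g; rewrite subrr; apply: ideal0. Qed.

Lemma ideal_adj_id J y : is_ideal J -> ideal_adj J y y.
Proof. by move=> iJ; rewrite -{2}[y]mulr1; apply: ideal_adjr. Qed.

Lemma ideal_adj_sub J y I : is_ideal I -> subid J I -> I y -> subid (ideal_adj J y) I.
Proof.
move=> iI JI Iy x [g /JI Jg]; apply: idealBl Jg => //; exact: idealMr.
Qed.

Lemma gensP J zs : is_ideal J -> is_ideal (gens J zs).
Proof. by elim: zs J => //= z zs IH J iJ; apply/IH/ideal_adjP. Qed.

Lemma gensl J zs : is_ideal J -> subid J (gens J zs).
Proof.
elim: zs J => [|z zs IH] J iJ x Jx //=.
by apply: IH; [apply: ideal_adjP | apply: ideal_adjl].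
Qed.

Lemma gens_mem J zs x : is_ideal J -> x \in zs -> gens J zs x.
Proof.
elim: zs J => //= z zs IH J iJ; rewrite inE => /orP[/eqP->|xzs].
  by apply: gensl; [apply: ideal_adjP | apply: ideal_adj_id].
by apply: IH => //; apply: ideal_adjP.
Qed.

Lemma gens_sub J zs I :
  is_ideal I -> subid J I -> {in zs, forall x, I x} -> subid (gens J zs) I.
Proof.
elim: zs J => [|z zs IH] J iI JI zI //=; apply: IH => //.
  by apply: ideal_adj_sub => //; apply: zI; rewrite inE eqxx.
by move=> x xz; apply: zI; rewrite inE xz orbT.
Qed.

Lemma gens_cat J s1 s2 : gens J (s1 ++ s2) = gens (gens J s1) s2.
Proof. exact: foldl_cat. Qed.

Lemma prime_is_ideal P : prime_ideal P -> is_ideal P. Proof. by case. Qed.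
Lemma prime1 P : prime_ideal P -> ~ P 1. Proof. by case. Qed.
Lemma primeM {P x y }: prime_ideal P -> P (x * y) -> P x \/ P y.
Proof. by case=> _ _; apply. Qed.
Lemma nprimeM {P x y }: prime_ideal P -> ~ P x -> ~ P y -> ~ P (x * y).
Proof. by move=> pP nx ny /(primeM pP)[]. Qed.
Lemma primeX {P x n }: prime_ideal P -> P (x ^+ n) -> P x.
Proof.
move=> pP; elim: n => [/(prime1 pP)//|n IH]; rewrite exprS.
by case/(primeM pP) => //.
Qed.
Lemma nprimeX {P x n }: prime_ideal P -> ~ P x -> ~ P (x ^+ n).
Proof. by move=> pP nx /(primeX pP). Qed.

Lemma prime_ideal_ext P Q : same_ideal P Q -> prime_ideal P -> prime_ideal Q.
Proof.
move=> PQ [iP P1 PM]; split; first exact: is_ideal_ext iP.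
  by rewrite -PQ.
by move=> x y; rewrite -!PQ; apply: PM.
Qed.

Lemma loc_ideal P J : prime_ideal P -> is_ideal J -> is_ideal (loc P J).
Proof.
move=> pP iJ; split=> [|x y [u [nu Ju]] [v [nv Jv]]|r x [u [nu Ju]]].
- by exists 1; rewrite mulr0; split; [apply: prime1 | apply: ideal0].
- exists (u * v); split; first exact: nprimeM.
  have -> : u * v * (x + y) = v * (u * x) + u * (v * y) by ring.
  by apply: idealD => //; apply: idealMl.
- exists u; split=> //; have -> : u * (r * x) = r * (u * x) by ring.
  exact: idealMl.
Qed.

Lemma loc_incl P J : prime_ideal P -> subid J (loc P J).
Proof. by move=> pP x Jx; exists 1; rewrite mul1r; split=> //; apply: prime1. Qed.

Lemma loc_mono P I J : subid I J -> subid (loc P I) (loc P J).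
Proof. by move=> IJ x [u [nu /IJ]]; exists u. Qed.

Lemma loc_mul P J u x : prime_ideal P -> ~ P u -> loc P J (u * x) -> loc P J x.
Proof.
move=> pP nu [v [nv]]; rewrite mulrA => Jx; exists (v * u); split=> //.
exact: nprimeM.
Qed.

Lemma loc_loc P J : prime_ideal P -> subid (loc P (loc P J)) (loc P J).
Proof. by move=> pP x [u [nu]]; apply: loc_mul. Qed.

Lemma loc_sub P J : prime_ideal P -> subid J P -> subid (loc P J) P.
Proof. by move=> pP JP x [u [nu /JP /(primeM pP)[]]]. Qed.

Lemma ideal_genP (G : A -> Prop) : is_ideal (ideal_gen G).
Proof.
split=> [I iI _|x y Gx Gy I iI GI|r x Gx I iI GI]; first exact: ideal0.
  by apply: idealD; [|apply: Gx|apply: Gy].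
by apply: idealMl => //; apply: Gx.
Qed.

Lemma ideal_gen_incl (G : A -> Prop) : subid G (ideal_gen G).
Proof. by move=> x Gx I _; apply. Qed.

Lemma ideal_gen_sub (G : A -> Prop) I :
  is_ideal I -> subid G I -> subid (ideal_gen G) I.
Proof. by move=> iI GI x; apply. Qed.

Lemma ideal_ofP n (g : 'I_n -> A) : is_ideal (ideal_of g).
Proof. exact: ideal_genP. Qed.

Lemma ideal_of_gen n (g : 'I_n -> A) i : ideal_of g (g i).
Proof. by apply: ideal_gen_incl; exists i. Qed.

Lemma ideal_of_sub n (g : 'I_n -> A) I :
  is_ideal I -> (forall i, I (g i)) -> subid (ideal_of g) I.
Proof. by move=> iI gI; apply: ideal_gen_sub => // x [i ->]. Qed.

Lemma ideal_of_lin n (g : 'I_n -> A) x :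
  ideal_of g x <-> exists c : 'I_n -> A, x = \sum_i c i * g i.
Proof.
split; last first.
  move=> [c ->]; apply: (ideal_bigsum (ideal_ofP g)) => i _.
  by apply: (idealMl (ideal_ofP g)); apply: ideal_of_gen.
move: x; apply: ideal_of_sub.
  split=> [|x y [c ->] [d ->]|r x [c ->]].
  - by exists (fun=> 0); rewrite big1 // => i _; rewrite mul0r.
  - exists (fun i => c i + d i); rewrite -big_split /=.
    by apply: eq_bigr => i _; rewrite mulrDl.
  - exists (fun i => r * c i); rewrite mulr_sumr.
    by apply: eq_bigr => i _; rewrite mulrA.
move=> i; exists (fun j => (j == i)%:R); rewrite (bigD1 i) //= eqxx mul1r.
by rewrite big1 ?addr0 // => j /negPf->; rewrite mul0r.
Qed.

Lemma ideal_of_gens n (g : 'I_n -> A) :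
  same_ideal (ideal_of g) (gens zero_ideal [seq g i | i <- enum 'I_n]).
Proof.
have iz := zero_idealP; split.
  apply: ideal_of_sub => [|i]; first exact: gensP.
  by apply: gens_mem => //; apply: map_f; rewrite mem_enum.
apply: gens_sub; [exact: ideal_ofP | exact: zero_ideal_sub (ideal_ofP g) |].
by move=> _ /mapP[i _ ->]; apply: ideal_of_gen.
Qed.

End IdealBasics.
Arguments zero_ideal {A}.
Arguments zero_idealP {A}.
Hint Resolve zero_idealP : core.

(** * Maximal elements, minimal primes and associated primes in a Noetherian ring *)

Section Noetherian.
Variable A : comNzRingType.
Hypothesis noeA : noetherian A.
Implicit Types (I J L P Q : A -> Prop) (x y z u v : A).

(** Without a maximal element, choice yields a strictly increasing sequence of ideals; the finitely
    many generators of its union all occur at one stage, where the sequence would have to stop. *)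
Lemma noeth_max (F : (A -> Prop) -> Prop) I0 :
  is_ideal I0 -> F I0 ->
  exists I, [/\ is_ideal I, F I & forall J, is_ideal J -> F J -> subid I J -> subid J I].
Proof.
move=> iI0 FI0; apply: NNPP => nmax.
pose T := {I : A -> Prop | is_ideal I /\ F I}.
have step (I : T) : exists J : T, subid (sval I) (sval J) /\ ~ subid (sval J) (sval I).
  apply: NNPP => nJ; apply: nmax; exists (sval I).
  case: I nJ => I [iI FI] /= nJ; split=> // J iJ FJ IJ; apply: NNPP => nJI.
  by apply: nJ; exists (exist _ J (conj iJ FJ)).
pose g (t : T) : T := sval (constructive_indefinite_description _ (step t)).
have gP (t : T) : subid (sval t) (sval (g t)) /\ ~ subid (sval (g t)) (sval t).
  exact: (svalP (constructive_indefinite_description _ (step t))).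
pose c n := iter n g (exist _ I0 (conj iI0 FI0) : T).
have cS n : subid (sval (c n)) (sval (c n.+1)) by case: (gP (c n)).
have cle n k : (n <= k)%N -> subid (sval (c n)) (sval (c k)).
  by move/subnK<-; elim: (k - n)%N => // d IH x /IH; apply: cS.
have iU : is_ideal (fun x => exists n, sval (c n) x).
  split=> [|x y [n cx] [k cy]|r x [n cx]].
  - by exists 0%N; apply: ideal0.
  - exists (maxn n k); apply: idealD; first by case: (svalP (c (maxn n k))).
      by apply: cle cx; rewrite leq_maxl.
    by apply: cle cy; rewrite leq_maxr.
  - by exists n; apply: idealMl => //; case: (svalP (c n)).
have [n [h hP]] := noeA iU.
have hc i : exists k, sval (c k) (h i) by case: (hP (h i)) => _; apply; apply: ideal_of_gen.
pose K i := sval (constructive_indefinite_description _ (hc i)).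
have KP i : sval (c (K i)) (h i).
  exact: (svalP (constructive_indefinite_description _ (hc i))).
pose N := (\max_i K i)%N.
have [_ []] := gP (c N) => x cx.
have : ideal_of h x by case: (hP x) => + _; apply; exists N.+1.
apply: ideal_of_sub; first by case: (svalP (c N)).
by move=> i; apply: cle (KP i); rewrite /N (bigmax_sup i).
Qed.

Lemma noeth_ind (F : (A -> Prop) -> Prop) :
  (forall I, is_ideal I ->
     (forall J, is_ideal J -> subid I J -> ~ subid J I -> F J) -> F I) ->
  forall I, is_ideal I -> F I.
Proof.
move=> step I0 iI0; apply: NNPP => nF.
have [I [iI nFI maxI]] := noeth_max (F := fun I => ~ F I) iI0 nF.
apply: nFI; apply: step => // J iJ IJ nJI; apply: NNPP => nFJ.
exact/nJI/maxI.
Qed.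

(** An ideal maximal among those that contain [J] and miss [W] is prime: if [x] and [y] are outside
    it, adjoining either one makes it meet [W], and the product of the two witnesses would lie in
    the ideal together with [x * y]. *)
Lemma prime_avoiding J (W : A -> Prop) :
  is_ideal J -> W 1 -> (forall x y, W x -> W y -> W (x * y)) ->
  (forall x, J x -> ~ W x) ->
  exists P, [/\ prime_ideal P, subid J P & forall x, P x -> ~ W x].
Proof.
move=> iJ W1 WM JW.
have [|I [iI [JI IW] maxI]] :=
  noeth_max (F := fun I => subid J I /\ forall x, I x -> ~ W x) iJ; first by split.
have out x : ~ I x -> exists w g, W w /\ I (w - x * g).
  move=> nIx; apply: NNPP => nw; apply: nIx.
  apply: (maxI _ (ideal_adjP x iI)); last 2 first.
  - exact: ideal_adjl.
  - exact: ideal_adj_id.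
  split=> [y /JI|y [g Ig] Wy]; first exact: ideal_adjl.
  by apply: nw; exists y, g.
exists I; split=> //; split=> // [I1|x y Ixy]; first exact: IW W1.
apply: NNPP => /not_or_and[/out[w [g [Ww Iw]]] /out[w' [g' [Ww' Iw']]]].
apply: (IW (w * w')); last exact: WM.
have -> : w * w' = (w - x * g) * w' + x * g * (w' - y * g') + g * g' * (x * y) by ring.
apply: idealD => //; last exact: idealMl.
by apply: idealD => //; [apply: idealMr | apply: idealMl].
Qed.

(** Propositional membership, for lists over types without decidable equality, such as ideals. *)
Fixpoint InP (T : Type) (x : T) (s : seq T) : Prop :=
  if s is y :: s' then y = x \/ InP x s' else False.

Lemma InP_cat T (x : T) s1 s2 : InP x (s1 ++ s2) <-> InP x s1 \/ InP x s2.
Proof. by elim: s1 => /= [|y s1 IH]; rewrite ?IH; tauto. Qed.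

(** Noetherian induction: when [x * y] is in [J] but neither factor is, every prime over [J]
    contains [J + (x)] or [J + (y)], and the two finite lists are concatenated. Finiteness then
    yields minimal primes by inspection of a list. *)
Lemma prime_cover J : is_ideal J ->
  exists ps : seq (A -> Prop),
   (forall p, InP p ps -> prime_ideal p /\ subid J p) /\
   (forall P, prime_ideal P -> subid J P -> exists p, InP p ps /\ subid p P).
Proof.
move: J; apply: noeth_ind => J iJ IH.
case: (classic (J 1)) => [J1|nJ1].
  by exists [::]; split=> // P pP JP; case: (prime1 pP); apply: JP.
case: (classic (exists x y, [/\ J (x * y), ~ J x & ~ J y])) => [|npr]; last first.
  exists [:: J]; split=> [p /= [<-|//]|P pP JP]; last by exists J; split=> //; left.
  split=> //; split=> // x y Jxy; apply: NNPP => /not_or_and[nx ny].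
  by apply: npr; exists x, y.
move=> [x [y [Jxy nx ny]]].
have bigger w : ~ J w -> ~ subid (ideal_adj J w) J.
  by move=> nw sub; apply: nw; apply: sub; apply: ideal_adj_id.
have [ps [ps1 ps2]] := IH _ (ideal_adjP x iJ) (@ideal_adjl _ J x) (bigger x nx).
have [qs [qs1 qs2]] := IH _ (ideal_adjP y iJ) (@ideal_adjl _ J y) (bigger y ny).
exists (ps ++ qs); split=> [p|P pP JP].
  rewrite InP_cat => -[/ps1|/qs1] [pp sub]; split=> // z Jz; apply: sub;
    exact: ideal_adjl.
have /(primeM pP)[Px|Py] := JP _ Jxy.
  have [|p [pin sub]] := ps2 P pP; first by apply: ideal_adj_sub => //; apply: prime_is_ideal.
  by exists p; rewrite InP_cat; split=> //; left.
have [|p [pin sub]] := qs2 P pP; first by apply: ideal_adj_sub => //; apply: prime_is_ideal.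
by exists p; rewrite InP_cat; split=> //; right.
Qed.

Definition minimal_over P J : Prop :=
  [/\ prime_ideal P, subid J P &
      forall P', prime_ideal P' -> subid J P' -> subid P' P -> subid P P'].

Lemma finite_minimal (ps : seq (A -> Prop)) P : InP P ps ->
  exists p, [/\ InP p ps, subid p P & forall q, InP q ps -> subid q p -> subid p q].
Proof.
elim: ps P => //= p0 ps IH P Pin.
have key P1 : InP P1 ps -> subid P1 P -> exists p, [/\ p0 = p \/ InP p ps, subid p P &
    forall q, p0 = q \/ InP q ps -> subid q p -> subid p q].
  move=> /IH[p [pin sub minp]] sP.
  case: (classic (subid p0 p /\ ~ subid p p0)) => [[sub0 nsub]|nn].
    exists p0; split=> [|x /sub0 /sub /sP //|q [<- //|qin] qp0]; first by left.
    by move=> x p0x; apply: (minp q qin _ x (sub0 x p0x)) => y /qp0 /sub0.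
  exists p; split=> [|x /sub /sP //|q [<-|qin] qp]; first by right.
    by apply: NNPP => nsub; apply: nn.
  exact: minp.
case: Pin => [EP|Pin]; last exact: key Pin _.
subst P.
case: (classic (exists P1, [/\ InP P1 ps, subid P1 p0 & ~ subid p0 P1])) => [[P1 [P1in s1 _]]|nn].
  exact: key P1in s1.
exists p0; split=> // [|q [<-//|qin] qP]; first by left.
by apply: NNPP => nsub; apply: nn; exists q.
Qed.

Lemma minimal_prime_below P J : is_ideal J -> prime_ideal P -> subid J P ->
  exists Q, minimal_over Q J /\ subid Q P.
Proof.
move=> iJ pP JP; have [ps [ps1 ps2]] := prime_cover iJ.
have [p [pin pP']] := ps2 P pP JP.
have [q [qin qp minq]] := finite_minimal pin.
have [pq Jq] := ps1 q qin.
exists q; split=> [|x /qp /pP' //]; split=> // P' pP1 JP1 P1q.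
have [p1 [p1in p1P]] := ps2 P' pP1 JP1.
by move=> x qx; apply/p1P/(minq p1 p1in) => // y /p1P /P1q.
Qed.

(** After localization at [P] the prime [P] is the only one over [J], so its elements are nilpotent
    modulo [J]. Otherwise a prime avoiding all products [u * x ^+ t] with [u] outside [P] would lie
    inside [P] and miss [x]. *)
Lemma minimal_over_nilp P J x : is_ideal J -> minimal_over P J -> P x ->
  exists u t, ~ P u /\ J (u * x ^+ t).
Proof.
move=> iJ [pP JP minP] Px; apply: NNPP => nn.
pose W := fun y => exists u t, ~ P u /\ y = u * x ^+ t.
have nW (y : A) : ~ P y -> W y by move=> ny; exists y, 0%N; rewrite mulr1.
have [|||P' [pP' JP' P'W]] := @prime_avoiding J W iJ.
- by apply: nW; apply: prime1.
- move=> _ _ [u [t [nu ->]]] [v [k [nv ->]]]; exists (u * v), (t + k)%N.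
  by split; [apply: nprimeM | rewrite exprD; ring].
- by move=> y Jy [u [t [nu yE]]]; apply: nn; exists u, t; rewrite -yE.
have P'P : subid P' P by move=> y P'y; apply: NNPP => /nW; apply: P'W.
apply: (P'W x); first exact: minP.
by exists 1, 1%N; rewrite mul1r; split=> //; apply: prime1.
Qed.

(* An associated prime of the cyclic submodule generated by [v] in [E / L]. *)
Lemma exists_associated_prime (E : lmodType A) (L : E -> Prop) (v : E) :
  (forall c w, L w -> L (c *: w)) -> (forall w w', L w -> L w' -> L (w + w')) ->
  L 0 -> ~ L v ->
  exists c, ~ L (c *: v) /\ prime_ideal (fun e => L (e *: (c *: v))).
Proof.
move=> LZ LD L0 nLv.
have iA (w : E) : is_ideal (fun e : A => L (e *: w)).
  split=> [|x y Lx Ly|r x Lx]; first by rewrite scale0r.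
    by rewrite scalerDl; apply: LD.
  by rewrite -scalerA; apply: LZ.
have [|I [iI [c [nc IE]] maxI]] := noeth_max
  (F := fun I => exists c, ~ L (c *: v) /\ same_ideal I (fun e => L (e *: (c *: v))))
  (iA v).
  by exists 1; rewrite scale1r.
exists c; split=> //; split=> // [|x y Lxy]; first by rewrite scale1r.
case: (classic (L (x *: (c *: v)))) => Lx; [by left | right].
apply/IE/(maxI _ (iA ((x * c) *: v))).
- by exists (x * c); rewrite -scalerA.
- by move=> z /IE Lz; rewrite -scalerA scalerA mulrC -scalerA; apply: LZ.
- by rewrite -[in X in L X]scalerA scalerA [y * x]mulrC.
Qed.

End Noetherian.

(** * Krull's height theorem *)

Section Height.
Variable A : comNzRingType.
Implicit Types (I J L P Q : A -> Prop) (x y z u v : A).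

Lemma prime_height_ge_prime P n : prime_height_ge P n -> prime_ideal P.
Proof. by case=> c [[cp _] cP]; apply: prime_ideal_ext cP _; apply: cp. Qed.

Lemma prime_height_ge0 P : prime_ideal P -> prime_height_ge P 0.
Proof. by move=> pP; exists (fun=> P). Qed.

Lemma prime_height_geS P Q n :
  prime_ideal P -> subid Q P -> ~ subid P Q ->
  prime_height_ge Q n -> prime_height_ge P n.+1.
Proof.
move=> pP QP nPQ [c [[cp cS] cQ]].
exists (fun i => if (i <= n)%N then c i else P); split; last by rewrite ltnn.
split=> i; first by case: ifP => // le _; apply: cp.
rewrite ltnS => le; rewrite le; case: ltnP => lt; first exact: cS.
have -> : i = n by apply/eqP; rewrite eqn_leq le.
by split=> [x /cQ/QP //|sub]; apply: nPQ => x /sub /cQ.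
Qed.

Lemma prime_height_ge_le P n k : (k <= n)%N -> prime_height_ge P n -> prime_height_ge P k.
Proof.
move=> le [c [[cp cS] cP]]; exists (fun i => c (i + (n - k))%N); split.
  split=> i ik; first by apply: cp; lia.
  by rewrite addSn; apply: cS; lia.
by rewrite subnKC.
Qed.

Lemma prime_height_ge_pred P n : prime_height_ge P n.+1 ->
  exists Q, [/\ prime_height_ge Q n, subid Q P & ~ subid P Q].
Proof.
move=> [c [[cp cS] cP]]; exists (c n); have [s1 s2] := cS n (leqnn _).
split.
- exists c; split=> //; split=> i le; first by apply: cp; lia.
  by apply: cS; lia.
- by move=> x /s1 /cP.
- by move=> sub; apply: s2 => x /cP /sub.
Qed.

(** The determinant trick. Modulo [J] the matrix [X] is diagonal with entries outside [P], so its
    determinant is outside [P]; and [\adj X *m X = (\det X)%:M] carries the relations in [M] to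
    [\det X * g i]. *)
Lemma nakayama P J M n (g : 'I_n -> A) :
  prime_ideal P -> is_ideal M -> subid J P ->
  (forall i, exists u (c : 'I_n -> A),
     [/\ ~ P u, forall j, J (c j) & M (u * g i - \sum_j c j * g j)]) ->
  forall i, loc P M (g i).
Proof.
move=> pP iM JP /fin_all_exists[u /fin_all_exists[c cP]] i.
have iP := prime_is_ideal pP.
pose X := (\matrix_(i, j) ((if i == j then u i else 0) - c i j))%R.
exists (\det X); split.
  rewrite /determinant (bigD1 (1%g : {perm 'I_n})) //= odd_perm1 expr0 mul1r => PX.
  have : P (\prod_i X i ((1%g : {perm 'I_n}) i)).
    set s := (X in P (_ + X)) in PX; rewrite -[X in P X](addrK s); apply: idealB => //.
    apply: ideal_bigsum => // p p1; apply: idealMl => //.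
    have [k sk] : exists k, p k != k.
      apply: NNPP => nk; case/eqP: p1; apply/permP => k; rewrite perm1.
      by apply: NNPP => /eqP sk; apply: nk; exists k.
    rewrite (bigD1 k) //= mxE eq_sym (negPf sk) sub0r; apply: idealMr => //.
    by apply: idealN => //; apply: JP; case: (cP k).
  elim/big_rec: _ => [/(prime1 pP)//|k x _ IH]; rewrite perm1 mxE eqxx.
  case/(primeM pP) => // Pu; case: (cP k) => + Jc _; apply.
  by apply: idealBl Pu => //; apply: JP.
have -> : \det X * g i = ((\det X)%:M *m \col_j g j) i 0.
  by rewrite mul_scalar_mx !mxE.
rewrite -mul_adj_mx -mulmxA mxE; apply: ideal_bigsum => // k _; apply: idealMl => //.
suff -> : (X *m \col_j g j) k 0 = u k * g k - \sum_j c k j * g j by case: (cP k).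
rewrite mxE (eq_bigr (fun j => (if k == j then u k else 0) * g j - c k j * g j)); last first.
  by move=> j _; rewrite !mxE mulrBl.
rewrite sumrB (bigD1 k) //= eqxx [X in _ + X - _]big1 ?addr0 // => j /negPf kj.
by rewrite eq_sym kj mul0r.
Qed.

Hypothesis noeA : noetherian A.

(* The quotient by [L] is Artinian at [P], so descending chains stop. *)
Lemma descending_chain P L0 :
  is_ideal L0 -> minimal_over P L0 ->
  forall L, is_ideal L -> subid L0 L -> subid (loc P L) L ->
  forall I : nat -> A -> Prop,
   (forall k, [/\ is_ideal (I k), subid (loc P (I k)) (I k), subid L (I k) &
                  subid (I k.+1) (I k)]) ->
  exists k, subid (I k) (I k.+1).
Proof.
move=> iL0 minP; have [pP L0P minP'] := minP.
apply: (noeth_ind noeA) => L iL IH L0L Lsat I IP.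
case: (classic (L 1)) => [L1|nL1].
  exists 0%N => x _; case: (IP 1%N) => i1 _ LI _.
  by rewrite -[x]mulr1; apply: idealMl => //; apply: LI.
(* An associated prime of [A / L] is inside [P] because [L] is saturated at [P], and contains [P] by
   minimality. Thus [P] is the annihilator of [g] modulo [L]: at [P], adjoining [g] to [L] adds
   length one. *)
have [|||g [nLg pLg]] := @exists_associated_prime A noeA A^o L 1 _ _ _ nL1.
- by move=> c w; apply: idealMl.
- by move=> w w'; apply: idealD.
- exact: ideal0.
pose p := fun e : A => L (e * g).
have gE : g *: (1 : A^o) = g by rewrite /GRing.scale /= mulr1.
rewrite gE in nLg pLg.
have pP' : subid p P.
  move=> e pe; apply: NNPP => ne; apply: nLg; apply: Lsat.
  by exists e.
have Pp : subid P p.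
  by apply: minP' => // x L0x; apply: idealMr => //; apply: L0L.
pose J I := loc P (ideal_adj I g).
have iJ I1 : is_ideal I1 -> is_ideal (J I1) by move=> i1; apply/loc_ideal/ideal_adjP.
have sJ I1 : subid (loc P (J I1)) (J I1) by exact: loc_loc.
have inJ I1 : subid I1 (J I1).
  by move=> x Ix; apply: loc_incl => //; apply: ideal_adjl.
have mJ I1 I2 : subid I1 I2 -> subid (J I1) (J I2).
  by move=> s12; apply: loc_mono => x [h /s12 Ih]; exists h.
have nJL : ~ subid (J L) L.
  move=> sub; apply: nLg; apply: sub; apply: loc_incl => //; exact: ideal_adj_id.
(* Either all terms contain [g], hence [L + (g)], or [g] is missing from some term [k0] on. In the
   second case adjoining [g] hides no strict inclusion: a multiple [g * c] in a later term forces
   [c] into [P], hence [g * c] into [L]. *)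
case: (classic (forall k, I k g)) => [allg|/not_all_ex_not[k0 nk0]].
  have IJ k : subid (J (I k)) (I k).
    case: (IP k) => ik satk _ _ x Jx; apply: satk; apply: loc_mono Jx.
    exact: ideal_adj_sub.
  have [x|k|k Ik] := IH _ (iJ _ iL) (inJ L) nJL _ (sJ L) (fun k => J (I k)).
  - by move=> L0x; apply: (inJ L); apply: L0L.
  - case: (IP k) => ik satk Lk dk; split; [exact: iJ|exact: sJ|exact: mJ|exact: mJ].
  by exists k => x /(inJ (I k)) /Ik /IJ.
have dec k : subid (I (k0 + k)%N) (I k0).
  elim: k => [|k IHk] x; first by rewrite addn0.
  by rewrite addnS => Ix; apply: IHk; case: (IP (k0 + k)%N) => _ _ _; apply.
have [x|k|k Ik] := IH _ (iJ _ iL) (inJ L) nJL _ (sJ L) (fun k => J (I (k0 + k)%N)).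
- by move=> L0x; apply: (inJ L); apply: L0L.
- rewrite addnS; case: (IP (k0 + k)%N) => ik satk Lk dk.
  by split; [exact: iJ|exact: sJ|exact: mJ|exact: mJ].
exists (k0 + k)%N => x Ix.
case: (IP (k0 + k)%N) => ik satk Lk dk; case: (IP (k0 + k).+1) => ik1 satk1 Lk1 dk1.
have [u [nu [c Ic]]] := Ik x (inJ _ x Ix); rewrite addnS in Ic.
have Igc : I (k0 + k)%N (g * c).
  by apply: idealBr (dk _ Ic) => //; apply: idealMl.
have Pc : P c.
  apply: NNPP => nc; apply: nk0; apply: (dec k); apply: satk.
  by exists c; rewrite mulrC.
apply: satk1; exists u; split=> //; apply: idealBl Ic => //; apply: Lk1.
by rewrite mulrC; apply: Pp.
Qed.

Lemma ideal_powP J t : is_ideal (ideal_pow J t).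
Proof. by case: t => [|t] //=; exact: ideal_genP. Qed.

Lemma ideal_pow_exp J x t : J x -> ideal_pow J t (x ^+ t).
Proof.
move=> Jx; elim: t => //= t IH; apply: ideal_gen_incl.
by exists (x ^+ t), x; rewrite exprSr.
Qed.

Lemma ideal_powS_sub J t : subid (ideal_pow J t.+1) (ideal_pow J t).
Proof.
apply: ideal_gen_sub; first exact: ideal_powP.
by move=> _ [a [b [Ja _ ->]]]; apply: idealMr => //; apply: ideal_powP.
Qed.

Lemma ideal_powS_lin J t n (h : 'I_n -> A) x : is_ideal J ->
  same_ideal (ideal_pow J t) (ideal_of h) -> ideal_pow J t.+1 x ->
  exists c : 'I_n -> A, (forall j, J (c j)) /\ x = \sum_j c j * h j.
Proof.
move=> iJ hP; move: x; apply: ideal_gen_sub.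
  split=> [|x y [c [Jc ->]] [d [Jd ->]]|r x [c [Jc ->]]].
  - by exists (fun=> 0); split=> [j|]; [apply: ideal0 | rewrite big1 // => j _; rewrite mul0r].
  - exists (fun j => c j + d j); split=> [j|]; first exact: idealD.
    by rewrite -big_split; apply: eq_bigr => j _; rewrite mulrDl.
  - exists (fun j => r * c j); split=> [j|]; first exact: idealMl.
    by rewrite mulr_sumr; apply: eq_bigr => j _; rewrite mulrA.
move=> _ [a [b [Ja Jb ->]]]; have [/(_ Ja)/ideal_of_lin[c ->] _] := hP a.
exists (fun j => b * c j); split=> [j|]; first exact: idealMr.
by rewrite mulr_suml; apply: eq_bigr => j _; ring.
Qed.

(** The symbolic powers of [Q] modulo [Q'], enlarged by [(z)], stabilize at [P]. As [z] is outside
    [Q], Nakayama at [P] makes the symbolic powers themselves stabilize, and Nakayama at [Q] then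
    puts a power of [Q] into [Q']. *)
Lemma principal_ideal_thm P Q Q' z :
  prime_ideal Q -> prime_ideal Q' -> minimal_over P (ideal_adj Q' z) ->
  subid Q' Q -> subid Q P -> ~ subid P Q -> subid Q Q'.
Proof.
move=> pQ pQ' minP Q'Q QP nPQ.
have [pP LP minP'] := minP.
have [iP iQ iQ'] : [/\ is_ideal P, is_ideal Q & is_ideal Q'] by split; apply: prime_is_ideal.
have nz : ~ Q z.
  by move=> Qz; apply: nPQ; apply: minP' => //; apply: ideal_adj_sub.
pose S k x := exists w y, [/\ ~ Q w, ideal_pow Q k y & Q' (w * x - y)].
have iS k : is_ideal (S k).
  have ik := @ideal_powP Q k.
  split=> [|x x' [w [y [nw Qy e]]] [w' [y' [nw' Qy' e']]]|r x [w [y [nw Qy e]]]].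
  - exists 1, 0; split; [exact: prime1 | exact: ideal0 | rewrite mulr0 subrr; exact: ideal0].
  - exists (w * w'), (w' * y + w * y'); split; first exact: nprimeM.
      by apply: idealD => //; apply: idealMl.
    have -> : w * w' * (x + x') - (w' * y + w * y') = w' * (w * x - y) + w * (w' * x' - y') by ring.
    by apply: idealD => //; apply: idealMl.
  - exists w, (r * y); split=> //; first exact: idealMl.
    have -> : w * (r * x) - r * y = r * (w * x - y) by ring.
    exact: idealMl.
have satS k : subid (loc Q (S k)) (S k).
  move=> x [u [nu [w [y [nw Qy e]]]]]; exists (w * u), y; split=> //; first exact: nprimeM.
  by rewrite -mulrA.
have decS k : subid (S k.+1) (S k).
  by move=> x [w [y [nw Qy e]]]; exists w, y; split=> //; apply: ideal_powS_sub.
have Q'S k : subid Q' (S k).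
  move=> x Q'x; exists 1, 0; rewrite mul1r subr0; split=> //; first exact: prime1.
  by apply: ideal0; apply: ideal_powP.
have [] := @descending_chain P _ (ideal_adjP z iQ') minP (loc P (ideal_adj Q' z)) _ _ _
  (fun k => loc P (ideal_adj (S k) z)).
- exact/loc_ideal/ideal_adjP.
- exact: loc_incl.
- exact: loc_loc.
- move=> k; split; [exact/loc_ideal/ideal_adjP|exact: loc_loc| |].
    by apply: loc_mono => x [h /Q'S]; exists h.
  by apply: loc_mono => x [h /decS]; exists h.
move=> k Ik.
have [n [g gP]] := noeA (iS k).
have Sg i : loc P (S k.+1) (g i).
  apply: (@nakayama P (ideal_adj zero_ideal z)) => // [|{}i].
    apply: ideal_adj_sub; [exact: iP | exact: zero_ideal_sub iP |].
    by apply: LP; apply: ideal_adj_id.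
  have Skg : S k (g i) by apply: (proj2 (gP (g i))); apply: ideal_of_gen.
  have [|u [nu [h Sh]]] := Ik (g i).
    by apply: loc_incl => //; apply: ideal_adjl.
  (* [S k] is saturated at [Q] and [z] is outside [Q], so the cofactor of [z] stays in [S k]; this
     gives the relation the shape that Nakayama's lemma requires. *)
  have : S k h.
    apply: satS; exists z; split=> //; apply: idealBr (decS _ _ Sh) => //.
    exact: idealMl.
  move=> /(proj1 (gP h))/ideal_of_lin [c hE]; exists u, (fun j => z * c j); split=> // [j|].
    exact: ideal_adjr.
  by move: Sh; rewrite hE mulr_sumr; under eq_bigr do rewrite mulrA.
have SS : subid (S k) (S k.+1).
  move=> x /(proj1 (gP x)); move: x; apply: ideal_of_sub => // i; apply: satS.
  by case: (Sg i) => u [nu Su]; exists u; split=> // /QP.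
have [q [h hP]] := noeA (@ideal_powP Q k).
have Q'h i : Q' (h i).
  apply: (loc_sub pQ' (fun _ => id)).
  have : loc Q Q' (h i).
    apply: (@nakayama Q Q) => // {}i.
    have : S k.+1 (h i).
      apply: SS; exists 1, (h i); rewrite mul1r subrr; split; [exact: prime1| |exact: ideal0].
      by apply: (proj2 (hP (h i))); apply: ideal_of_gen.
    move=> [w [y [nw Qy Q'wy]]]; have [c [Qc yE]] := ideal_powS_lin iQ hP Qy.
    by exists w, c; rewrite -yE.
  by move=> [u [nu Q'u]]; exists u; split=> // /Q'Q.
move=> x Qx; apply: (primeX pQ' (n := k)).
by move: (ideal_pow_exp k Qx) => /(proj1 (hP _)); apply: ideal_of_sub.
Qed.

(** Induction on the number of generators. With [Q] maximal among the relevant primes strictly below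
    [P], and a generator [z] outside [Q], the prime [P] is minimal over [Q + (z)]. So each remaining
    generator has, up to a multiplier outside [P], a power of the form [q + z * b] with [q] in [Q].
    By the principal case [Q] is minimal over these elements [q], which are one fewer. *)
Theorem krull_height P (zs : seq A) h :
  minimal_over P (fun x => x \in zs) -> prime_height_ge P h -> (h <= size zs)%N.
Proof.
move en: (size zs) => n; elim: n P zs en h => [|n IH] P zs sz [|h] // minP.
  move/prime_height_ge_pred => [Q [/prime_height_ge_prime pQ QP nPQ]].
  case: minP => _ _ minP; case: nPQ; apply: minP => //.
  by move/eqP: sz; rewrite size_eq0 => /eqP->.
move=> hP; rewrite ltnS; case: h hP => // h hP.
have [Q0 [hQ0 Q0P nPQ0]] := prime_height_ge_pred hP.
have pQ0 := prime_height_ge_prime hQ0.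
have [Q [iQ [pQ Q0Q QP nPQ] maxQ]] := noeth_max (F := fun Q =>
   [/\ prime_ideal Q, subid Q0 Q, subid Q P & ~ subid P Q]) noeA (prime_is_ideal pQ0)
   (And4 pQ0 (fun _ => id) Q0P nPQ0).
have hQ : prime_height_ge Q h.+1.
  have [Q1 [hQ1 Q1Q nQQ1]] := prime_height_ge_pred hQ0.
  apply: prime_height_geS hQ1 => // [x /Q1Q/Q0Q //|sub].
  by apply: nQQ1 => x /Q0Q /sub.
have [pP zP minP'] := minP.
have [z zin nQz] : exists2 z, z \in zs & ~ Q z.
  apply: NNPP => nn; apply: nPQ; apply: minP' => // z zin; apply: NNPP => nz.
  by apply: nn; exists z.
have iQz := ideal_adjP z iQ.
have minPz : minimal_over P (ideal_adj Q z).
  have [|Pm [[pPm sPm minPm] PmP]] := minimal_prime_below noeA iQz pP.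
    by apply: ideal_adj_sub => //; [exact: prime_is_ideal | exact: zP].
  split=> // [|P' pP' QzP' P'P]; first by move=> x /sPm /PmP.
  apply: NNPP => nsub; apply: nQz.
  have : subid P' Q.
    apply: maxQ => //; first exact: prime_is_ideal.
      by split=> // x; move/Q0Q => ?; apply: QzP'; apply: ideal_adjl.
    by move=> x ?; apply: QzP'; apply: ideal_adjl.
  by apply; apply: QzP'; apply: ideal_adj_id.
have nil y : y \in rem z zs -> exists q, Q q /\ exists u t b, ~ P u /\ u * y ^+ t = q + z * b.
  move=> /mem_rem yin.
  have [u [t [nu [b Qb]]]] := minimal_over_nilp noeA iQz minPz (zP _ yin).
  by exists (u * y ^+ t - z * b); split=> //; exists u, t, b; rewrite subrK.
pose q y := if excluded_middle_informative (y \in rem z zs) is left yin then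
  sval (constructive_indefinite_description _ (nil y yin)) else 0.
have qP y : y \in rem z zs -> Q (q y) /\ exists u t b, ~ P u /\ u * y ^+ t = q y + z * b.
  rewrite /q => yin; case: excluded_middle_informative => // yin'.
  exact: (svalP (constructive_indefinite_description _ (nil y yin'))).
apply: (IH Q (map q (rem z zs))) hQ; first by rewrite size_map size_rem // sz.
split=> // [_ /mapP[y yin ->]|Q' pQ' qQ' Q'Q]; first by case: (qP y yin).
apply: (@principal_ideal_thm P Q Q' z) => //.
have iQ' := prime_is_ideal pQ'.
have P'm P' : prime_ideal P' -> subid (ideal_adj Q' z) P' -> subid P' P -> subid P P'.
  move=> pP' sP' P'P; have iP' := prime_is_ideal pP'.
  apply: minP' => // y yin.
  have [->|yz] := eqVneq y z; first by apply: sP'; apply: ideal_adj_id.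
  have yin' : y \in rem z zs.
    by move: yin; rewrite (perm_mem (perm_to_rem zin)) inE (negPf yz).
  have [_ [u [t [b [nu uE]]]]] := qP y yin'.
  have : P' (u * y ^+ t).
    rewrite uE; apply: idealD => //; apply: sP'; last exact: ideal_adjr.
    by apply: ideal_adjl; apply: qQ'; apply: map_f.
  by case/(primeM pP') => [/P'P //|/(primeX pP')].
split=> //; apply: (ideal_adj_sub (prime_is_ideal pP)); [by move=> x /Q'Q/QP | exact: zP].
Qed.

(* Regular sequences modulo [J] up to multipliers in [U]: [U = {1}] gives the usual notion,
   [U = A \ P] regularity after localizing at the prime [P]. *)
Fixpoint lreg (U : A -> Prop) J (zs : seq A) : Prop :=
  if zs is z :: zs' then
    (forall p, J (z * p) -> exists u, U u /\ J (u * p)) /\ lreg U (ideal_adj J z) zs'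
  else True.

Lemma lreg_cat U J s1 s2 : lreg U J (s1 ++ s2) <-> lreg U J s1 /\ lreg U (gens J s1) s2.
Proof. by elim: s1 J => /= [|z s1 IH] J; rewrite ?IH; tauto. Qed.

Lemma lreg_mono (U V : A -> Prop) J zs : subid U V -> lreg U J zs -> lreg V J zs.
Proof.
move=> UV; elim: zs J => //= z zs IH J [zJ /IH]; split=> // p /zJ[u [Uu Ju]].
by exists u; split=> //; apply: UV.
Qed.

(** Take a prime [Q] inside [P] minimal over all elements but the last. Locally at [Q] its members
    are nilpotent modulo those elements, while the last element is regular; so the latter is outside
    [Q], and the height grows by one. *)
Lemma lreg_height P zs : prime_ideal P -> {in zs, forall z, P z} ->
  lreg (fun u => ~ P u) zero_ideal zs -> prime_height_ge P (size zs).
Proof.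
elim/last_ind: zs P => [|zs z IH] P pP zP; first by move=> _; apply: prime_height_ge0.
rewrite -cats1 size_cat addn1 => /lreg_cat[rzs [rz _]].
have iG := gensP zs (@zero_idealP A).
have zP' : {in zs, forall z, P z} by move=> x xin; apply: zP; rewrite mem_rcons inE xin orbT.
have GP : subid (gens zero_ideal zs) P.
  by apply: gens_sub => //; [exact: prime_is_ideal | exact: zero_ideal_sub (prime_is_ideal pP)].
have [Q [minQ QP]] := minimal_prime_below noeA iG pP GP.
have [pQ GQ _] := minQ.
have nQz : ~ Q z.
  move=> Qz; have [u [t [nu]]] := minimal_over_nilp noeA iG minQ Qz.
  elim: t u nu => [|t IHt] u nu; first by rewrite mulr1 => /GQ.
  rewrite exprS mulrCA => /rz[v [nv]]; rewrite mulrA; apply: IHt.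
  by apply: nprimeM => // /QP.
apply: (@prime_height_geS P Q) => //.
  by move=> sub; apply/nQz/sub/zP; rewrite mem_rcons inE eqxx.
apply: IH => // [x xin|]; first by apply: GQ; apply: gens_mem.
by apply: lreg_mono rzs => u nu /QP.
Qed.

End Height.

(** * Polynomial rings: Hilbert's basis theorem and regular primes *)

Section Transfer.
Variables (A D : comNzRingType) (h : {rmorphism A -> D}).

Lemma preim_ideal (J : D -> Prop) : is_ideal J -> is_ideal (fun a => J (h a)).
Proof.
move=> iJ; split=> [|x y Jx Jy|r x Jx]; first by rewrite rmorph0; apply: ideal0.
  by rewrite rmorphD; apply: idealD.
by rewrite rmorphM; apply: idealMl.
Qed.

Lemma preim_prime (Q : D -> Prop) : prime_ideal Q -> prime_ideal (fun a => Q (h a)).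
Proof.
move=> pQ; split; first exact/preim_ideal/prime_is_ideal.
  by rewrite rmorph1; apply: prime1.
by move=> x y; rewrite rmorphM; apply: primeM.
Qed.

Lemma gens_image (J : A -> Prop) (J' : D -> Prop) zs :
  (forall a, J a -> J' (h a)) -> forall a, gens J zs a -> gens J' [seq h z | z <- zs] (h a).
Proof.
elim: zs J J' => //= z zs IH J J' JJ'; apply: IH => a [g /JJ' Jg].
by exists (h g); rewrite -rmorphM -rmorphB.
Qed.

Hypothesis hsurj : forall d, exists a, h a = d.

Lemma noetherian_surj : noetherian A -> noetherian D.
Proof.
move=> noeA I iI; have [n [g gP]] := noeA _ (preim_ideal iI).
exists n, (fun i => h (g i)) => d; split.
  have [a <-] := hsurj d => /(proj1 (gP a))/ideal_of_lin[c ->].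
  apply/ideal_of_lin; exists (fun i => h (c i)); rewrite rmorph_sum.
  by apply: eq_bigr => i _; rewrite rmorphM.
move: d; apply: ideal_of_sub => // i.
by apply: (proj2 (gP (g i))); apply: ideal_of_gen.
Qed.

End Transfer.

(** The localization at [P] is a regular local ring: its maximal ideal is generated by a regular
    sequence. *)
Definition regular_at (A : comNzRingType) (P : A -> Prop) : Prop :=
  exists zs : seq A, [/\ {in zs, forall z, P z}, lreg (fun u => ~ P u) zero_ideal zs &
    forall y, P y -> loc P (gens zero_ideal zs) y].

Definition regular_primes (A : comNzRingType) : Prop :=
  forall P : A -> Prop, prime_ideal P -> regular_at P.

(** [P] is minimal over the sequence that generates it locally, so Krull's height theorem bounds the
    height by the length of the sequence. *)
Lemma regular_at_height (A : comNzRingType) (P : A -> Prop) n : noetherian A ->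
  prime_ideal P -> regular_at P -> prime_height_ge P n ->
  exists zs : seq A, [/\ (n <= size zs)%N, {in zs, forall z, P z},
    lreg (fun u => ~ P u) zero_ideal zs & forall y, P y -> loc P (gens zero_ideal zs) y].
Proof.
move=> noeA pP [zs [zP zreg zgen]] hP; exists zs; split=> //.
apply: krull_height hP => //; split=> // P' pP' zP' P'P y /zgen[u [nu]].
have iP' := prime_is_ideal pP'.
move/(gens_sub iP' (zero_ideal_sub iP') zP')/(primeM pP')=> [/P'P|] //.
Qed.

Section TransferRegular.
Variables (A D : comNzRingType) (h : {rmorphism A -> D}) (g : D -> A).
Hypotheses (hK : cancel h g) (gK : cancel g h).

Lemma gens_iso (J : A -> Prop) (J' : D -> Prop) zs :
  (forall a, J' (h a) <-> J a) ->
  forall a, gens J' [seq h z | z <- zs] (h a) <-> gens J zs a.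
Proof.
elim: zs J J' => //= z zs IH J J' JJ'; apply: IH => a; split.
  by move=> [d]; rewrite -[d]gK -rmorphM -rmorphB => /JJ'; exists (g d).
by move=> [b Jb]; exists (h b); rewrite -rmorphM -rmorphB; apply/JJ'.
Qed.

Lemma lreg_iso (J : A -> Prop) (J' : D -> Prop) (U : A -> Prop) (U' : D -> Prop) zs :
  (forall a, U a -> U' (h a)) ->
  (forall a, J' (h a) <-> J a) -> lreg U J zs -> lreg U' J' [seq h z | z <- zs].
Proof.
move=> UU'; elim: zs J J' => //= z zs IH J J' JJ' [zJ reg]; split.
  move=> p; rewrite -[p]gK -rmorphM => /JJ' /zJ[u [Uu Ju]].
  by exists (h u); split; [apply: UU' | rewrite -rmorphM; apply/JJ'].
apply: IH reg => a; exact: (@gens_iso J J' [:: z]).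
Qed.

Lemma regular_primes_iso : regular_primes A -> regular_primes D.
Proof.
move=> regA Q pQ; have [zs [zP zreg zgen]] := regA _ (preim_prime h pQ).
have z0 a : zero_ideal (h a) <-> zero_ideal a.
  by split=> [h0|->]; [apply: (can_inj hK); rewrite rmorph0 | rewrite /zero_ideal rmorph0].
exists [seq h z | z <- zs]; split=> [_ /mapP[z /zP Qz ->] //||y].
  exact: lreg_iso zreg.
rewrite -[y]gK => /zgen[u [nu uy]]; exists (h u); split=> //.
by rewrite -rmorphM; apply/gens_iso; first exact: z0.
Qed.

End TransferRegular.

Section PolynomialRing.
Variable A : comNzRingType.
Implicit Types (J P : A -> Prop) (p q : {poly A}).

Lemma loc_uniform P J (n : nat) (F : nat -> A) : prime_ideal P -> is_ideal J ->
  (forall i, (i < n)%N -> loc P J (F i)) ->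
  exists u, ~ P u /\ forall i, (i < n)%N -> J (u * F i).
Proof.
move=> pP iJ; elim: n => [|n IH] JF; first by exists 1; split=> //; apply: prime1.
have [|u [nu Ju]] := IH; first by move=> i lt; apply: JF; apply: ltnW.
have [v [nv Jv]] := JF n (ltnSn n).
exists (v * u); split; first exact: nprimeM.
move=> i; rewrite ltnS leq_eqVlt => /predU1P[->|/Ju Jui].
  by rewrite mulrAC; apply: idealMr.
by rewrite -mulrA; apply: idealMl.
Qed.

Lemma noetherian_seq (D : comNzRingType) :
  (forall I : D -> Prop, is_ideal I -> exists zs : seq D,
     {in zs, forall z, I z} /\ subid I (gens zero_ideal zs)) -> noetherian D.
Proof.
move=> H I iI; have [zs [zI sub]] := H I iI.
exists (size zs), (fun i => zs`_i) => x; split=> [/sub|].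
  apply: gens_sub; [exact: ideal_ofP | exact: zero_ideal_sub (ideal_ofP _) |].
  move=> z /(nthP 0)[i lt <-].
  by apply: ideal_gen_incl; exists (Ordinal lt).
by move: x; apply: ideal_of_sub => // i; apply: zI; rewrite mem_nth.
Qed.

Lemma gens_catl (D : comNzRingType) (s1 s2 : seq D) :
  subid (gens zero_ideal s1) (gens zero_ideal (s1 ++ s2)).
Proof. by rewrite gens_cat; apply/gensl/gensP. Qed.

Lemma gens_catr (D : comNzRingType) (s1 s2 : seq D) :
  subid (gens zero_ideal s2) (gens zero_ideal (s1 ++ s2)).
Proof.
have i0 := @zero_idealP D.
apply: gens_sub; [exact: gensP | exact: zero_ideal_sub (gensP _ _) |].
by move=> z zin; apply: gens_mem => //; rewrite mem_cat zin orbT.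
Qed.

(** Finitely many elements of [I] have leading coefficients generating the ideal of all leading
    coefficients; [N] bounds their degrees, and they reduce every element of degree at least [N].
    The elements of degree below [N] are generated degree by degree. *)
Theorem hilbert_basis : noetherian A -> noetherian {poly A}.
Proof.
move=> noeA; apply: noetherian_seq => I iI.
have i0 := @zero_idealP {poly A}.
pose lead d c := exists p, [/\ I p, (size p <= d.+1)%N & p`_d = c].
have leadP d : is_ideal (lead d).
  split=> [|x y [p [Ip sp <-]] [q [Iq sq <-]]|r x [p [Ip sp <-]]].
  - by exists 0; rewrite size_poly0 coef0; split=> //; apply: ideal0.
  - exists (p + q); rewrite coefD; split=> //; first exact: idealD.
    by rewrite (leq_trans (size_polyD _ _)) // geq_max sp.
  - exists (r%:P * p); rewrite coefCM; split=> //; first exact: idealMl.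
    by rewrite mul_polyC (leq_trans (size_scale_leq _ _)).
have low d : exists zs, {in zs, forall z, I z} /\
    forall p, I p -> (size p <= d)%N -> gens zero_ideal zs p.
  elim: d => [|d [zs [zI zP]]].
    exists [::]; split=> // p _; rewrite leqn0 size_poly_eq0 => /eqP->.
    exact: ideal0.
  have [n [g gP]] := noeA _ (leadP d).
  have /fin_all_exists[q qP] : forall i, lead d (g i).
    by move=> i; apply: (proj2 (gP (g i))); apply: ideal_of_gen.
  exists (zs ++ [seq q i | i <- enum 'I_n]); split=> [z|p Ip sp].
    by rewrite mem_cat => /orP[/zI//|/mapP[i _ ->]]; case: (qP i).
  have /(proj1 (gP _))/ideal_of_lin[c cE] : lead d p`_d by exists p.
  apply: (@idealBl _ _ p (\sum_i (c i)%:P * q i)).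
  - exact: gensP.
  - apply: gens_catr; apply: ideal_bigsum; first exact: gensP.
    move=> i _; apply: idealMl; first exact: gensP.
    by apply: gens_mem => //; apply: map_f; rewrite mem_enum.
  - apply: gens_catl; apply: zP.
      apply: idealB => //; apply: ideal_bigsum => // i _; apply: idealMl => //.
      by case: (qP i).
    apply/leq_sizeP => j; rewrite leq_eqVlt coefB coef_sum => /predU1P[<-|lt].
      rewrite cE -sumrB big1 // => i _; rewrite coefCM.
      by case: (qP i) => _ _ ->; rewrite subrr.
    rewrite nth_default ?(leq_trans sp) // big1 ?subrr // => i _.
    by rewrite coefCM nth_default ?mulr0 //; case: (qP i) => _ /leq_trans->.
have iU : is_ideal (fun c => exists d, lead d c).
  split=> [|x y [d [p [Ip sp <-]]] [e [q [Iq sq <-]]]|r x [d Lx]].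
  - by exists 0%N; apply: ideal0.
  - exists (d + e)%N, (p * 'X^e + q * 'X^d); split.
    + by apply: idealD => //; apply: idealMr.
    + rewrite (leq_trans (size_polyD _ _)) // geq_max; apply/andP.
      split; apply: (leq_trans (size_polyMleq _ _)); rewrite size_polyXn addnS /=.
        by rewrite -addSn leq_add2r.
      by rewrite addnC -addnS leq_add2l.
    + by rewrite coefD !coefMXn !ltnNge leq_addl leq_addr /= addnK addnC addnK.
  - by exists d; apply: idealMl.
have [n [g gP]] := noeA _ iU.
have /fin_all_exists[e /fin_all_exists[q qP]] : forall i, exists d, lead d (g i).
  by move=> i; apply: (proj2 (gP (g i))); apply: ideal_of_gen.
pose N := (\max_i e i)%N.
have [zs [zI zP]] := low N.
exists (zs ++ [seq q i | i <- enum 'I_n]); split=> [z|p].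
  by rewrite mem_cat => /orP[/zI//|/mapP[i _ ->]]; case: (qP i).
have [d] := ubnP (size p); elim: d p => // d IH p; rewrite ltnS => sp Ip.
have [le|lt] := leqP (size p) N; first by apply: gens_catl; apply: zP.
case sE: (size p) sp lt => [|l] // sp lt.
have /(proj1 (gP _))/ideal_of_lin[c cE] : exists d, lead d p`_l.
  by exists l, p; rewrite sE.
have le_e i : (e i <= l)%N by rewrite -ltnS (leq_ltn_trans _ lt) // /N (bigmax_sup i).
apply: (@idealBl _ _ p (\sum_i ((c i)%:P * 'X^(l - e i)) * q i)).
- exact: gensP.
- apply: gens_catr; apply: ideal_bigsum; first exact: gensP.
  move=> i _; apply: idealMl; first exact: gensP.
  by apply: gens_mem => //; apply: map_f; rewrite mem_enum.
- apply: IH; last first.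
    apply: idealB => //; apply: ideal_bigsum => // i _; apply: idealMl => //.
    by case: (qP i).
  apply: leq_ltn_trans sp; apply/leq_sizeP => j.
  rewrite leq_eqVlt coefB coef_sum => /predU1P[<-|ltj].
    rewrite cE -sumrB big1 // => i _; rewrite -mulrA coefCM mulrC mulrC coefXnM.
    rewrite ltnNge leq_subr /= subKn //.
    by case: (qP i) => _ _ ->; rewrite subrr.
  rewrite nth_default ?sE // big1 ?subrr // => i _.
  rewrite -mulrA coefCM coefXnM; case: ltnP => [_|_]; rewrite ?mulr0 //.
  rewrite nth_default ?mulr0 //; case: (qP i) => _ /leq_trans-> //.
  by move: (le_e i); lia.
Qed.

Lemma gens_polyC J (J' : {poly A} -> Prop) zs : is_ideal J ->
  (forall f, J' f <-> forall i, J f`_i) ->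
  forall f, gens J' [seq z%:P | z <- zs] f <-> forall i, gens J zs f`_i.
Proof.
elim: zs J J' => //= z zs IH J J' iJ JJ'; apply: IH; first exact: ideal_adjP.
move=> f; split=> [[g /JJ' Jg] i|Jf].
  by exists g`_i; move: (Jg i); rewrite coefB coefCM.
pose g i := if excluded_middle_informative (ideal_adj J z f`_i) is left pf then
  sval (constructive_indefinite_description _ pf) else 0.
have gP i : J (f`_i - z * g i).
  rewrite /g; case: excluded_middle_informative => [pf|/(_ (Jf i))//].
  exact: (svalP (constructive_indefinite_description _ pf)).
exists (\poly_(i < size f) g i); apply/JJ' => i; rewrite coefB coefCM coef_poly.
case: ltnP => // le; rewrite nth_default // mulr0 subr0; exact: ideal0.
Qed.

Lemma lreg_polyC P J (J' : {poly A} -> Prop) (U' : {poly A} -> Prop) zs :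
  prime_ideal P -> is_ideal J ->
  (forall u, ~ P u -> U' u%:P) -> (forall f, J' f <-> forall i, J f`_i) ->
  lreg (fun u => ~ P u) J zs -> lreg U' J' [seq z%:P | z <- zs].
Proof.
move=> pP + UU'; elim: zs J J' => //= z zs IH J J' iJ JJ' [zJ reg]; split; last first.
  apply: IH reg => [|f]; first exact: ideal_adjP.
  exact: (@gens_polyC J J' [:: z]).
move=> f /JJ' Jf.
have [|u [nu Ju]] := @loc_uniform P J (size f) (fun i => f`_i) pP iJ.
  by move=> i _; apply: zJ; move: (Jf i); rewrite coefCM.
exists u%:P; split; first exact: UU'.
apply/JJ' => i; rewrite coefCM; case: (ltnP i (size f)) => [|le]; first exact: Ju.
by rewrite nth_default // mulr0; apply: ideal0.
Qed.

(** With [P] the contraction of [Q], either [Q] is the extension of [P] and the sequence for [P]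
    suffices, or one more element is needed: a polynomial [f] of least degree in [Q] having a
    coefficient outside [P], which generates [Q] on the fibre over [P]. *)
Theorem regular_primes_poly : regular_primes A -> regular_primes {poly A}.
Proof.
move=> regA Q pQ; have iQ := prime_is_ideal pQ.
pose P (a : A) := Q a%:P.
have pP : prime_ideal P := preim_prime (polyC : {rmorphism A -> {poly A}}) pQ.
have iP := prime_is_ideal pP.
have [zs [zP zreg zgen]] := regA P pP.
have z0 (f : {poly A}) : zero_ideal f <-> forall i, zero_ideal f`_i.
  by split=> [-> i|f0]; [rewrite /zero_ideal coef0 | apply/polyP => i; rewrite coef0 f0].
pose PA (f : {poly A}) := forall i, P f`_i.
have PAQ f : PA f -> Q f.
  move=> Pf; rewrite -[f]coefK poly_def; apply: ideal_bigsum => // i _.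
  by rewrite -mul_polyC; apply: idealMr => //; apply: Pf.
have PAloc f : PA f -> exists u, ~ P u /\ gens zero_ideal [seq z%:P | z <- zs] (u%:P * f).
  move=> Pf; have [|u [nu gu]] := @loc_uniform P (gens zero_ideal zs) (size f)
    (fun i => f`_i) pP (gensP _ (@zero_idealP A)).
    by move=> i _; apply: zgen.
  exists u; split=> //; apply/(gens_polyC _ (@zero_idealP A) z0) => i.
  rewrite coefCM; case: (ltnP i (size f)) => [|le]; first exact: gu.
  by rewrite nth_default // mulr0; exact: (ideal0 (gensP _ (@zero_idealP A))).
have zreg' : lreg (fun u => ~ Q u) zero_ideal [seq z%:P | z <- zs].
  by apply: (lreg_polyC (P := P) (J := zero_ideal)) zreg.
have zQ : {in [seq z%:P | z <- zs], forall z, Q z} by move=> _ /mapP[z /zP Pz ->].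
have i0 := @zero_idealP {poly A}.
case: (classic (subid Q PA)) => [sub|nsub].
  exists [seq z%:P | z <- zs]; split=> // y /sub /PAloc[u [nu gu]].
  by exists u%:P.
have [d [f [Qf nf sf minf]]] : exists d f, [/\ Q f, ~ PA f, size f = d &
    forall g, Q g -> (size g < d)%N -> PA g].
  have : exists d f, [/\ Q f, ~ PA f & size f = d].
    apply: NNPP => nn; apply: nsub => f Qf; apply: NNPP => nf; apply: nn.
    by exists (size f), f.
  move=> [d]; have [n] := ubnP d; elim: n d => // n IH d; rewrite ltnS => dn [f [Qf nf sf]].
  case: (classic (exists g, [/\ Q g, ~ PA g & (size g < d)%N])) => [[g [Qg ng lt]]|nn].
    by apply: (IH (size g)); [apply: leq_trans lt dn | exists g].
  exists d, f; split=> // g Qg lt; apply: NNPP => ng; apply: nn; by exists g.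
(* Were the leading coefficient in [P], dropping the leading term would leave a smaller polynomial
   of the same kind. *)
have nlead : ~ P (lead_coef f).
  move=> Pl; apply: (nf).
  have Ql : Q ((lead_coef f)%:P * 'X^((size f).-1)) by apply: idealMr.
  have fn0 : f != 0.
    by apply/eqP => f0; apply: (nf) => i; rewrite f0 coef0; apply: ideal0.
  have lt : (size (f - (lead_coef f)%:P * 'X^((size f).-1))%R < d)%N.
    have lt0 : (0 < size f)%N by rewrite size_poly_gt0.
    rewrite -sf -(prednK lt0) ltnS; apply/leq_sizeP => j; rewrite leq_eqVlt.
    rewrite coefB coefCM coefXn => /predU1P[<-|lt]; first by rewrite eqxx mulr1 subrr.
    by rewrite gtn_eqF // mulr0 subr0 nth_default // -(prednK lt0).
  have PAd := minf _ (idealB iQ Qf Ql) lt.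
  move=> i; have := PAd i; rewrite coefB => Pi; apply: (idealBl iP _ Pi).
  by rewrite coefCM; apply: idealMr.
exists ([seq z%:P | z <- zs] ++ [:: f]); split.
- by move=> z; rewrite mem_cat inE => /orP[/zQ//|/eqP->].
- apply/lreg_cat; split=> //=; split=> // g.
  move/(gens_polyC _ (@zero_idealP A) z0) => fg.
  (* The extension [PA] of [P] is prime, by comparison of the first coefficients outside [P], and
     [f] is not in it. So [g] is in [PA], which the lifted sequence generates locally. *)
  have : PA g.
    have PAfg : PA (f * g).
      move=> i; by apply: gens_sub (fg i) => //; exact: zero_ideal_sub iP.
    case: (classic (PA g)) => // ng.
    have ex h : ~ PA h -> exists i, ~ P h`_i /\ forall j, (j < i)%N -> P h`_j.
      move=> nh; have [i ni] : exists i, ~ P h`_i by apply: not_all_ex_not.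
      have [n] := ubnP i; elim: n i ni => // n IH i ni; rewrite ltnS => le.
      case: (classic (exists j, (j < i)%N /\ ~ P h`_j)) => [[j [lt nj]]|nn].
        by apply: (IH j) => //; apply: leq_trans lt le.
      exists i; split=> // j lt; apply: NNPP => nj; apply: nn; by exists j.
    have [i [ni li]] := ex f nf; have [j [nj lj]] := ex g ng.
    have := PAfg (i + j)%N; rewrite coefM.
    have lti : (i < (i + j).+1)%N by lia.
    rewrite (bigD1 (Ordinal lti)) //= addKn => Psum.
    case: (nprimeM pP ni nj).
    set s := (X in P (_ + X)) in Psum; rewrite -[_ * _](addrK s).
    apply: idealB => //; apply: ideal_bigsum => // l; rewrite -val_eqE /= => li'.
    case: (ltngtP l i) li' => // lt _; first by apply: idealMr => //; apply: li.
    by apply: idealMl => //; apply: lj; have := ltn_ord l; lia.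
  by move=> /PAloc[u [nu gu]]; exists u%:P.
- move=> g Qg; rewrite gens_cat /=.
  (* Pseudo-division multiplies [g] by a power of the leading coefficient of [f], which is outside
     [P]; the remainder is in [Q] and of smaller degree, hence in [PA]. *)
  have dE := Pdiv.ComRing.rdivp_eq f g.
  set c := lead_coef f ^+ _ in dE; set q := Pdiv.Ring.rdivp g f in dE.
  set rem := Pdiv.Ring.rmodp g f in dE.
  have Qrem : Q rem.
    have -> : rem = c%:P * g - q * f by rewrite mul_polyC dE addrC addKr.
    by apply: idealB => //; apply: idealMl.
  have fn0 : f != 0.
    by apply/eqP => f0; apply: (nf) => i; rewrite f0 coef0; apply: ideal0.
  have [|u [nu gu]] := PAloc rem.
    by apply: minf => //; rewrite -sf Pdiv.Ring.ltn_rmodpN0.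
  exists (u * c)%:P; split; first exact: (nprimeM pP nu (nprimeX pP nlead)).
  exists (u%:P * q); have -> : (u * c)%:P * g - f * (u%:P * q) = u%:P * rem.
    by rewrite polyCM -mulrA [c%:P * g]mul_polyC dE; ring.
  exact: gu.
Qed.

End PolynomialRing.

(** * Several variables, by adding one variable at a time *)

Section MpolyRing.

Local Notation widen := (widen_ord (leqnSn _)).

Lemma mpoly_rmorph_ext (A D : comNzRingType) n (g h : {rmorphism {mpoly A[n]} -> D}) :
  (forall c, g c%:MP = h c%:MP) -> (forall i, g 'X_i = h 'X_i) -> g =1 h.
Proof.
move=> ghC ghX p; rewrite [p]mpolyE !rmorph_sum; apply: eq_bigr => m _.
rewrite -mul_mpolyC !rmorphM ghC mpolyXE_id !rmorph_prod; congr (_ * _).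
by apply: eq_bigr => i _; rewrite !rmorphXn /= ghX.
Qed.

Variables (A : comNzRingType) (n : nat).

Definition mpoly_of_poly : {rmorphism {poly {mpoly A[n]}} -> {mpoly A[n.+1]}} :=
  horner_eval ('X_ord_max : {mpoly A[n.+1]}) \o map_poly (@mwiden n A).

Lemma mpoly_of_polyC c : mpoly_of_poly c%:P = mwiden c.
Proof. by rewrite /= map_polyC /horner_eval hornerC. Qed.

Lemma mpoly_of_polyX : mpoly_of_poly 'X = 'X_ord_max.
Proof. by rewrite /= map_polyX /horner_eval hornerX. Qed.

Lemma muni_ord_max : muni ('X_ord_max : {mpoly A[n.+1]}) = 'X.
Proof.
rewrite muniE msuppX big_seq1 mcoeffX eqxx scale1r mnm1E eqxx expr1.
rewrite [X in 'X_[X]](_ : _ = 0%MM) ?mpolyX0 ?scale1r //.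
by apply/mnmP => i; rewrite mnmE mnm1E mnm0E -val_eqE /= gtn_eqF.
Qed.

Lemma muni_widen i : muni ('X_(widen i) : {mpoly A[n.+1]}) = ('X_i)%:P.
Proof.
rewrite muniE msuppX big_seq1 mcoeffX eqxx scale1r mnm1E -val_eqE /= ltn_eqF // expr0.
rewrite [X in 'X_[X]](_ : _ = U_(i))%MM ?alg_polyC //.
by apply/mnmP => j; rewrite mnmE !mnm1E -!val_eqE.
Qed.

Lemma mwidenXU i : mwiden ('X_i : {mpoly A[n]}) = 'X_(widen i).
Proof. by rewrite mwidenX mnmwiden1. Qed.

Lemma mpoly_of_polyK : cancel mpoly_of_poly (@muni n A).
Proof.
move=> p; have muni_mw (c : {mpoly A[n]}) : muni (mwiden c) = c%:P.
  apply: (@mpoly_rmorph_ext A _ n (@muni n A \o @mwiden n A) (polyC : {rmorphism _ -> _})) => [a|i] /=.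
    by rewrite mwidenC muniC.
  by rewrite mwidenXU muni_widen.
rewrite -[p]coefK poly_def !rmorph_sum; apply: eq_bigr => i _.
rewrite -mul_polyC rmorphM rmorphXn mpoly_of_polyC mpoly_of_polyX.
by rewrite rmorphM rmorphXn [X in X * _]muni_mw [X in _ * X ^+ _]muni_ord_max.
Qed.

Lemma muniK : cancel (@muni n A) mpoly_of_poly.
Proof.
apply: (@mpoly_rmorph_ext A _ n.+1 (mpoly_of_poly \o @muni n A) idfun) => [a|i].
  change (mpoly_of_poly (muni (a%:MP : {mpoly A[n.+1]})) = a%:MP).
  by rewrite muniC mpoly_of_polyC mwidenC.
change (mpoly_of_poly (muni ('X_i : {mpoly A[n.+1]})) = 'X_i).
have [j ->|->] := unliftP ord_max i; last by rewrite muni_ord_max mpoly_of_polyX.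
have -> : lift ord_max j = widen j by apply: val_inj; rewrite /= /bump leqNgt ltn_ord.
by rewrite muni_widen mpoly_of_polyC mwidenXU.
Qed.

End MpolyRing.

Lemma mpoly0E (A : comNzRingType) (p : {mpoly A[0]}) : (p@_0%MM)%:MP = p.
Proof.
apply/mpolyP => m; have -> : m = 0%MM by apply/mnmP; case.
by rewrite mcoeffC eqxx mulr1.
Qed.

Theorem noetherian_mpoly (A : comNzRingType) n : noetherian A -> noetherian {mpoly A[n]}.
Proof.
move=> noeA; elim: n => [|n IH].
  apply: (noetherian_surj (h := @mpolyC 0 A)) => // p.
  by exists p@_0%MM; apply: mpoly0E.
apply: (noetherian_surj (h := mpoly_of_poly A n)); last exact: hilbert_basis.
by move=> p; exists (muni p); apply: muniK.
Qed.

Theorem regular_primes_mpoly (A : comNzRingType) n :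
  regular_primes A -> regular_primes {mpoly A[n]}.
Proof.
move=> regA; elim: n => [|n IH].
  apply: (regular_primes_iso (h := @mpolyC 0 A) (g := mcoeff 0%MM)) => // [a|p].
    by rewrite mcoeffC eqxx mulr1.
  exact: mpoly0E.
apply: (regular_primes_iso (h := mpoly_of_poly A n) (g := @muni n A)).
- exact: mpoly_of_polyK.
- exact: muniK.
- exact: regular_primes_poly.
Qed.

Lemma field_ideal (k : fieldType) (I : k -> Prop) x : is_ideal I -> ~ I 1 -> I x -> x = 0.
Proof.
move=> iI n1 Ix; apply/eqP/negP => /negP nx; apply: n1.
by rewrite -(mulVf nx); apply: idealMl.
Qed.

Lemma noetherian_field (k : fieldType) : noetherian k.
Proof.
apply: noetherian_seq => I iI; case: (classic (I 1)) => I1; last first.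
  exists [::]; split=> // x Ix; exact: field_ideal Ix.
exists [:: 1]; split=> [z|x _] /=; first by rewrite inE => /eqP->.
by exists x; rewrite mul1r subrr.
Qed.

Lemma regular_primes_field (k : fieldType) : regular_primes k.
Proof.
move=> P pP; exists [::]; split=> // y Py; exists 1; split; first exact: prime1.
rewrite (field_ideal (prime_is_ideal pP) (prime1 pP) Py) mulr0 //.
Qed.

(** * Rank of a matrix modulo a prime *)

Section ResidueField.
Variables (B : comNzRingType) (q : B -> Prop).
Hypothesis pq : prime_ideal q.

(** Boolean by excluded middle, since the quotient construction takes a boolean predicate. *)
Definition prime_pred : {pred B} :=
  fun b => if excluded_middle_informative (q b) then true else false.

Lemma prime_predP b : reflect (q b) (b \in prime_pred).
Proof.
by rewrite unfold_in; case: excluded_middle_informative => h; constructor.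
Qed.

Lemma prime_pred_idealr_closed : idealr_closed prime_pred.
Proof.
have iq := prime_is_ideal pq; split.
- by apply/prime_predP; apply: ideal0.
- by apply/prime_predP; apply: prime1.
- move=> x u v /prime_predP qu /prime_predP qv; apply/prime_predP.
  by apply: idealD => //; apply: idealMl.
Qed.

Lemma prime_pred_prime : prime_idealr_closed prime_pred.
Proof. by move=> u v /prime_predP/(primeM pq)[]/prime_predP->; rewrite ?orbT. Qed.

HB.instance Definition _ := isIdealr.Build B prime_pred prime_pred_idealr_closed.
HB.instance Definition _ := isPrimeIdealrClosed.Build B prime_pred prime_pred_prime.

Definition residue_domain := {ideal_quot prime_pred}.
HB.instance Definition _ := GRing.ComNzRing.on residue_domain.

(** The fraction field is built over a domain that carries units and inverses; those of the quotient
    are chosen classically. *)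
Definition residue_unit : pred residue_domain :=
  fun x => if excluded_middle_informative (exists y, y * x = 1) then true else false.

Lemma residue_unitP x : reflect (exists y, y * x = 1) (residue_unit x).
Proof. by rewrite /residue_unit; case: excluded_middle_informative => h; constructor. Qed.

Definition residue_inv (x : residue_domain) : residue_domain :=
  if excluded_middle_informative (exists y, y * x = 1) is left e
  then sval (constructive_indefinite_description _ e) else x.

Lemma residue_mulVx : {in residue_unit, left_inverse 1 residue_inv *%R}.
Proof.
move=> x /residue_unitP ex; rewrite /residue_inv; case: excluded_middle_informative => // e.
exact: (svalP (constructive_indefinite_description _ e)).
Qed.

Lemma residue_unitPl x y : y * x = 1 -> residue_unit x.
Proof. by move=> yx; apply/residue_unitP; exists y. Qed.

Lemma residue_inv_out : {in [predC residue_unit], residue_inv =1 id}.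
Proof.
move=> x; rewrite inE => /residue_unitP nx; rewrite /residue_inv.
by case: excluded_middle_informative.
Qed.

HB.instance Definition _ := GRing.ComNzRing_hasMulInverse.Build residue_domain
  residue_mulVx residue_unitPl residue_inv_out.
HB.instance Definition _ := GRing.ComUnitRing_isIntegral.Build residue_domain
  (@Quotient.rquot_IdomainAxiom B prime_pred).

(** The fraction field of [B / q]. The second property, fractions with denominators outside [q],
    serves to clear denominators of polynomials over it. *)
Lemma residue_field : exists (K : fieldType) (p : {rmorphism B -> K}),
  (forall b, p b = 0 <-> q b) /\
  (forall x : K, exists a b, ~ q b /\ x * p b = p a).
Proof.
pose D : idomainType := residue_domain.
pose p1 : {rmorphism B -> residue_domain} := \pi_{ideal_quot prime_pred}%qT.
pose p2 : {rmorphism D -> {fraction D}} := @FracField.tofrac D.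
have p1E b : p1 b = 0 <-> q b.
  rewrite -(rmorph0 p1); split=> [/eqP|qb].
    by rewrite -Quotient.idealrBE subr0 => /prime_predP.
  by apply/eqP; rewrite -Quotient.idealrBE subr0; apply/prime_predP.
have p2E d : p2 d = 0 <-> d = 0.
  by split=> [/eqP|->]; [rewrite tofrac_eq0 => /eqP | rewrite rmorph0].
have surj (d : D) : exists b, p1 b = d.
  by exists (generic_quotient.repr (d : {ideal_quot prime_pred})); apply: reprK.
exists {fraction D}, (p2 \o p1); split=> [b|x]; first by rewrite -p1E -p2E.
have [y ->] : exists y : {ratio D}, x = \pi_({fraction D})%qT y by exists (generic_quotient.repr x); rewrite generic_quotient.reprK.
have [a aE] := surj \n_y; have [b bE] := surj \d_y.
exists a, b; split.
  by move/p1E; rewrite bE => /eqP; apply/negP; exact: denom_ratioP.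
rewrite /= aE bE /p2 /=; unlock FracField.tofrac; rewrite -[LHS]FracField.pi_mul.
apply/eqmodP; rewrite /= FracField.equivfE /FracField.mulf.
by rewrite !numden_Ratio ?(oner_neq0, mulr1, denom_ratioP) //= mulrC.
Qed.

End ResidueField.

Section RankSelection.
Variables (B : comNzRingType) (K : fieldType) (p : {rmorphism B -> K}).
Variables (r s : nat) (psi : 'M[B]_(r, s)).
Let rho := \rank (map_mx p psi).

(** Choose independent rows [I] and, within them, independent columns [J]. All rows of the reduced
    matrix [A] are combinations [D] of the rows [I], so [colsub J A = D *m mxsub I J A]; multiplying
    by the adjugate eliminates [D]. *)
Lemma rank_minor : exists (I : 'I_rho -> 'I_r) (J : 'I_rho -> 'I_s),
  [/\ injective I, injective J, p (\det (mxsub I J psi)) != 0 &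
   forall i j, p (\det (mxsub I J psi) * psi i j) =
     p ((colsub J psi *m \adj (mxsub I J psi) *m rowsub I psi) i j)].
Proof.
pose A := map_mx p psi; pose I := maxrankfun A; pose A1 := rowsub I A.
have A1free : row_free A1 := maxrowsub_free A.
have A1full : row_full A1^T by rewrite /row_full mxrank_tr.
pose J := fullrankfun A1full.
have Ju : rowsub J A1^T \in unitmx := fullrowsub_unit A1full.
have ME : mxsub I J A = (rowsub J A1^T)^T by apply/matrixP => i j; rewrite !mxE.
have Mu : mxsub I J A \in unitmx by rewrite ME unitmx_tr.
have /submxP[D DE] : (A <= A1)%MS by rewrite (eq_maxrowsub A).
exists I, J; split; [exact: maxrankfun_inj | exact: fullrankfun_inj | |].
  by rewrite -det_map_mx map_mxsub -unitfE -unitmxE.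
have key : \det (mxsub I J A) *: A = colsub J A *m \adj (mxsub I J A) *m A1.
  have cE : colsub J A = D *m mxsub I J A.
    have -> : mxsub I J A = colsub J A1 by rewrite mxsubcr.
    by rewrite mulmx_colsub -DE.
  by rewrite cE -[D *m _ *m _]mulmxA mul_mx_adj -scalemx1 -scalemxAr mulmx1 -scalemxAl -DE.
have keyM : map_mx p (colsub J psi *m \adj (mxsub I J psi) *m rowsub I psi) =
    colsub J A *m \adj (mxsub I J A) *m A1.
  by rewrite !map_mxM map_mx_adj !map_mxsub.
move=> i j; rewrite rmorphM -det_map_mx map_mxsub -/A.
by have /matrixP/(_ i j) := key; rewrite -keyM !mxE.
Qed.

Lemma minor_rank_lt n (I : 'I_n -> 'I_r) (J : 'I_n -> 'I_s) :
  (rho < n)%N -> p (\det (mxsub I J psi)) = 0.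
Proof.
move=> lt; apply/eqP; rewrite -det_map_mx map_mxsub; apply: contraTT lt.
rewrite -unitfE -unitmxE -row_free_unit -leqNgt => /eqP <-.
have -> : mxsub I J (map_mx p psi) = rowsub I (colsub J (map_mx p psi)) by rewrite mxsubrc.
apply: leq_trans (mxrankS (rowsub_sub _ _)) _.
rewrite -mxrank_tr /rho -[X in (_ <= X)%N]mxrank_tr.
have -> : (colsub J (map_mx p psi))^T = rowsub J (map_mx p psi)^T by apply/matrixP => i j; rewrite !mxE.
exact/mxrankS/rowsub_sub.
Qed.

End RankSelection.

(** * Families independent over the base field modulo an ideal *)

Section GensMore.
Variable A : comNzRingType.
Implicit Types (J U : A -> Prop) (zs : seq A).

Lemma gens_lin J zs x : is_ideal J ->
  gens J zs x <-> exists h : nat -> A, J (x - \sum_(t < size zs) zs`_t * h t).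
Proof.
elim: zs J x => [|z zs IH] J x iJ /=.
  by split=> [Jx|[h]]; [exists (fun=> 0) | ]; rewrite big_ord0 subr0.
rewrite (IH _ _ (ideal_adjP z iJ)); split=> [[h [g Jg]]|[h Jh]].
  exists (fun t => if t is t'.+1 then h t' else g).
  by rewrite big_ord_recl /= opprD addrA addrAC.
exists (fun t => h t.+1), (h 0%N).
by move: Jh; rewrite big_ord_recl /= opprD addrA addrAC.
Qed.

Lemma lreg_rcons U J zs z : lreg U J (rcons zs z) <->
  lreg U J zs /\ (forall p, gens J zs (z * p) -> exists u, U u /\ gens J zs (u * p)).
Proof. by rewrite -cats1 lreg_cat /=; tauto. Qed.

Lemma lreg_nth U J zs :
  (forall i, (i < size zs)%N -> forall p, gens J (take i zs) (zs`_i * p) ->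
     exists u, U u /\ gens J (take i zs) (u * p)) -> lreg U J zs.
Proof.
elim/last_ind: zs => // zs z IH H; apply/lreg_rcons; split.
  apply: IH => i lt p; have := H i; rewrite size_rcons ltnS => /(_ (ltnW lt) p).
  by rewrite nth_rcons lt -cats1 takel_cat ?(ltnW lt).
have := H (size zs); rewrite size_rcons ltnSn nth_rcons ltnn eqxx -cats1 take_size_cat //.
by apply.
Qed.

Lemma gens_mpolyC n J (J' : {mpoly A[n]} -> Prop) zs : is_ideal J ->
  (forall f, J' f <-> forall m, J f@_m) ->
  forall f, gens J' [seq z%:MP | z <- zs] f <-> forall m, gens J zs f@_m.
Proof.
elim: zs J J' => //= z zs IH J J' iJ JJ'; apply: IH; first exact: ideal_adjP.
move=> f; split=> [[g /JJ' Jg] m|Jf].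
  by exists g@_m; move: (Jg m); rewrite mcoeffB mcoeffCM.
pose g m := if excluded_middle_informative (ideal_adj J z f@_m) is left pf then
  sval (constructive_indefinite_description _ pf) else 0.
have gP m : J (f@_m - z * g m).
  rewrite /g; case: excluded_middle_informative => [pf|/(_ (Jf m))//].
  exact: (svalP (constructive_indefinite_description _ pf)).
exists (\sum_(m <- msupp f) g m *: 'X_[m]); apply/JJ' => m.
rewrite mcoeffB mcoeffCM raddf_sum /=.
case: (boolP (m \in msupp f)) => [min|nin].
  rewrite (bigD1_seq m) ?msupp_uniq //= mcoeffZ mcoeffX eqxx mulr1 big1 ?addr0 //.
  by move=> m' /negPf nm; rewrite mcoeffZ mcoeffX nm mulr0.
rewrite big_seq big1; last first.
  move=> m' min; rewrite mcoeffZ mcoeffX; case: eqP => [e|]; last by rewrite mulr0.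
  by rewrite e (negPf nin) in min.
by rewrite mulr0 subr0 memN_msupp_eq0 //; apply: ideal0.
Qed.

Lemma lreg_mpolyC n J (J' : {mpoly A[n]} -> Prop) zs : is_ideal J ->
  (forall f, J' f <-> forall m, J f@_m) ->
  lreg (fun u => u = 1) J zs -> lreg (fun u => u = 1) J' [seq z%:MP | z <- zs].
Proof.
elim: zs J J' => //= z zs IH J J' iJ JJ' [zJ reg]; split; last first.
  apply: IH reg => [|f]; first exact: ideal_adjP.
  exact: (@gens_mpolyC n J J' [:: z]).
move=> f /JJ' Jf; exists 1; split=> //; apply/JJ' => m; rewrite mul1r.
have [|u [-> ]] := zJ f@_m; last by rewrite mul1r.
by move: (Jf m); rewrite mcoeffCM.
Qed.

Lemma regular_seq_lreg r (a : 'I_r -> A) : regular_seq a ->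
  lreg (fun u => u = 1) zero_ideal [seq a i | i <- enum 'I_r].
Proof.
move=> [_ reg]; apply: lreg_nth => i; rewrite size_map size_enum_ord => lt p.
have gE x : gens zero_ideal (take i [seq a i | i <- enum 'I_r]) x <->
    ideal_gen (fun x => exists j : 'I_r, (j < Ordinal lt)%N /\ x = a j) x.
  split; move: x.
    apply: gens_sub; [exact: ideal_genP | exact: zero_ideal_sub (ideal_genP _) |].
    move=> x; rewrite -map_take => /mapP[j jin ->]; apply: ideal_gen_incl.
    exists j; split=> //=.
    have /(map_f val) : j \in take i (enum 'I_r) by [].
    by rewrite map_take val_enum_ord take_iota mem_iota add0n => /andP[_]; rewrite leq_min => /andP[].
  apply: ideal_gen_sub; first exact: gensP.
  move=> _ [j [/= ji ->]]; apply: gens_mem => //; rewrite -map_take; apply: map_f.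
  rewrite -(mem_map val_inj) map_take val_enum_ord take_iota mem_iota add0n /=.
  by rewrite leq_min ji ltn_ord.
have -> : [seq a i | i <- enum 'I_r]`_i = a (Ordinal lt).
  rewrite (nth_map (Ordinal lt)) ?size_enum_ord //; congr a; apply: val_inj.
  by rewrite /= nth_enum_ord.
by move/gE/reg/gE => gp; exists 1; rewrite mul1r.
Qed.

End GensMore.

Section BaseChange.
Variables (R : comNzRingType) (k : fieldType) (f : {rmorphism k -> R}) (m : nat).
Local Notation B := {mpoly k[m]}.
Local Notation S := {mpoly R[m]}.
Local Notation F := (map_mpoly f : {rmorphism B -> S}).
Variable J : R -> Prop.
Hypotheses (iJ : is_ideal J).
Implicit Types (e : seq R) (b : nat -> B).

Definition comb e (c : nat -> k) := \sum_(i < size e) f (c i) * e`_i.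
(** Linear independence over [k] of the classes modulo [J]. Finite families of this kind stand in
    for a basis of [R / J] over [k]. *)
Definition indep e := forall c, J (comb e c) -> forall i, (i < size e)%N -> c i = 0.
Definition spans e x := exists c, J (x - comb e c).

Lemma comb_cat e1 e2 c : comb (e1 ++ e2) c = comb e1 c + comb e2 (fun i => c (size e1 + i)%N).
Proof.
rewrite /comb size_cat big_split_ord /=; congr (_ + _); apply: eq_bigr => i _.
  by rewrite nth_cat ltn_ord.
by rewrite nth_cat ltnNge leq_addr /= addKn.
Qed.

Lemma spans_cat e1 e2 x : spans e1 x -> spans (e1 ++ e2) x.
Proof.
move=> [c Jc]; exists (fun i => if (i < size e1)%N then c i else 0).
rewrite comb_cat [comb e2 _]big1 ?addr0; last first.
  by move=> i _; rewrite ltnNge leq_addr /= rmorph0 mul0r.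
rewrite (_ : comb e1 _ = comb e1 c) //; apply: eq_bigr => i _; by rewrite ltn_ord.
Qed.

Lemma indep_rcons e x : indep e -> ~ spans e x -> indep (rcons e x).
Proof.
move=> ie nx c; rewrite -cats1 comb_cat /comb big_ord_recl big_ord0 /= addn0 addr0 => Jc.
have c0 : c (size e) = 0.
  apply: NNPP => /eqP nc; apply: nx; exists (fun i => - (c (size e))^-1 * c i).
  rewrite (_ : comb _ _ = - (f (c (size e))^-1 * comb e c)); last first.
    rewrite /comb mulr_sumr -sumrN; apply: eq_bigr => i _.
    by rewrite rmorphM rmorphN mulNr mulNr mulrA.
  rewrite opprK; have -> : x = f (c (size e))^-1 * (f (c (size e)) * x).
    by rewrite mulrA -rmorphM mulVf // rmorph1 mul1r.
  by rewrite -mulrDr; apply: idealMl; rewrite // addrC.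
move=> i; rewrite size_cat addn1 ltnS leq_eqVlt => /predU1P[->//|].
by apply: ie; move: Jc; rewrite c0 rmorph0 mul0r addr0.
Qed.

Lemma indep_extend e (xs : seq R) : indep e ->
  exists e', indep (e ++ e') /\ {in xs, forall x, spans (e ++ e') x}.
Proof.
elim: xs e => [|x xs IH] e ie; first by exists [::]; rewrite cats0.
case: (classic (spans e x)) => [sx|nx].
  have [e' [ie' sp]] := IH e ie; exists e'; split=> // y; rewrite inE => /predU1P[->|/sp//].
  exact: spans_cat.
have [e' [ie' sp]] := IH _ (indep_rcons ie nx).
exists (x :: e'); rewrite -cat_rcons; split=> // y; rewrite inE => /predU1P[->|/sp//].
apply: spans_cat; exists (fun i => (i == size e)%:R).
rewrite -cats1 comb_cat /comb big_ord_recl big_ord0 /= addn0 addr0 eqxx rmorph1 mul1r.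
rewrite big1 ?add0r ?subrr; first exact: ideal0.
by move=> i _; rewrite ltn_eqF // rmorph0 mul0r.
Qed.

Definition coef_ideal (g : S) := forall mm, J g@_mm.

Lemma coef_idealP : is_ideal coef_ideal.
Proof.
split=> [mm|g h Jg Jh mm|g h Jh mm]; first by rewrite mcoeff0; apply: ideal0.
  by rewrite mcoeffD; apply: idealD.
by rewrite mcoeffM; apply: ideal_bigsum => // i _; apply: idealMl.
Qed.

Definition combS e b : S := \sum_(i < size e) (e`_i)%:MP * F (b i).

Lemma mcoeff_combS e b mm : (combS e b)@_mm = comb e (fun i => (b i)@_mm).
Proof.
rewrite raddf_sum /=; apply: eq_bigr => i _.
by rewrite mcoeffCM mcoeff_map_mpoly mulrC.
Qed.

Lemma combS_mull e b c : F c * combS e b = combS e (fun i => c * b i).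
Proof. by rewrite mulr_sumr; apply: eq_bigr => i _; rewrite rmorphM mulrCA. Qed.

Lemma combSB e b b' : combS e b - combS e b' = combS e (fun i => b i - b' i).
Proof. by rewrite -sumrB; apply: eq_bigr => i _; rewrite rmorphB mulrBr. Qed.

Lemma combS_sum e n (b : 'I_n -> nat -> B) :
  \sum_(t < n) combS e (b t) = combS e (fun i => \sum_(t < n) b t i).
Proof.
rewrite exchange_big; apply: eq_bigr => i _.
by rewrite rmorph_sum mulr_sumr.
Qed.

Lemma combS_indep e b : indep e -> coef_ideal (combS e b) -> forall i, (i < size e)%N -> b i = 0.
Proof.
move=> ie Jb i lt; apply/mpolyP => mm; rewrite mcoeff0.
by apply: (ie (fun i => (b i)@_mm)) lt; rewrite -mcoeff_combS.
Qed.

Lemma combS_cat e e' b :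
  combS e b = combS (e ++ e') (fun i => if (i < size e)%N then b i else 0).
Proof.
rewrite /combS size_cat big_split_ord /= [X in _ = _ + X]big1 ?addr0.
  by apply: eq_bigr => i _; rewrite nth_cat ltn_ord.
by move=> i _; rewrite ltnNge leq_addr /= rmorph0 mulr0.
Qed.

Lemma expandS e (gs : seq S) : indep e ->
  exists e', indep (e ++ e') /\
    {in gs, forall g, exists b, coef_ideal (g - combS (e ++ e') b)}.
Proof.
move=> ie; have [e' [ie' sp]] :=
  indep_extend (flatten [seq [seq g@_mm | mm <- msupp g] | g <- gs]) ie.
exists e'; split=> // g gin; set e1 := e ++ e' in ie' sp *.
have ex mm : exists c, J (g@_mm - comb e1 c).
  case: (boolP (mm \in msupp g)) => [min|nin].
    by apply: sp; apply/flattenP; exists [seq g@_mm | mm <- msupp g]; apply: map_f.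
  exists (fun=> 0); rewrite memN_msupp_eq0 // /comb big1 ?subrr; first exact: ideal0.
  by move=> i _; rewrite rmorph0 mul0r.
pose c mm := sval (constructive_indefinite_description _ (ex mm)).
have cP mm : J (g@_mm - comb e1 (c mm)).
  exact: (svalP (constructive_indefinite_description _ (ex mm))).
exists (fun i => \sum_(mm <- msupp g) c mm i *: 'X_[mm]) => mm.
rewrite mcoeffB mcoeff_combS; case: (boolP (mm \in msupp g)) => [min|nin].
  rewrite (_ : comb _ _ = comb e1 (c mm)) //; apply: eq_bigr => i _; congr (f _ * _).
  rewrite raddf_sum /= (bigD1_seq mm) ?msupp_uniq //= mcoeffZ mcoeffX eqxx mulr1.
  by rewrite big1 ?addr0 // => m' /negPf nm; rewrite mcoeffZ mcoeffX nm mulr0.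
rewrite memN_msupp_eq0 // /comb big1 ?subrr; first exact: ideal0.
move=> i _; rewrite raddf_sum /= big_seq big1 ?rmorph0 ?mul0r // => m' min.
rewrite mcoeffZ mcoeffX; case: eqP => [e0|]; last by rewrite mulr0.
by rewrite e0 (negPf nin) in min.
Qed.

(** An elementary form of the freeness of [S / J S] over [B]. The family is enlarged until the
    cofactors expand along it too; comparing coordinates then gives relations in [B]. *)
Lemma gens_base_change e zs b : indep e ->
  gens coef_ideal [seq F z | z <- zs] (combS e b) ->
  forall i, (i < size e)%N -> gens zero_ideal zs (b i).
Proof.
move=> ie /(gens_lin _ _ coef_idealP)[h]; rewrite size_map => Jh i lt.
have [e' [ie' hx]] := expandS [seq h t | t <- iota 0 (size zs)] ie.
have ex (t : 'I_(size zs)) : exists b', coef_ideal (h t - combS (e ++ e') b').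
  by apply: hx; apply: map_f; rewrite mem_iota /=.
have /fin_all_exists[b' b'P] := ex.
pose D i := (if (i < size e)%N then b i else 0) - \sum_(t < size zs) zs`_t * b' t i.
have JD : coef_ideal (combS (e ++ e') D).
  have -> : combS (e ++ e') D = (combS e b - \sum_(t < size zs) [seq F z | z <- zs]`_t * h t)
      + \sum_(t < size zs) F zs`_t * (h t - combS (e ++ e') (b' t)).
    have -> : \sum_(t < size zs) F zs`_t * (h t - combS (e ++ e') (b' t)) =
        \sum_(t < size zs) [seq F z | z <- zs]`_t * h t
        - \sum_(t < size zs) combS (e ++ e') (fun i => zs`_t * b' t i).
      rewrite -sumrB; apply: eq_bigr => t _.
      by rewrite (nth_map 0) // -combS_mull mulrBr.
    by rewrite -combSB -combS_cat combS_sum addrA subrK.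
  apply: (idealD coef_idealP) => //.
  by apply: (ideal_bigsum coef_idealP) => t _; apply: (idealMl coef_idealP).
have D0 : D i = 0 by apply: (combS_indep ie') => //; rewrite size_cat ltn_addr.
apply/gens_lin => //; exists (fun t => if insub t is Some t' then b' t' i else 0).
rewrite /zero_ideal -[RHS]D0 /D lt; congr (_ - _); apply: eq_bigr => t _.
by rewrite valK.
Qed.

Lemma gens_combS e zs b : (forall i, (i < size e)%N -> gens zero_ideal zs (b i)) ->
  gens coef_ideal [seq F z | z <- zs] (combS e b).
Proof.
have iG := gensP [seq F z | z <- zs] coef_idealP.
move=> gb; apply: (ideal_bigsum iG) => i _; apply: (idealMl iG).
apply: gens_image (gb i (ltn_ord i)) => c ->; rewrite rmorph0.
exact: ideal0 coef_idealP.
Qed.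

(** Regularity is tested on the coordinates along an independent family, and one multiplier from [B]
    serves all of them. *)
Lemma lreg_base_change (q : B -> Prop) zs : prime_ideal q ->
  lreg (fun u => ~ q u) zero_ideal zs ->
  lreg (fun u => exists v, ~ q v /\ u = F v) coef_ideal [seq F z | z <- zs].
Proof.
move=> pq; elim/last_ind: zs => // zs z IH /lreg_rcons[reg rz].
rewrite map_rcons; apply/lreg_rcons; split; first exact: IH.
have iG : is_ideal (gens coef_ideal [seq F z | z <- zs]) by apply: gensP; exact: coef_idealP.
move=> g Jzg.
have i0 : indep [::] by [].
have [e [ie /(_ g)[|b Jb]]] := expandS [:: g] i0; first by rewrite inE.
rewrite cat0s in ie Jb.
have Jb' : gens coef_ideal [seq F z | z <- zs] (combS e (fun i => z * b i)).
  have Jd : gens coef_ideal [seq F z | z <- zs] (F z * (g - combS e b)).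
    by apply: idealMl => //; apply: gensl => //; exact: coef_idealP.
  rewrite -combS_mull; have -> : F z * combS e b = F z * g - F z * (g - combS e b) by ring.
  exact: idealB.
have zb := gens_base_change ie Jb'.
have [|u [nu gu]] := loc_uniform (n := size e) (F := b) pq (gensP zs (@zero_idealP B)).
  by move=> i lt; apply/rz/zb.
exists (F u); split; first by exists u.
apply: (@idealBl _ _ _ (F u * combS e b)) => //; last first.
  rewrite -mulrBr; apply: idealMl => //; apply: gensl => //; exact: coef_idealP.
by rewrite combS_mull; apply: gens_combS.
Qed.

Hypothesis nJ1 : ~ J 1.

Lemma indep1 : indep [:: 1].
Proof.
move=> c; rewrite /comb big_ord1 /= mulr1 => Jc [|//] _; apply: NNPP => /eqP nc.
apply: nJ1; rewrite -(rmorph1 f) -(mulVf nc) rmorphM; exact: idealMl.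
Qed.

(** Since [J] is proper, the family [[:: 1]] is independent, and an element of [B] is its own
    coordinate. *)
Lemma base_change_contract zs y :
  gens coef_ideal [seq F z | z <- zs] (F y) -> gens zero_ideal zs y.
Proof.
move=> Jy; apply: (gens_base_change (e := [:: 1]) (b := fun=> y) indep1 _ (i := 0%N)) => //.
by rewrite /combS big_ord1 /= mul1r.
Qed.

End BaseChange.

(** * The height of a prime containing the maximal minors *)

Lemma gens_ext (A : comNzRingType) (J J' : A -> Prop) zs :
  same_ideal J J' -> same_ideal (gens J zs) (gens J' zs).
Proof.
elim: zs J J' => //= z zs IH J J' JJ'; apply: IH => x.
by split=> -[g /JJ' Jg]; exists g.
Qed.

Lemma lreg_ext (A : comNzRingType) (U J J' : A -> Prop) zs :
  same_ideal J J' -> lreg U J zs -> lreg U J' zs.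
Proof.
elim: zs J J' => //= z zs IH J J' JJ' [zJ reg]; split.
  by move=> p /JJ'/zJ[u [Uu /JJ' Ju]]; exists u.
by apply: IH reg => x; split=> -[g /JJ' Jg]; exists g.
Qed.

Lemma minimal_over_ext (A : comNzRingType) (P J J' : A -> Prop) :
  (forall P', prime_ideal P' -> subid J P' <-> subid J' P') ->
  minimal_over P J -> minimal_over P J'.
Proof.
move=> JJ' [pP JP minP]; split=> //; first exact/JJ'.
by move=> P' pP' /(JJ' P' pP'); apply: minP.
Qed.

Lemma gens_mem_sub (A : comNzRingType) (zs : seq A) (P : A -> Prop) :
  is_ideal P -> subid (gens zero_ideal zs) P <-> subid (fun x => x \in zs) P.
Proof.
move=> iP; split=> [sub x xin|sub]; first exact/sub/gens_mem.
exact: gens_sub (zero_ideal_sub iP) sub.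
Qed.

Lemma minors_mxsub (B : comNzRingType) r s (psi : 'M[B]_(r, s)) n
    (I : 'I_n -> 'I_r) (J : 'I_n -> 'I_s) :
  n = r -> injective I -> injective J -> minors_ideal psi (\det (mxsub I J psi)).
Proof.
move=> nr; subst n => injI injJ.
have -> : mxsub I J psi = row_perm (perm injI) (colsub J psi).
  by apply/matrixP => i j; rewrite !mxE permE.
rewrite row_permE det_mulmx; apply: (idealMl (ideal_genP _)).
by apply: ideal_gen_incl; exists J.
Qed.

Lemma rank_lt_minors (B : comNzRingType) (K : fieldType) (p : {rmorphism B -> K})
    r s (psi : 'M[B]_(r, s)) :
  (forall x, minors_ideal psi x -> p x = 0) -> (\rank (map_mx p psi) < r)%N.
Proof.
move=> minors0; have [I [J [injI injJ pd _]]] := rank_minor p psi.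
rewrite ltn_neqAle rank_leq_row andbT; apply: contra pd => /eqP rr.
by apply/eqP; apply: minors0; exact: (minors_mxsub rr injI injJ).
Qed.

Section RankBound.
Variables (R : comNzRingType) (k : fieldType) (f : {rmorphism k -> R}) (r m s : nat).
Variables (a : 'I_r -> R) (psi : 'M[{mpoly k[m]}]_(r, s)).
Local Notation B := {mpoly k[m]}.
Local Notation S := {mpoly R[m]}.
Local Notation F := (map_mpoly f : {rmorphism B -> S}).
Hypothesis noeR : noetherian R.
Hypothesis reg : regular_seq a.
Let aS : 'I_r -> S := fun i => (a i)%:MP.
Let apsi : 'I_s -> S := fun j => \sum_(i < r) aS i * F (psi i j).
Let sat := saturation (ideal_of apsi) (ideal_of aS).
Hypothesis height_sat : height_ge sat s.

Lemma sat_sub (P : S -> Prop) i :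
  prime_ideal P -> (forall j, P (apsi j)) -> ~ P (aS i) -> subid sat P.
Proof.
move=> pP apP ni x [t col]; have iP := prime_is_ideal pP.
have : P (x * aS i ^+ t).
  apply: (ideal_of_sub iP apP); apply: col; apply: ideal_pow_exp.
  exact: ideal_of_gen.
by case/(primeM pP) => // /(primeX pP).
Qed.

Let seqa := [seq a i | i <- enum 'I_r].
Let Ja := gens zero_ideal seqa.
Let iJa : is_ideal Ja := gensP seqa (@zero_idealP R).

Lemma Ja_proper : ~ Ja 1.
Proof. by case: reg => n1 _ J1; apply: n1; apply/ideal_of_gens. Qed.

Lemma gens_aS : same_ideal (gens zero_ideal [seq c%:MP | c <- seqa]) (coef_ideal (m := m) Ja).
Proof.
apply: gens_mpolyC => // g; split=> [-> mm|g0]; first by rewrite /zero_ideal mcoeff0.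
by apply/mpolyP => mm; rewrite mcoeff0; apply: g0.
Qed.

Variables (q : B -> Prop) (K : fieldType) (p : {rmorphism B -> K}).
Hypotheses (pq : prime_ideal q) (pE : forall b, p b = 0 <-> q b).
Hypothesis minors_q : subid (minors_ideal psi) q.
Local Notation rho := (\rank (map_mx p psi)).

Lemma rank_bound : exists h, prime_height_ge q h /\ (s <= h + rho)%N.
Proof.
have noeS : noetherian S := @noetherian_mpoly R m noeR.
have noeB : noetherian B := @noetherian_mpoly k m (@noetherian_field k).
have iq := prime_is_ideal pq.
have rho_r : (rho < r)%N by apply: rank_lt_minors => x /minors_q /pE.
have [I [J [_ _ /eqP pd dE]]] := rank_minor p psi.
have [zs [zq zreg zgen]] := @regular_primes_mpoly k m (@regular_primes_field k) q pq.
exists (size zs); split; first exact: lreg_height.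
pose az := [seq c%:MP | c <- seqa] ++ [seq F z | z <- zs].
have iG : is_ideal (gens zero_ideal az) by apply: gensP.
have GE : same_ideal (gens zero_ideal az) (gens (coef_ideal Ja) [seq F z | z <- zs]).
  by rewrite /az gens_cat; apply: gens_ext; exact: gens_aS.
(* A prime over [(a)] and [zs] avoiding the image of the complement of [q]: a member of that image
   in the ideal would contract to an element of [(zs)], hence of [q]. *)
have [|||N0 [pN0 GN0 N0W]] := @prime_avoiding S noeS (gens zero_ideal az)
    (fun x => exists u, ~ q u /\ x = F u) iG.
- by exists 1; split; [apply: prime1 | rewrite rmorph1].
- move=> _ _ [u [nu ->]] [v [nv ->]]; exists (u * v); rewrite rmorphM; split=> //.
  exact: nprimeM.
- move=> x /GE Gx [u [nu xE]]; apply: nu; rewrite xE in Gx.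
  apply: gens_sub (base_change_contract iJa Ja_proper Gx) => //.
  exact: zero_ideal_sub.
have [N [minN NN0]] := minimal_prime_below noeS iG pN0 GN0.
have [pN GN minN'] := minN.
have NF u : ~ q u -> ~ N (F u) by move=> nu /NN0 Nu; apply: (N0W _ Nu); exists u.
have hN : prime_height_ge N (size az).
  apply: lreg_height => // [x xin|]; first exact/GN/gens_mem.
  apply/lreg_cat; split.
    apply: (lreg_mono (U := fun u => u = 1)) => [_ ->|]; first exact: prime1.
    apply: (@lreg_mpolyC R m zero_ideal zero_ideal) => // [g|]; last exact: regular_seq_lreg.
    split=> [-> mm|g0]; first by rewrite /zero_ideal mcoeff0.
    by apply/mpolyP => mm; rewrite mcoeff0; apply: g0.
  apply: (lreg_ext (J := coef_ideal Ja)) => [x|]; first by split=> /gens_aS.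
  apply: (lreg_mono (U := fun u => exists v, ~ q v /\ u = F v)).
    by move=> _ [v [nv ->]]; apply: NF.
  exact: lreg_base_change.
(* The forms at the columns [J] of a minor outside [q], together with [zs]. As [rho < r], they are
   too few for [N] to be minimal over them, so some prime over [L] inside [N] misses an entry of
   [a]. *)
pose L := [seq F z | z <- zs] ++ [seq apsi (J c) | c <- enum 'I_rho].
have szL : size L = (size zs + rho)%N.
  by rewrite /L size_cat 2!size_map size_enum_ord.
have szaz : size az = (r + size zs)%N.
  by rewrite /az /seqa size_cat 2!size_map size_enum_ord size_map.
have iL : is_ideal (gens zero_ideal L) by apply: gensP.
have aG i : gens zero_ideal az (aS i).
  apply: gens_mem => //; rewrite /az mem_cat -map_comp; apply/orP; left.
  by apply/mapP; exists i; rewrite ?mem_enum.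
have LG : subid (gens zero_ideal L) (gens zero_ideal az).
  apply: gens_sub => //; first exact: zero_ideal_sub.
  move=> x; rewrite /L mem_cat => /orP[xin|/mapP[c _ ->]].
    by apply: gens_mem => //; rewrite mem_cat xin orbT.
  by apply: ideal_bigsum => // i _; apply: idealMr.
have [P1 [pP1 LP1 P1N [i nP1]]] : exists P1, [/\ prime_ideal P1, subid (gens zero_ideal L) P1,
    subid P1 N & exists i, ~ P1 (aS i)].
  apply: NNPP => nn.
  have : (size az <= size L)%N.
    apply: krull_height hN => //; split=> // [x xin|P' pP' LP' P'N].
      by apply/GN/LG/gens_mem.
    have iP' := prime_is_ideal pP'.
    apply: minN' => //; apply/gens_mem_sub => // x.
    rewrite /az mem_cat => /orP[|xin]; last by apply: LP'; rewrite mem_cat xin.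
    rewrite -map_comp => /mapP[i _ ->]; apply: NNPP => ni; apply: nn; exists P'; split=> //.
      exact/gens_mem_sub.
    by exists i.
  by rewrite szL szaz addnC leq_add2l leqNgt rho_r.
have [P0 [minP0 P0P1]] := minimal_prime_below noeS iL pP1 LP1.
have [pP0 LP0 minP0'] := minP0; have iP0 := prime_is_ideal pP0.
have P0F u : ~ q u -> ~ P0 (F u) by move=> nu /P0P1/P1N; apply: NF.
have P0q y : q y -> P0 (F y).
  move=> /zgen[u [nu gu]]; have : P0 (F (u * y)).
    apply: LP0; rewrite gens_cat; apply: gensl; first exact: gensP.
    by apply: gens_image gu => c ->; rewrite rmorph0.
  by rewrite rmorphM => /(primeM pP0)[/(P0F _ nu)|].
(* Modulo [q], whose image is in [P0], the chosen minor times any column of [psi] is a combination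
   of the columns [J]; the minor is outside [q], so it cancels. *)
have P0apsi j : P0 (apsi j).
  have : P0 (F (\det (mxsub I J psi)) * apsi j).
    pose t := \adj (mxsub I J psi) *m rowsub I psi.
    have -> : F (\det (mxsub I J psi)) * apsi j = \sum_(c < rho) apsi (J c) * F (t c j) +
       \sum_(i < r) aS i * F (\det (mxsub I J psi) * psi i j -
          (colsub J psi *m \adj (mxsub I J psi) *m rowsub I psi) i j).
      have -> : \sum_(c < rho) apsi (J c) * F (t c j) =
          \sum_(i < r) aS i * F ((colsub J psi *m \adj (mxsub I J psi) *m rowsub I psi) i j).
        rewrite (eq_bigr (fun c => \sum_(i < r) aS i * F (psi i (J c)) * F (t c j))).
          rewrite exchange_big; apply: eq_bigr => i' _.
          rewrite -mulmxA mxE rmorph_sum mulr_sumr; apply: eq_bigr => c _.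
          by rewrite [colsub J psi i' c]mxE rmorphM mulrA.
        by move=> c _; rewrite mulr_suml.
      rewrite -big_split mulr_sumr; apply: eq_bigr => i' _ /=.
      rewrite rmorphB mulrBr addrCA subrr addr0 rmorphM; exact: mulrCA.
    apply: idealD => //; apply: ideal_bigsum => // c _.
      apply: idealMr => //; apply: LP0; apply: gens_mem => //.
      by rewrite mem_cat; apply/orP; right; apply/mapP; exists c; rewrite ?mem_enum.
    apply: idealMl => //; apply: P0q; apply/pE; rewrite rmorphB dE subrr //.
  by case/(primeM pP0) => // Pd; case: (P0F _ _ Pd) => /pE.
have hP0 : prime_height_ge P0 s.
  apply: height_sat => //; apply: (sat_sub (i := i)) => //.
  by move/P0P1.
rewrite -szL; apply: krull_height hP0 => //.
apply: minimal_over_ext minP0 => P' pP'; apply: gens_mem_sub; exact: prime_is_ideal.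
Qed.

End RankBound.

(** * Primes over the generic linear forms *)

(** Cramer's rule: the row [x] times [colsub g psi], a row of generators, times the adjugate is [x]
    times the determinant. *)
Lemma cramer_ideal (A : comNzRingType) r s (x : 'I_r -> A) (psi : 'M[A]_(r, s)) i (g : 'I_r -> 'I_s) :
  ideal_of (fun j => \sum_(i < r) x i * psi i j) (x i * \det (colsub g psi)).
Proof.
apply/ideal_of_lin.
(* [g] may repeat a column, so the coefficient of a generator is a sum over a fibre of [g]. *)
exists (fun j => \sum_(c | g c == j) (\adj (colsub g psi)) c i).
have -> : x i * \det (colsub g psi) = ((\row_i x i) *m (colsub g psi *m \adj (colsub g psi))) 0 i.
  by rewrite mul_mx_adj mul_mx_scalar !mxE mulrC.
rewrite mulmxA mxE (partition_big g xpredT) //=; apply: eq_bigr => j _.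
rewrite mulr_suml; apply: eq_bigr => c /eqP <-; rewrite mulrC; congr (_ * _).
by rewrite mxE; apply: eq_bigr => i' _; rewrite !mxE.
Qed.

Lemma mpoly_rmorph_cong (A D : comNzRingType) n (g h : {rmorphism {mpoly A[n]} -> D})
    (J : D -> Prop) : is_ideal J ->
  (forall c, g c%:MP = h c%:MP) -> (forall i, J (g 'X_i - h 'X_i)) ->
  forall p, J (g p - h p).
Proof.
move=> iJ ghC ghX p.
have cM u v u' v' : J (u - u') -> J (v - v') -> J (u * v - u' * v').
  move=> Ju Jv; have -> : u * v - u' * v' = (u - u') * v + u' * (v - v') by ring.
  by apply: idealD => //; [apply: idealMr | apply: idealMl].
have c1 : J (1 - 1) by rewrite subrr; apply: ideal0.
have cX u u' n0 : J (u - u') -> J (u ^+ n0 - u' ^+ n0).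
  by move=> Ju; elim: n0 => // n0 IH; rewrite !exprS; apply: cM.
rewrite [p]mpolyE !rmorph_sum -sumrB; apply: ideal_bigsum => // mm _.
rewrite -mul_mpolyC !rmorphM ghC; apply: (cM); first by rewrite subrr; apply: ideal0.
rewrite mpolyXE_id !rmorph_prod.
by elim/big_rec2: _ => // i y1 y2 _ Jy; apply: cM => //; rewrite !rmorphXn; apply: cX.
Qed.

Lemma zero_prime (A : idomainType) : prime_ideal (@zero_ideal A).
Proof.
split=> // [/eqP|x y /eqP]; first by rewrite oner_eq0.
by rewrite mulf_eq0 => /orP[]/eqP; [left|right].
Qed.

Section LinearForms.
Variables (K : fieldType) (r rho : nat) (I : 'I_rho -> 'I_r) (G : 'M[K]_(r, rho)).
Hypothesis injI : injective I.
Hypothesis GI : forall c c', G (I c') c = (c' == c)%:R.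
Local Notation KX := {mpoly K[r]}.

Definition lform c : KX := \sum_l G l c *: 'X_l.
(** The substitution that subtracts [lform c] from the variable of index [I c], for every [c < k].
    As the rows [I] of [G] form an identity matrix, it kills these forms and fixes the other ones.
    Its kernel is the ideal they generate, which is thereby prime. *)
Definition elim_var k l : KX := 'X_l - \sum_(c < rho | (c < k)%N && (I c == l)) lform c.
Definition elim_map k : {rmorphism KX -> KX} := mmap (@mpolyC r K) (elim_var k).

Lemma elim_mapC k c : elim_map k c%:MP = c%:MP.
Proof. exact: mmapC. Qed.

Lemma elim_mapX k l : elim_map k 'X_l = elim_var k l.
Proof. by rewrite /= mmapX mmap1U. Qed.

Lemma elim_map_lform k c : elim_map k (lform c) = if (c < k)%N then 0 else lform c.
Proof.
rewrite {1}/lform rmorph_sum.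
rewrite (eq_bigr (fun l => G l c *: 'X_l -
    \sum_(c' < rho | (c' < k)%N && (I c' == l)) G l c *: lform c')); last first.
  move=> l _; rewrite -mul_mpolyC rmorphM elim_mapC elim_mapX /elim_var mulrBr mulr_sumr.
  by congr (_ - _); apply: eq_bigr => c' _; rewrite mul_mpolyC.
rewrite sumrB -/(lform c).
have -> : \sum_l \sum_(c' < rho | (c' < k)%N && (I c' == l)) G l c *: lform c' =
    \sum_(c' < rho | (c' < k)%N) G (I c') c *: lform c'.
  rewrite (exchange_big_dep (fun c' : 'I_rho => (c' < k)%N)) /=; last by move=> l c' _ /andP[].
  apply: eq_bigr => c' lt; rewrite (big_pred1 (I c')) // => l.
  by rewrite lt /= eq_sym.
case: ifP => lt; last first.
  rewrite big1 ?subr0 // => c' lt'; rewrite GI.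
  by case: eqP => [e|]; [rewrite e lt in lt' | rewrite scale0r].
rewrite (bigD1 c) //= GI eqxx scale1r big1 ?addr0 ?subrr // => c' /andP[_ /negPf nc].
by rewrite GI nc scale0r.
Qed.

Lemma mcoeff_lform c l : (lform c)@_U_(l) = G l c.
Proof.
rewrite raddf_sum /= (bigD1 l) //= mcoeffZ mcoeffXU eqxx mulr1 big1 ?addr0 // => l' nl.
by rewrite mcoeffZ mcoeffXU (negPf nl) mulr0.
Qed.

Lemma lform_neq0 c : lform c != 0.
Proof.
apply/eqP => l0; have := mcoeff_lform c (I c); rewrite l0 mcoeff0 GI eqxx => /eqP.
by rewrite eq_sym oner_eq0.
Qed.

Lemma elim_map_kernel k g : elim_map k g = 0 ->
  exists h : 'I_rho -> KX, g = \sum_(c < rho | (c < k)%N) lform c * h c.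
Proof.
move=> g0.
pose J (g : KX) := exists h : 'I_rho -> KX, g = \sum_(c < rho | (c < k)%N) lform c * h c.
have iJ : is_ideal J.
  split=> [|x y [h ->] [h' ->]|u x [h ->]].
  - by exists (fun=> 0); rewrite big1 // => c _; rewrite mulr0.
  - exists (fun c => h c + h' c); rewrite -big_split; apply: eq_bigr => c _.
    by rewrite mulrDr.
  - exists (fun c => u * h c); rewrite mulr_sumr; apply: eq_bigr => c _.
    by rewrite mulrCA.
have Jl (c : 'I_rho) : (c < k)%N -> J (lform c).
  move=> lt; exists (fun c' => (c' == c)%:R); rewrite (bigD1 c) //= eqxx mulr1.
  by rewrite big1 ?addr0 // => c' /andP[_ /negPf->]; rewrite mulr0.
have := @mpoly_rmorph_cong K KX r idfun (elim_map k) J iJ _ _ g.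
rewrite g0 /= subr0; apply=> [c|l]; first by rewrite [RHS]elim_mapC.
rewrite [X in _ - X]elim_mapX /elim_var opprB addrCA subrr addr0.
by apply: ideal_bigsum => // c /andP[lt _]; apply: Jl.
Qed.

End LinearForms.

Section HeightChain.
Variables (B : comNzRingType) (q : B -> Prop) (K : fieldType) (p : {rmorphism B -> K}).
Hypotheses (pq : prime_ideal q) (pE : forall b, p b = 0 <-> q b).
Hypothesis pfrac : forall x : K, exists a b, ~ q b /\ x * p b = p a.
Variables (r s : nat) (psi : 'M[B]_(r, s)).
Local Notation C := {mpoly B[r]}.
Local Notation KX := {mpoly K[r]}.
Local Notation pX := (map_mpoly p : {rmorphism C -> KX}).
Local Notation rho := (\rank (map_mx p psi)).

Lemma map_mpoly_eq0 (g : C) : pX g = 0 <-> forall mm, q g@_mm.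
Proof.
split=> [g0 mm|qg].
  by apply/pE; rewrite -mcoeff_map_mpoly; move: g0 => /= ->; rewrite mcoeff0.
by apply/mpolyP => mm; rewrite mcoeff_map_mpoly mcoeff0; apply/pE.
Qed.

Lemma common_denom (h : KX) : exists d (H : C), ~ q d /\ pX H = p d *: h.
Proof.
have [d [nd hd]] : exists d, ~ q d /\ forall mm, mm \in msupp h -> exists a, h@_mm * p d = p a.
  elim: (msupp h) => [|mm ms [d [nd IH]]]; first by exists 1; split; [apply: prime1|].
  have [a [b [nb ab]]] := pfrac h@_mm.
  exists (b * d); split; first exact: nprimeM.
  move=> mm'; rewrite inE => /predU1P[->|/IH[a' a'E]].
    by exists (a * d); rewrite !rmorphM mulrA ab.
  by exists (a' * b); rewrite !rmorphM -a'E; ring.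
have ex mm : exists a, h@_mm * p d = p a.
  case: (boolP (mm \in msupp h)) => [/hd//|nin].
  by exists 0; rewrite memN_msupp_eq0 // mul0r rmorph0.
pose a mm := sval (constructive_indefinite_description _ (ex mm)).
have aP mm : h@_mm * p d = p (a mm).
  exact: (svalP (constructive_indefinite_description _ (ex mm))).
exists d, (\sum_(mm <- msupp h) a mm *: 'X_[mm]); split=> //.
rewrite rmorph_sum [h in RHS]mpolyE scaler_sumr; apply: eq_bigr => mm _.
by rewrite /= map_mpolyZ map_mpolyX -aP scalerA mulrC.
Qed.

(** A chain below [q] is extended coefficientwise; each extension is prime as the kernel of the map
    to polynomials over a residue field. *)
Lemma coef_prime_height h : prime_height_ge q h ->
  prime_height_ge (fun g : C => forall mm, q g@_mm) h.
Proof.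
move=> [c [[cp cS] cq]].
have coefP (P : B -> Prop) b : is_ideal P -> (forall mm, P (b%:MP_[r])@_mm) <-> P b.
  move=> iP; split=> [/(_ 0%MM)|Pb mm]; first by rewrite mcoeffC eqxx mulr1.
  by rewrite mcoeffC; apply: idealMr.
exists (fun i g => forall mm, c i g@_mm); split; last by move=> g; split=> H mm; apply/cq.
split=> i le.
  have [K' [p' [p'E _]]] := residue_field (cp i le).
  apply: (prime_ideal_ext _ (preim_prime (map_mpoly p' : {rmorphism C -> {mpoly K'[r]}})
     (@zero_prime {mpoly K'[r]}))).
  move=> g; split=> [g0 mm|cg].
    by apply/p'E; rewrite -mcoeff_map_mpoly; move: g0; rewrite /zero_ideal /= => ->; rewrite mcoeff0.
  by apply/mpolyP => mm; rewrite mcoeff_map_mpoly mcoeff0; apply/p'E.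
have [s1 s2] := cS i le; split=> [g cg mm|sub]; first exact/s1/cg.
have i1 := prime_is_ideal (cp i (ltnW le)); have i2 := prime_is_ideal (cp i.+1 le).
by apply: s2 => b cb; apply/(coefP _ _ i1)/sub/(coefP _ _ i2).
Qed.

Variables (N : C -> Prop).
Hypotheses (pN : prime_ideal N) (Nq : forall b, N b%:MP <-> q b).
Hypothesis Nalpha : forall j, N (\sum_(i < r) 'X_i * (psi i j)%:MP).

(** Over the residue field of [q] the columns of [psi] give [rho] independent linear forms. Killing
    them one at a time gives primes [L k] between the extension of [q] and [N], strictly increasing,
    which lengthen a chain below [q] by [rho]. *)
Lemma prime_height_fibre h : prime_height_ge q h -> prime_height_ge N (h + rho).
Proof.
move=> hq; have iN := prime_is_ideal pN.
have [I [J [injI _ /eqP pd _]]] := rank_minor p psi.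
set M := mxsub I J psi in pd; pose d := \det M.
pose T := colsub J psi *m \adj M.
(* Combinations, by the adjugate of the minor, of the forms at the columns [J]. Their reductions are
   [p d] times linear forms whose coefficients at the rows [I] are those of a unit vector. *)
pose xx c : C := \sum_l 'X_l * (T l c)%:MP.
have Nxx c : N (xx c).
  have -> : xx c = \sum_(e < rho) (\sum_(i < r) 'X_i * (psi i (J e))%:MP) * (\adj M e c)%:MP.
    rewrite (eq_bigr (fun e => \sum_(i < r) 'X_i * ((psi i (J e))%:MP * (\adj M e c)%:MP))).
      rewrite exchange_big; apply: eq_bigr => l _; rewrite [T l c]mxE.
      rewrite raddf_sum mulr_sumr /=; apply: eq_bigr => e _.
      by rewrite mpolyCM [colsub J psi l e]mxE.
    by move=> e _; rewrite mulr_suml; apply: eq_bigr => i _; rewrite mulrA.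
  by apply: ideal_bigsum => // e _; apply: idealMr.
pose G : 'M[K]_(r, rho) := \matrix_(l, c) ((p d)^-1 * p (T l c)).
have pd0 : p d != 0 by apply/eqP.
have GI c c' : G (I c') c = (c' == c)%:R.
  have -> : G (I c') c = (p d)^-1 * p ((M *m \adj M) c' c).
    rewrite mxE; congr (_ * p _); rewrite !mxE; apply: eq_bigr => e _; congr (_ * _).
    by rewrite !mxE.
  rewrite mul_mx_adj mxE rmorphMn /=; case: eqP => _; rewrite ?mulr1n ?mulr0n ?mulr0 //.
  by rewrite mulVf.
have pxx c : pX (xx c) = p d *: lform G c.
  rewrite rmorph_sum scaler_sumr; apply: eq_bigr => l _.
  rewrite /= rmorphM /= map_mpolyC map_mpolyX scalerA [G l c]mxE mulrA mulfV // mul1r.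
  by rewrite mulrC mul_mpolyC.
pose phi k : {rmorphism C -> KX} := elim_map I G k \o pX.
pose L k (g : C) := phi k g = 0.
have pL k : prime_ideal (L k) := preim_prime (phi k) (@zero_prime KX).
have NpX g : pX g = 0 -> N g.
  move/map_mpoly_eq0 => qg; rewrite [g]mpolyE; apply: ideal_bigsum => // mm _.
  by rewrite -mul_mpolyC; apply: idealMr => //; apply/Nq.
have nNC b : ~ q b -> ~ N b%:MP by move=> nb /Nq.
have nd : ~ q d by move/pE.
(* Over the field an element of [L k] is a combination of linear forms; clearing the denominators of
   its cofactors costs a multiplier outside [q], hence outside [N]. *)
have LN k : subid (L k) N.
  move=> g /elim_map_kernel[h' gE].
  have ex (c : 'I_rho) : exists e (H : C), ~ q e /\ pX H = p e *: h' c by apply: common_denom.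
  have /fin_all_exists[e /fin_all_exists[H eH]] := ex.
  pose E := \prod_c e c.
  have nE : ~ q E.
    rewrite /E; elim/big_rec: _ => [|c x _ nx]; first exact: prime1.
    by apply: nprimeM => //; case: (eH c).
  pose E' c := \prod_(c' | c' != c) e c'.
  have EE c : E = e c * E' c by rewrite /E (bigD1 c).
  have : N ((E * d)%:MP * g - \sum_(c < rho | (c < k)%N) xx c * ((E' c)%:MP * H c)).
    apply: NpX; rewrite rmorphB rmorphM rmorph_sum /= map_mpolyC {1}[map_mpoly p g]gE.
    have t c : pX (xx c * ((E' c)%:MP * H c)) =
        (p d *: lform G c) * ((p (E' c))%:MP * (p (e c) *: h' c)).
      transitivity (pX (xx c) * (pX (E' c)%:MP * pX (H c))); first by rewrite !rmorphM.
      by congr (_ * (_ * _)); [exact: pxx | exact: map_mpolyC | case: (eH c)].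
    rewrite mulr_sumr -sumrB big1 // => c _; rewrite [X in _ - X]t.
    have pEd : p (E * d) = p (e c) * p (E' c) * p d by rewrite (EE c) !rmorphM.
    rewrite [X in X%:MP_[r] * (lform G c * _)]pEd !mpolyCM -!mul_mpolyC; ring.
  move=> NN; have : N ((E * d)%:MP * g).
    by apply: idealBl NN => //; apply: ideal_bigsum => // c _; apply: idealMr.
  by case/(primeM pN) => // /nNC; case; apply: nprimeM.
suff key k : (k <= rho)%N -> prime_height_ge (L k) (h + k).
  have [c [cc cL]] := key _ (leqnn _).
  case: (classic (subid N (L rho))) => [NL|nNL].
    by exists c; split=> // g; split=> [/cL/LN//|/NL/cL].
  apply: (@prime_height_ge_le _ _ (h + rho).+1) => //.
  by apply: (@prime_height_geS _ N (L rho)) => //; exists c.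
elim: k => [|k IH] le.
  rewrite addn0; have [c [cc cL]] := coef_prime_height hq.
  have id0 : elim_map I G 0 =1 idfun.
    apply: mpoly_rmorph_ext => [b|l]; first exact: elim_mapC.
    by rewrite elim_mapX /elim_var big_pred0 ?subr0.
  exists c; split=> // g; rewrite cL -map_mpoly_eq0 /L /phi /=.
  by rewrite [elim_map I G 0 _]id0.
rewrite addnS; pose c := Ordinal le.
apply: (@prime_height_geS _ _ (L k)) (IH (ltnW le)) => // [g /elim_map_kernel[h' gE]|sub].
  rewrite /L /phi /=; move: gE => /= ->; rewrite rmorph_sum big1 // => c' lt.
  by rewrite rmorphM [elim_map I G k.+1 (lform G c')]elim_map_lform // ltnS (ltnW lt) mul0r.
(* Strictness: [xx c], with [c] of value [k], is killed at stage [k.+1] but not at stage [k]. *)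
have : L k (xx c).
  apply: sub; rewrite /L /phi /=; move: (pxx c) => /= ->.
  rewrite -mul_mpolyC rmorphM [elim_map I G k.+1 (lform G c)]elim_map_lform //.
  by rewrite ltnS leqnn mulr0.
rewrite /L /phi /=; move: (pxx c) => /= ->.
rewrite -mul_mpolyC rmorphM [elim_map I G k (lform G c)]elim_map_lform // ltnn.
rewrite [elim_map I G k _]elim_mapC mul_mpolyC => /eqP; apply/negP.
rewrite -mul_mpolyC mulf_eq0 negb_or mpolyC_eq0 pd0 /=; exact: lform_neq0 GI _.
Qed.

End HeightChain.

(** * The Koszul complex *)

Section Exterior.
Variable A : comNzRingType.

(* The exterior algebra of a free module of rank [s]: splitting off the first basis
   vector [e_0], a pair [(u, v)] stands for [u + e_0 v]. *)
Fixpoint ext (s : nat) : lmodType A :=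
  if s is s'.+1 then (ext s' * ext s')%type : lmodType A else A^o.

Implicit Types (phi chi : nat -> A) (X J U : A -> Prop).

(* Contraction with the linear form [e_j |-> phi j], i.e. the Koszul differential of [phi]. *)
Fixpoint contr phi (s : nat) : ext s -> ext s :=
  if s is s'.+1 then fun v : ext s'.+1 =>
    (phi 0%N *: v.2 + contr (fun j => phi j.+1) v.1, - contr (fun j => phi j.+1) v.2)
  else fun _ => 0.

(** Left multiplication by the vector with these coordinates; the sign comes from moving it past the
    first basis vector. *)
Fixpoint wedge phi (s : nat) : ext s -> ext s :=
  if s is s'.+1 then fun v : ext s'.+1 =>
    (wedge (fun j => phi j.+1) v.1, phi 0%N *: v.1 - wedge (fun j => phi j.+1) v.2)
  else fun _ => 0.

Fixpoint allc X (s : nat) : ext s -> Prop :=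
  if s is s'.+1 then fun v : ext s'.+1 => allc X v.1 /\ allc X v.2
  else fun v : A => X v.

Fixpoint homd (p : nat) (s : nat) : ext s -> Prop :=
  if s is s'.+1 then fun v : ext s'.+1 =>
    homd p v.1 /\ (if p is p'.+1 then homd p' v.2 else v.2 = 0)
  else fun v : A => p = 0%N \/ v = 0.

Fixpoint hproj (p : nat) (s : nat) : ext s -> ext s :=
  if s is s'.+1 then fun v : ext s'.+1 =>
    (hproj p v.1, if p is p'.+1 then hproj p' v.2 else 0)
  else fun v : A => if p is 0%N then v else 0.

Fixpoint mapc (h : A -> A) (s : nat) : ext s -> ext s :=
  if s is s'.+1 then fun v : ext s'.+1 => (mapc h v.1, mapc h v.2)
  else fun v : A => h v.

Lemma iota_lin phi s c (u v : ext s) : contr phi (c *: u + v) = c *: contr phi u + contr phi v.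
Proof.
elim: s phi u v => [|s IH] phi u v /=; first by rewrite scaler0 addr0.
apply: injective_projections => /=; rewrite IH; last first.
  by rewrite opprD scalerN.
rewrite !scalerDr !scalerA -!addrA; congr (_ *: _ + _); first by rewrite mulrC.
by rewrite addrCA.
Qed.

Lemma iota0 phi s : contr phi (0 : ext s) = 0.
Proof.
by have := iota_lin phi (-1) (0 : ext s) 0; rewrite scaler0 addr0 scaleN1r addNr.
Qed.

Lemma iotaZ phi s c (u : ext s) : contr phi (c *: u) = c *: contr phi u.
Proof. by rewrite -[c *: u]addr0 iota_lin iota0 addr0. Qed.

Lemma iotaD phi s (u v : ext s) : contr phi (u + v) = contr phi u + contr phi v.
Proof. by rewrite -[u]scale1r iota_lin !scale1r. Qed.

Lemma iotaN phi s (u : ext s) : contr phi (- u) = - contr phi u.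
Proof. by rewrite -scaleN1r iotaZ scaleN1r. Qed.

Lemma iotaB phi s (u v : ext s) : contr phi (u - v) = contr phi u - contr phi v.
Proof. by rewrite iotaD iotaN. Qed.

Lemma iota_lin_phi phi chi s c (u : ext s) :
  contr (fun j => c * phi j + chi j) u = c *: contr phi u + contr chi u.
Proof.
elim: s phi chi u => [|s IH] phi chi u /=; first by rewrite scaler0 addr0.
apply: injective_projections => /=; rewrite IH; last by rewrite opprD scalerN.
by rewrite scalerDl -scalerA scalerDr -!addrA; congr (_ + _); rewrite addrCA.
Qed.

Lemma iota_ext phi chi s (u : ext s) : (forall j, (j < s)%N -> phi j = chi j) ->
  contr phi u = contr chi u.
Proof.
elim: s phi chi u => //= s IH phi chi u e.
by rewrite e // !(IH _ (fun j => chi j.+1)) // => j lt; apply: e.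
Qed.

Lemma iota_0phi s (u : ext s) : contr (fun=> 0) u = 0.
Proof.
elim: s u => //= s IH u; rewrite !IH scale0r addr0 oppr0; reflexivity.
Qed.

Lemma iota_sum_phi (T : Type) (r : seq T) (x : T -> A) (f : T -> nat -> A) s (u : ext s) :
  contr (fun j => \sum_(i <- r) x i * f i j) u = \sum_(i <- r) x i *: contr (f i) u.
Proof.
elim: r => [|i r IH].
  rewrite big_nil -(iota_0phi u); apply: iota_ext => j _; exact: big_nil.
rewrite big_cons -IH -iota_lin_phi; apply: iota_ext => j _; exact: big_cons.
Qed.

Lemma iota_anti phi chi s (u : ext s) : contr phi (contr chi u) = - contr chi (contr phi u).
Proof.
elim: s phi chi u => [|s IH] phi chi u /=; first by rewrite oppr0.
apply: injective_projections => /=; last by rewrite !iotaN IH.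
rewrite !iotaD !iotaZ IH !scalerN !opprD opprK.
by rewrite addrCA.
Qed.

Lemma iota_sq phi s (u : ext s) : contr phi (contr phi u) = 0.
Proof.
elim: s phi u => [|s IH] phi u //=.
apply: injective_projections => /=; last by rewrite iotaN IH !oppr0.
by rewrite iotaD iotaZ IH addr0 scalerN addNr.
Qed.

(** The homotopy formula. With [chi] a basis vector, it makes multiplication by an entry of [phi]
    null-homotopic on the Koszul complex. *)
Lemma wedge_iota phi chi s (u : ext s) :
  contr phi (wedge chi u) + wedge chi (contr phi u) = (\sum_(j < s) phi j * chi j) *: u.
Proof.
have wedge_lin c0 ch s0 (x y : ext s0) : wedge ch (c0 *: x + y) = c0 *: wedge ch x + wedge ch y.
  elim: s0 ch x y => [|s0 IH] ch x y /=; first by rewrite scaler0 addr0.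
  apply: injective_projections => /=; rewrite IH //.
  by rewrite scalerDr opprD addrACA scalerBr !scalerA [ch 0%N * c0]mulrC.
have wedge0 ch s0 : wedge ch (0 : ext s0) = 0.
  by have := wedge_lin (-1) ch s0 0 0; rewrite scaler0 addr0 scaleN1r addNr.
have wedgeN ch s0 (x : ext s0) : wedge ch (- x) = - wedge ch x.
  by rewrite -scaleN1r -[-1 *: x]addr0 wedge_lin wedge0 addr0 scaleN1r.
elim: s phi chi u => [|s IH] phi chi u.
  by rewrite big_ord0 scale0r /= addr0.
have -> : \sum_(j < s.+1) phi j * chi j =
  phi 0%N * chi 0%N + \sum_(j < s) phi j.+1 * chi j.+1 by rewrite big_ord_recl.
have {}IH (w : ext s) : (\sum_(j < s) phi j.+1 * chi j.+1) *: w =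
    contr (fun j => phi j.+1) (wedge (fun j => chi j.+1) w) +
    wedge (fun j => chi j.+1) (contr (fun j => phi j.+1) w).
  by rewrite (IH (fun j => phi j.+1) (fun j => chi j.+1) w).
apply: injective_projections => /=; rewrite scalerDl IH.
  rewrite wedge_lin scalerBr !scalerA -!addrA; congr (_ + _).
  by rewrite (addrCA (contr _ _)) addKr.
rewrite iotaB iotaZ wedgeN opprK opprB scalerDr scalerA [chi 0%N * _]mulrC.
by rewrite -!addrA (addrCA (- _)) addKr addrCA.
Qed.

Lemma allc_sub X Y s (v : ext s) : (forall x, X x -> Y x) -> allc X v -> allc Y v.
Proof. by move=> XY; elim: s v => /= [v /XY|s IH v [/IH ? /IH ?]]. Qed.

Lemma allc0 X s : X 0 -> allc X (0 : ext s).
Proof. by move=> X0; elim: s. Qed.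

Lemma allcD X Y Z s (u v : ext s) : (forall x y, X x -> Y y -> Z (x + y)) ->
  allc X u -> allc Y v -> allc Z (u + v).
Proof.
move=> XYZ; elim: s u v => /= [u v|s IH u v [u1 u2] [v1 v2]]; first exact: XYZ.
by split; apply: IH.
Qed.

Lemma allcZ X Y s c (u : ext s) : (forall x, X x -> Y (c * x)) -> allc X u -> allc Y (c *: u).
Proof.
move=> XY; elim: s u => /= [u|s IH u [u1 u2]]; first exact: XY.
by split; apply: IH.
Qed.

Lemma allcN X Y s (u : ext s) : (forall x, X x -> Y (- x)) -> allc X u -> allc Y (- u).
Proof.
move=> XY; elim: s u => /= [u|s IH u [u1 u2]]; first exact: XY.
by split; apply: IH.
Qed.

Lemma allc_iota X Y phi s (u : ext s) : Y 0 -> (forall x y, Y x -> Y y -> Y (x + y)) ->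
  (forall x, Y x -> Y (- x)) ->
  (forall j x, (j < s)%N -> X x -> Y (phi j * x)) -> allc X u -> allc Y (contr phi u).
Proof.
move=> Y0 YD YN; elim: s phi u => //= s IH phi u phiX [u1 u2]; split.
  by apply: allcD YD _ _; [apply: allcZ u2 => x; apply: phiX | apply: IH u1 => j x lt; apply: phiX].
by apply: allcN YN _; apply: IH u2 => j x lt; apply: phiX.
Qed.

Lemma homdD p s (u v : ext s) : homd p u -> homd p v -> homd p (u + v).
Proof.
elim: s p u v => /= [p u v [->|->] [//|->]|s IH [|p] u v [u1 u2] [v1 v2]].
- by left.
- by left.
- by rewrite add0r; left.
- by right; rewrite addr0.
- by split; [apply: IH | rewrite /= u2 v2 addr0].
- by split; apply: IH.
Qed.

Lemma homdZ p s c (u : ext s) : homd p u -> homd p (c *: u).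
Proof.
elim: s p u => /= [p u [->|->]|s IH [|p] u [u1 u2]].
- by left.
- by right; rewrite scaler0.
- by split; [apply: IH | rewrite /= u2 scaler0].
- by split; apply: IH.
Qed.

Lemma homdN p s (u : ext s) : homd p u -> homd p (- u).
Proof. by rewrite -scaleN1r; apply: homdZ. Qed.

Lemma homdB p s (u v : ext s) : homd p u -> homd p v -> homd p (u - v).
Proof. by move=> hu hv; apply: homdD => //; apply: homdN. Qed.

Lemma homd_gt p s (u : ext s) : (s < p)%N -> homd p u -> u = 0.
Proof.
elim: s p u => [|s IH] [|p] u //=; first by move=> _ [].
rewrite ltnS => lt [u1 u2]; apply: injective_projections.
  exact: (IH p.+1 u.1 (ltnW lt) u1).
exact: (IH p u.2 lt u2).
Qed.

Lemma homd_iota p phi s (u : ext s) : homd p.+1 u -> homd p (contr phi u).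
Proof.
elim: s p phi u => [p phi u _|s IH p phi u [u1 u2]]; first by right.
case: p u1 u2 => [|p] u1 u2 /=; split.
- by apply: homdD; [apply: homdZ | apply: IH].
- suff -> : contr (fun j => phi j.+1) u.2 = 0 by rewrite oppr0.
  have {}u2 : homd 0 u.2 by [].
  elim: (s) (fun j => phi j.+1) u.2 u2 => //= s0 IH0 ph w [w1 w2].
  by rewrite w2 scaler0 add0r iota0 IH0 // oppr0.
- by apply: homdD; [apply: homdZ | apply: IH].
- by apply: homdN; apply: IH.
Qed.

Lemma hproj_id p s (u : ext s) : homd p u -> hproj p u = u.
Proof.
elim: s p u => /= [p u [->//|->]|s IH [|p] u [u1 u2]]; first by case: p.
  by rewrite IH // -u2; case: (u).
by rewrite !IH //; case: (u).
Qed.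

Lemma hprojP p s (u : ext s) : homd p (hproj p u).
Proof. by elim: s p u => /= [[|p] u|s IH [|p] u]; [left|right|split|split]. Qed.

Lemma hprojD p s (u v : ext s) : hproj p (u + v) = hproj p u + hproj p v.
Proof.
elim: s p u v => /= [[|p] u v|s IH [|p] u v] //=; rewrite ?addr0 ?IH //.
by apply: injective_projections => //=; rewrite addr0.
Qed.

Lemma hprojZ p s c (u : ext s) : hproj p (c *: u) = c *: hproj p u.
Proof.
elim: s p u => /= [[|p] u|s IH [|p] u] //=; rewrite ?scaler0 ?IH //.
by apply: injective_projections => //=; rewrite scaler0.
Qed.

Lemma hprojN p s (u : ext s) : hproj p (- u) = - hproj p u.
Proof. by rewrite -scaleN1r hprojZ scaleN1r. Qed.

Lemma hproj_iota p phi s (u : ext s) : contr phi (hproj p.+1 u) = hproj p (contr phi u).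
Proof.
elim: s p phi u => [[|p] phi u|s IH p phi u] //=.
rewrite hprojD hprojZ !IH; case: p => [|p] /=; last by rewrite hprojN IH.
apply: injective_projections => //=.
suff -> : forall (ph : nat -> A) s0 (w : ext s0), contr ph (hproj 0 w) = 0 by rewrite oppr0.
move=> ph s0; elim: s0 ph => //= s0 IH0 ph w.
by rewrite scaler0 add0r iota0 IH0 oppr0.
Qed.

Section Mapc.
Variable h : {additive A -> A}.

Lemma mapc0 s : mapc h (0 : ext s) = 0.
Proof. by elim: s => [|s IH] /=; rewrite ?raddf0 // IH. Qed.

Lemma mapcD s (u v : ext s) : mapc h (u + v) = mapc h u + mapc h v.
Proof. by elim: s u v => [|s IH] u v /=; rewrite ?raddfD // !IH. Qed.

Lemma mapcN s (u : ext s) : mapc h (- u) = - mapc h u.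
Proof. by elim: s u => [|s IH] u /=; rewrite ?raddfN // !IH. Qed.

Lemma mapc_homd p s (u : ext s) : homd p u -> homd p (mapc h u).
Proof.
elim: s p u => /= [p u [->|->]|s IH [|p] u [u1 u2]].
- by left.
- by right; rewrite raddf0.
- by split; [apply: IH | rewrite /= u2 mapc0].
- by split; apply: IH.
Qed.

Lemma mapcZ (h' : {additive A -> A}) c s (u : ext s) :
  (forall x, h' (c * x) = c * h x) -> mapc h' (c *: u) = c *: mapc h u.
Proof. by move=> hc; elim: s u => [|s IH] u /=; rewrite ?hc // !IH. Qed.

Lemma mapc_all X s (u : ext s) : (forall x, X (h x)) -> allc X (mapc h u).
Proof. by move=> Xh; elim: s u => [|s IH] u /=. Qed.

Lemma mapc_id X s (u : ext s) : (forall x, X x -> h x = x) -> allc X u -> mapc h u = u.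
Proof.
move=> Xh; elim: s u => [|s IH] u /=; first exact: Xh.
by case=> u1 u2; rewrite !IH //; case: (u).
Qed.

End Mapc.

Lemma mapc_iota (h h' : {additive A -> A}) phi s (u : ext s) :
  (forall j x, (j < s)%N -> h' (phi j * x) = phi j * h x) ->
  contr phi (mapc h u) = mapc h' (contr phi u).
Proof.
elim: s phi u => [|s IH] phi u hc /=; first by rewrite raddf0.
have hc' j x : (j < s)%N -> h' (phi j.+1 * x) = phi j.+1 * h x by move=> lt; apply: hc.
by rewrite mapcD mapcN -!IH // (mapcZ (h := h)) // => x; apply: hc.
Qed.

(** The coordinate at the basis element coded by the bits [b], missing bits being false; [ecoef
    [::]] is the coordinate in exterior degree zero. Coordinates turn identities in [ext] into ring
    identities. *)
Fixpoint ecoef (b : seq bool) (s : nat) : ext s -> A :=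
  if s is s'.+1 then fun v : ext s'.+1 => ecoef (behead b) (if head false b then v.2 else v.1)
  else fun v : A => v.

Lemma ecoefD b s (u v : ext s) : ecoef b (u + v) = ecoef b u + ecoef b v.
Proof. by elim: s b u v => //= s IH b u v; case: (head false b); rewrite IH. Qed.

Lemma ecoefN b s (u : ext s) : ecoef b (- u) = - ecoef b u.
Proof. by elim: s b u => //= s IH b u; case: (head false b); rewrite IH. Qed.

Lemma ecoefZ b s c (u : ext s) : ecoef b (c *: u) = c * ecoef b u.
Proof. by elim: s b u => //= s IH b u; case: (head false b); rewrite IH. Qed.

Lemma ecoef0 b s : ecoef b (0 : ext s) = 0.
Proof. by elim: s b => //= s IH b; case: (head false b); rewrite IH. Qed.

Lemma ecoef_inj s (u v : ext s) : (forall b, ecoef b u = ecoef b v) -> u = v.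
Proof.
elim: s u v => [u v /(_ [::])//|s IH u v e]; apply: injective_projections; apply: IH => b.
  exact: (e (false :: b)).
exact: (e (true :: b)).
Qed.

Lemma allc_uniform U J s (v : ext s) : U 1 -> (forall x y, U x -> U y -> U (x * y)) ->
  is_ideal J -> allc (fun x => exists u, U u /\ J (u * x)) v ->
  exists u, U u /\ allc J (u *: v).
Proof.
move=> U1 UM iJ; elim: s v => /= [v //|s IH v [/IH[u1 [U1' J1]] /IH[u2 [U2 J2]]]].
exists (u1 * u2); split; first exact: UM.
split=> /=; first by rewrite mulrC -scalerA; apply: allcZ J1 => x; apply: idealMl.
by rewrite -scalerA; apply: allcZ J2 => x; apply: idealMl.
Qed.

(** Cofactors are chosen coordinate by coordinate and are zero off exterior degree [p], so that the
    degree constraints survive division by [y]. *)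
Lemma allc_split X X' J y s p (v : ext s) : X' 0 -> is_ideal J ->
  (forall x, X x -> ideal_adj J y x -> exists g, X' g /\ J (x - y * g)) ->
  homd p v -> allc X v -> allc (ideal_adj J y) v ->
  exists g, [/\ homd p g, allc X' g & allc J (v - y *: g)].
Proof.
move=> X0 iJ spl; elim: s p v => /= [p v hv Xv Jv|s IH p v [h1 h2] [x1 x2] [j1 j2]].
  case: hv => [->|v0]; first by have [g [Xg Jg]] := spl v Xv Jv; exists g; split=> //; left.
  exists 0; split=> //; first by right.
  by rewrite v0 scaler0 subrr; apply: ideal0.
have [g1 [hg1 Xg1 Jg1]] := IH p _ h1 x1 j1.
case: p h2 {h1} hg1 => [|p] h2 hg1.
  exists (g1, 0); split=> //=; split=> //; first exact: allc0.
  by rewrite h2 scaler0 subrr; apply: allc0; apply: ideal0.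
have [g2 [hg2 Xg2 Jg2]] := IH p _ h2 x2 j2.
by exists (g1, g2); split.
Qed.

End Exterior.

Ltac ext_ring := apply: ecoef_inj => ?; rewrite !(ecoefD, ecoefN, ecoefZ, ecoef0); ring.

(** * A chase in the Koszul complex *)

Section Chase.
Variables (A : comNzRingType) (s : nat) (alpha : nat -> A).
Local Notation E := (ext A s).
Local Notation d_ := (@contr A alpha s).
Variables (U : A -> Prop) (H : nat -> A -> Prop).
Hypotheses (U1 : U 1) (UM : forall x y, U x -> U y -> U (x * y)) (UH : forall x, U x -> H 0 x).
Hypotheses (H0 : forall e, H e 0) (HD : forall e x y, H e x -> H e y -> H e (x + y))
  (HN : forall e x, H e x -> H e (- x))
  (HM : forall e d x y, H e x -> H d y -> H (e + d) (x * y))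
  (Halpha : forall j, (j < s)%N -> H 1 (alpha j)).
(* [M l mu e] : [mu] is an admissible multiplier for the index [l], of degree [e.+1];
   [M' l mu e] : same for the auxiliary multipliers, of degree [e]. *)
Variables (T : Type) (M M' : T -> A -> nat -> Prop) (lo : nat).
Hypotheses (MH : forall l mu e, M l mu e -> H e.+1 mu) (MH' : forall l mu e, M' l mu e -> H e mu).
Hypotheses (MM : forall l mu mu' e e', M l mu e -> M' l mu' e' -> M l (mu' * mu) (e' + e))
  (MM' : forall l mu mu' e e', M' l mu e -> M' l mu' e' -> M' l (mu' * mu) (e' + e)).
Hypothesis Mlo : forall l mu e, M l mu e -> e = 0%N \/ lo = 0%N.
Hypothesis lo1 : (lo <= 1)%N.
Variable graded : (A -> Prop) -> Prop.
Hypothesis graded_adj : forall J l mu e, graded J -> M l mu e -> graded (ideal_adj J mu).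
Hypothesis graded_split : forall J l mu e d x, graded J -> is_ideal J -> M l mu e ->
  H d.+1 x -> ideal_adj J mu x ->
  J x \/ exists d' g, [/\ d.+1 = (d' + e.+1)%N, H d' g & J (x - mu * g)].

(** Exterior degree [p] and coefficient degree [d]. In the applications [H] is either trivial or the
    grading of [C] by its variables, and [U] is either the complement of a prime or [1] alone. *)
Definition bihom p d (v : E) := homd p v /\ allc (H d) v.

Lemma bihom_scale p d e c v : H e c -> bihom p d v -> bihom p (e + d) (c *: v).
Proof. by move=> Hc [hv Hv]; split; [apply: homdZ | apply: allcZ Hv => x; apply: HM]. Qed.

Lemma bihom_scaleU p d u v : U u -> bihom p d v -> bihom p d (u *: v).
Proof. by move/UH=> Hu; exact: (bihom_scale (e := 0%N)). Qed.

Lemma bihom_sub p d v w : bihom p d v -> bihom p d w -> bihom p d (v - w).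
Proof.
move=> [hv Hv] [hw Hw]; split; first exact: homdB.
by apply: allcD (HD (e := d)) Hv _; apply: allcN Hw => x; apply: HN.
Qed.

Lemma bihom_d p d v : bihom p.+1 d v -> bihom p d.+1 (d_ v).
Proof.
move=> [hv Hv]; split; first exact: homd_iota.
apply: allc_iota Hv => //; [exact: HD | exact: HN |].
by move=> j x lt Hx; rewrite -add1n; apply: HM => //; apply: Halpha.
Qed.

Lemma allc_d J (v : E) : is_ideal J -> allc J v -> allc J (d_ v).
Proof.
move=> iJ; apply: allc_iota; [exact: ideal0 | by move=> x y; apply: idealD | |].
  by move=> x; apply: idealN.
by move=> j x _; apply: idealMl.
Qed.

Lemma allc_add J (v w : E) : is_ideal J -> allc J v -> allc J w -> allc J (v + w).
Proof. by move=> iJ; apply: allcD => x y; apply: idealD. Qed.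
Lemma allc_opp J (v : E) : is_ideal J -> allc J v -> allc J (- v).
Proof. by move=> iJ; apply: allcN => x; apply: idealN. Qed.
Lemma allc_sub_ J (v w : E) : is_ideal J -> allc J v -> allc J w -> allc J (v - w).
Proof. by move=> iJ Jv Jw; apply: allc_add => //; apply: allc_opp. Qed.
Lemma allc_scale J c (v : E) : is_ideal J -> allc J v -> allc J (c *: v).
Proof. by move=> iJ; apply: allcZ => x; apply: idealMl. Qed.

Definition nzd J mu := forall x, J (mu * x) -> exists u, U u /\ J (u * x).

Lemma allc_nzd J mu (v : E) : is_ideal J -> nzd J mu -> allc J (mu *: v) ->
  exists u, U u /\ allc J (u *: v).
Proof.
move=> iJ nz Jv; apply: allc_uniform => //.
elim: (s) v Jv => /= [v /nz//|s0 IH v [J1 J2]]; split; exact: IH.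
Qed.

(** All admissible multipliers are quantified over, since the power of a variable that the chase
    meets is not known beforehand. *)
Fixpoint regular J (ls : seq T) : Prop :=
  if ls is l :: ls' then
    forall mu e, M l mu e -> nzd J mu /\ regular (ideal_adj J mu) ls'
  else True.

(** The bound [lo] accommodates exactness known only in positive coefficient degree; [Mlo] then asks
    the main multipliers to have degree one. *)
Definition koszul_exact J (ls : seq T) p := forall p' d v, (p < p')%N -> (lo <= d)%N -> bihom p' d v ->
  allc J (d_ v) -> forall l, InP l ls -> exists mu e u w d',
    [/\ M' l mu e, U u, d'.+1 = (d + e)%N, bihom p'.+1 d' w & allc J ((u * mu) *: v - d_ w)].

Definition torsion J (ls : seq T) p d (v : E) := forall l, InP l ls -> exists mu e u w,
    [/\ M l mu e, U u, bihom p.+1 (d + e) w & allc J ((u * mu) *: v - d_ w)].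

(* [Phi] collects the residual classes that the chase cannot kill. *)
Fixpoint chase_end (ls : seq T) J p d (Phi : E -> Prop) : Prop :=
  (forall u v, U u -> Phi v -> Phi (u *: v)) /\
  if ls is l :: ls' then
    forall mu e, M l mu e -> exists Phi' : E -> Prop,
      chase_end ls' (ideal_adj J mu) p.+1 (d + e)%N Phi' /\
      forall v', Phi' v' -> exists v, Phi v /\ allc J (d_ v' - mu *: v)
  else forall v, bihom p d v -> exists u w, [/\ U u, Phi w & allc J (u *: v - w)].

Lemma allc_adj J mu (v : E) : allc (ideal_adj J mu) v -> exists g : E, allc J (v - mu *: g).
Proof.
elim: (s) v => /= [v [g Jg]|s0 IH v [/IH[g1 J1] /IH[g2 J2]]]; first by exists g.
by exists (g1, g2).
Qed.

(** A connecting homomorphism: the boundary of a cycle modulo [mu] is [mu *: g] with [g] a cycle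
    modulo [J]; bounding [g] corrects the given element to a cycle modulo [J]. Since [g] has one
    exterior degree less, the range of exactness shrinks by one, and two auxiliary multipliers are
    combined. *)
Lemma koszul_exact_adj J l ls mu e p : is_ideal J -> graded J -> M l mu e -> nzd J mu ->
  koszul_exact J ls p -> koszul_exact (ideal_adj J mu) ls p.+1.
Proof.
move=> iJ gJ Mmu nz ex [|p'] d v // pp' lod Kv Jv l' l'in; rewrite ltnS in pp'.
have iJ' := ideal_adjP mu iJ.
have [hdv Hdv] := bihom_d Kv.
have [g [hg Hg Jg]] : exists g, [/\ homd p' g,
    allc (fun x => x = 0 \/ exists d', d.+1 = (d' + e.+1)%N /\ H d' x) g & allc J (d_ v - mu *: g)].
  apply: (allc_split (X := H d.+1)) => //; first by left.
  move=> x Hx Jx; case: (graded_split gJ iJ Mmu Hx Jx) => [J0|[d' [x' [dE Hx' Jx']]]].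
    by exists 0; rewrite mulr0 subr0; split=> //; left.
  by exists x'; split=> //; right; exists d'.
(* The quotient [g] has coefficient degree [d - e]. When [d < e] all its coordinates vanish, and the
   boundary is already in [J]. *)
have pos_case : exists d', (lo <= d')%N /\ (d = d' + e)%N /\ bihom p' d' g \/ allc J (d_ v).
  case: (leqP e d) => [le|lt].
    exists (d - e)%N; left; split; last first.
      split; first by rewrite subnK.
      split=> //; apply: allc_sub Hg => x [->//|[d' [dE Hx]]].
      by have -> : (d - e)%N = d' by lia.
    by case: (Mlo Mmu) => ->; rewrite ?subn0.
  exists 0%N; right; rewrite -[d_ v](subrK (mu *: g)); apply: allc_add => //.
  apply: allc_scale => //; apply: allc_sub Hg => x [->|[d' [dE _]]]; first exact: ideal0.
  by lia.
case: pos_case => d' [[lod' [dE Kg]]|Jdv]; last first.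
  have [mu2 [e2 [u2 [w [d2 [M2 Uu2 d2E Kw Jw]]]]]] := ex p'.+1 d v (ltnW pp') lod Kv Jdv l' l'in.
  exists mu2, e2, u2, w, d2; split=> //; apply: allc_sub Jw => x; exact: ideal_adjl.
have [u0 [Uu0 Ju0]] : exists u, U u /\ allc J (u *: d_ g).
  apply: (allc_nzd iJ nz); rewrite -iotaZ.
  have -> : d_ (mu *: g) = - d_ (d_ v - mu *: g) by rewrite iotaB iota_sq sub0r opprK.
  by apply: allc_opp => //; apply: allc_d.
have [|mu1 [e1 [u1 [h [d1 [M1 Uu1 d1E Kh Jh]]]]]] :=
  ex p' d' (u0 *: g) pp' lod' (bihom_scaleU Uu0 Kg) _ l' l'in; first by rewrite iotaZ.
pose x := (u1 * mu1 * u0) *: v - mu *: h.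
have Kx : bihom p'.+1 (e1 + d) x.
  apply: bihom_sub.
    have -> : (u1 * mu1 * u0) *: v = (u1 * u0) *: (mu1 *: v) by ext_ring.
    by apply: bihom_scaleU; [exact: UM | apply: bihom_scale => //; apply: MH' M1].
  have -> : (e1 + d = e.+1 + d1)%N by lia.
  by apply: bihom_scale => //; apply: MH Mmu.
have Jx : allc J (d_ x).
  have -> : d_ x = (u1 * mu1 * u0) *: (d_ v - mu *: g) + mu *: ((u1 * mu1) *: (u0 *: g) - d_ h).
    by rewrite iotaB !iotaZ; ext_ring.
  by apply: allc_add => //; apply: allc_scale.
have [|mu2 [e2 [u2 [w [d2 [M2 Uu2 d2E Kw Jw]]]]]] := ex p'.+1 _ x (ltnW pp') _ Kx Jx l' l'in.
  by rewrite (leq_trans lod) ?leq_addl.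
exists (mu2 * mu1), (e2 + e1)%N, (u2 * u1 * u0), w, d2; split=> //.
- exact: MM'.
- by apply: UM => //; apply: UM.
- by rewrite d2E; lia.
have -> : (u2 * u1 * u0 * (mu2 * mu1)) *: v - d_ w =
    ((u2 * mu2) *: x - d_ w) + mu *: ((u2 * mu2) *: h).
  by rewrite /x; ext_ring.
apply: allc_add => //; first by apply: allc_sub Jw => z; exact: ideal_adjl.
apply: (allcZ (X := fun=> True)); first by move=> z _; apply: ideal_adjr.
by elim: (s) ((u2 * mu2) *: h) => /= // s0 IHs y; split; apply: IHs.
Qed.

(* Induction on [ls]: a class killed by [mu] comes from a class one degree higher with
   coefficients modulo [mu], where the list is shorter. *)
Theorem chase ls J p d Phi v : is_ideal J -> graded J -> regular J ls -> koszul_exact J ls p ->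
  chase_end ls J p d Phi -> bihom p d v -> torsion J ls p d v ->
  exists u w phi, [/\ U u, Phi phi & allc J (u *: v - d_ w - phi)].
Proof.
elim: ls J p d Phi v => [|l ls IH] J p d Phi v iJ gJ reg ex [PhiU ce] Kv tv.
  have [u [w [Uu Phiw Jw]]] := ce v Kv.
  by exists u, 0, w; rewrite iota0 subr0.
have [mu [e [u [w [Mmu Uu Kw Jw]]]]] := tv l (or_introl erefl).
have [nz reg'] := reg mu e Mmu.
have [Phi' [ce' Phi'phi']] := ce mu e Mmu.
have iJ' := ideal_adjP mu iJ.
have JJ' (x : E) : allc J x -> allc (ideal_adj J mu) x.
  by apply: allc_sub => z; exact: ideal_adjl.
have muJ' (x : E) : allc (ideal_adj J mu) (mu *: x).
  apply: (allcZ (X := fun=> True)); first by move=> z _; apply: ideal_adjr.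
  by elim: (s) (x) => /= // s0 IHs y; split; apply: IHs.
have ex' : koszul_exact J ls p by move=> p' d' v' pp' lod Kv' Jv' l' l'in; apply: (ex p' d') => //; right.
have [||u' [w' [phi' [Uu' Phi'phi Jphi]]]] := IH (ideal_adj J mu) p.+1 (d + e)%N Phi' w iJ' _ reg'
    (koszul_exact_adj iJ gJ Mmu nz ex') ce' Kw.
- exact: graded_adj Mmu.
- move=> l2 l2in; have [mu2 [e2 [u2 [w2 [M2 Uu2 Kw2 Jw2]]]]] := tv l2 (or_intror l2in).
  (* [w] and [w2] bound multiples of the same [v]; the cross-multiplied difference is a cycle modulo
     [J]. Bounding it shows that [w] is torsion modulo [mu]. *)
  pose x := (u2 * mu2) *: w - (u * mu) *: w2.
  have Kx : bihom p.+1 (e2 + e + d).+1 x.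
    apply: bihom_sub.
      rewrite -scalerA; apply: bihom_scaleU => //.
      have -> : ((e2 + e + d).+1 = e2.+1 + (d + e))%N by lia.
      by apply: bihom_scale => //; apply: MH M2.
    rewrite -scalerA; apply: bihom_scaleU => //.
    have -> : ((e2 + e + d).+1 = e.+1 + (d + e2))%N by lia.
    by apply: bihom_scale => //; apply: MH Mmu.
  have Jx : allc J (d_ x).
    have -> : d_ x = (u * mu) *: ((u2 * mu2) *: v - d_ w2) - (u2 * mu2) *: ((u * mu) *: v - d_ w).
      by rewrite iotaB !iotaZ; ext_ring.
    by apply: allc_sub_ => //; apply: allc_scale.
  have [|mu3 [e3 [u3 [w3 [d3 [M3 Uu3 d3E Kw3 Jw3]]]]]] :=
    ex p.+1 (e2 + e + d).+1 x (ltnSn p) _ Kx Jx l2 (or_intror l2in).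
    by apply: leq_trans lo1 _.
  exists (mu3 * mu2), (e3 + e2)%N, (u3 * u2), w3; split; first exact: MM.
  + exact: UM.
  + by have <- : d3 = (d + e + (e3 + e2))%N by lia.
  have -> : (u3 * u2 * (mu3 * mu2)) *: w - d_ w3 =
      ((u3 * mu3) *: x - d_ w3) + mu *: ((u3 * mu3 * u) *: w2) by rewrite /x; ext_ring.
  by apply: allc_add => //; apply: JJ'.
have [g Jg] := allc_adj Jphi.
have [phi [Phiphi J1]] := Phi'phi' phi' Phi'phi.
(* The differential, applied to the relation found modulo [mu], produces [mu] times the desired
   relation; regularity cancels the factor. *)
have [|u2 [Uu2 Ju2]] := @allc_nzd J mu ((u' * u) *: v - phi - d_ g) iJ nz.
  have -> : mu *: ((u' * u) *: v - phi - d_ g) = d_ (u' *: w - d_ w' - phi' - mu *: g)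
     + u' *: ((u * mu) *: v - d_ w) + (d_ phi' - mu *: phi).
    by rewrite !iotaB !iotaZ iota_sq; ext_ring.
  apply: allc_add => //; apply: allc_add => //; first exact: allc_d.
  exact: allc_scale.
exists (u2 * (u' * u)), (u2 *: g), (u2 *: phi); split.
- by apply: UM => //; apply: UM.
- exact: PhiU.
have -> : (u2 * (u' * u)) *: v - d_ (u2 *: g) - u2 *: phi = u2 *: ((u' * u) *: v - phi - d_ g).
  by rewrite iotaZ; ext_ring.
exact: Ju2.
Qed.

End Chase.

Lemma InP_mem (T : eqType) (x : T) (ls : seq T) : InP x ls <-> x \in ls.
Proof.
elim: ls => //= y ls IH; rewrite inE; split; first by case=> [->|/IH->]; rewrite ?eqxx ?orbT.
by case/predU1P => [->|/IH]; [left | right].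
Qed.

Lemma allc_zero (A : comNzRingType) s (v : ext A s) : allc zero_ideal v -> v = 0.
Proof. by elim: s v => [|s IH] //= [v1 v2] /= [/IH -> /IH ->]. Qed.

Lemma allcT (A : comNzRingType) s (v : ext A s) : allc (fun=> True) v.
Proof. by elim: s v => //= s IH v; split; apply: IH. Qed.

(** * Torsion of the Koszul homology in positive exterior degree *)

Section KoszulTorsion.
Variables (C : comNzRingType) (noeC : noetherian C) (s : nat) (alpha : nat -> C) (x : C).
Hypothesis deep : forall N : C -> Prop, prime_ideal N -> (forall j, (j < s)%N -> N (alpha j)) ->
  ~ N x -> exists zs : seq C, [/\ (s <= size zs)%N, {in zs, forall z, N z} &
    lreg (fun u => ~ N u) zero_ideal zs].
Local Notation d_ := (@contr C alpha s).

(** Descending induction on [p]. A class killed by no power of [x] leads to an associated prime [N],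
    containing the [alpha j] but not [x]. The chase along a sequence of length at least [s], regular
    at [N], ends in exterior degree above [s], where nothing is left; so a multiplier outside [N]
    kills the class, a contradiction. *)
Theorem koszul_torsion p (v : ext C s) : (0 < p)%N -> homd p v -> d_ v = 0 ->
  exists t w, homd p.+1 w /\ x ^+ t *: v = d_ w.
Proof.
have [n] := ubnP (s.+1 - p); elim: n p v => // n IH p v; rewrite ltnS => lt p0 hv dv.
pose L (v : ext C s) := exists t w, x ^+ t *: v = d_ w.
suff [t [w xE]] : L v.
  exists t, (hproj p.+1 w); split; first exact: hprojP.
  by rewrite hproj_iota -xE hproj_id //; apply: homdZ.
case: (leqP p s) => [ps|sp]; last first.
  by exists 0%N, 0; rewrite (homd_gt sp hv) scaler0 iota0.
have LZ c w : L w -> L (c *: w).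
  by move=> [t [y e]]; exists t, (c *: y); rewrite iotaZ -e !scalerA mulrC.
have LD w w' : L w -> L w' -> L (w + w').
  move=> [t [y e]] [t' [y' e']]; exists (t + t')%N, (x ^+ t' *: y + x ^+ t *: y').
  by rewrite iotaD !iotaZ -e -e' exprD; ext_ring.
have L0 : L 0 by exists 0%N, 0; rewrite scaler0 iota0.
apply: NNPP => nL.
have [c [ncv pN]] := exists_associated_prime noeC LZ LD L0 nL.
set g := c *: v in ncv pN; pose N e := L (e *: g).
have hg : homd p g by apply: homdZ.
have dg : d_ g = 0 by rewrite iotaZ dv scaler0.
have nNx : ~ N x.
  move=> [t [w e]]; apply: ncv; exists t.+1, w.
  by rewrite exprSr -scalerA e.
(* By the homotopy formula [alpha j *: g] is the boundary of the [j]-th basis vector times the cycle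
   [g]. *)
have Na j : (j < s)%N -> N (alpha j).
  move=> lt'; exists 0%N, (wedge (fun i => (i == j)%:R) g); rewrite expr0 scale1r.
  have := wedge_iota alpha (fun i => (i == j)%:R) g; rewrite dg.
  have -> : wedge (fun i => (i == j)%:R) (0 : ext C s) = 0.
    have wl ch s0 : wedge ch (0 : ext C s0) = 0.
      elim: s0 ch => //= s0 IH0 ch; rewrite !IH0 scaler0 subr0; reflexivity.
    exact: wl.
  rewrite addr0 => ->; congr (_ *: _); rewrite (bigD1 (Ordinal lt')) //= eqxx mulr1.
  by rewrite big1 ?addr0 // => i; rewrite -val_eqE /= => /negPf->; rewrite mulr0.
have [zs [szs zN zreg]] := deep pN Na nNx.
pose U e := ~ N e.
(* The members of the list are themselves the multipliers, and the grading is trivial. The formal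
   degree of a preimage is still one less than that of its cycle, so [lo] will be 1. *)
pose M (y mu : C) (e : nat) := mu = y /\ e = 0%N.
pose M' (y mu : C) (e : nat) := mu = 1 /\ e = 0%N.
have UX t : U (x ^+ t) by apply: nprimeX.
have U1 : U 1 by apply: prime1.
have UM y z : U y -> U z -> U (y * z) by apply: nprimeM.
have MMe l mu mu' e e' : M l mu e -> M' l mu' e' -> M l (mu' * mu) (e' + e)%N.
  by move=> [-> ->] [-> ->]; rewrite mul1r.
have MM' l mu mu' e e' : M' l mu e -> M' l mu' e' -> M' l (mu' * mu) (e' + e)%N.
  by move=> [-> ->] [-> ->]; rewrite mulr1.
have Mlo l mu e : M l mu e -> e = 0%N \/ 1%N = 0%N by case; left.
have split J l mu e d y : True -> is_ideal J -> M l mu e -> True -> ideal_adj J mu y ->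
    J y \/ exists d' h, [/\ d.+1 = (d' + e.+1)%N, True & J (y - mu * h)].
  by move=> _ _ [_ ->] _ [h Jh]; right; exists d, h; rewrite addn1.
have reg (J : C -> Prop) ls : lreg U J ls -> regular U M J ls.
  elim: ls J => //= y ls IHl J [yJ reg] mu e [-> _]; split=> //; exact: IHl.
(* Every step raises the exterior degree by one; at the end of the list it exceeds [s], and no
   residual class is possible. *)
have ce ls (J : C -> Prop) p' d : is_ideal J -> (s < p' + size ls)%N ->
    chase_end alpha U (fun _ _ => True) M ls J p' d (fun v : ext C s => v = 0).
  elim: ls J p' d => [|y ls IHl] J p' d iJ lt'; (split; first by move=> u w _ ->; rewrite scaler0).
    move=> w [hw _]; exists 1, 0; rewrite addn0 in lt'; split=> //.
    by rewrite (homd_gt lt' hw) scaler0 subr0; exact: (allc0 _ (ideal0 iJ)).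
  move=> mu e _; exists (fun v => v = 0); split.
    by apply: IHl; [apply: ideal_adjP | rewrite addSnnS].
  by move=> _ ->; exists 0; rewrite iota0 scaler0 subr0; split=> //; exact: (allc0 _ (ideal0 iJ)).
have ex : koszul_exact s alpha U (fun _ _ => True) M' 1 zero_ideal zs p.
  move=> p' [//|d] w pp' _ [hw _] /allc_zero dw l _.
  have [|t [w' [hw' wE]]] := IH p' w _ (ltn_trans p0 pp') hw dw; first by lia.
  exists 1, 0%N, (x ^+ t), w', d; split=> //; first by rewrite addn0.
    by split=> //; apply: allcT.
  by rewrite mulr1 wE subrr; apply: allc0.
have tors : torsion alpha U (fun _ _ => True) M zero_ideal zs p 0 g.
  move=> y /InP_mem/zN[t [w e]]; exists y, 0%N, (x ^+ t), (hproj p.+1 w); split=> //.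
    by split; [apply: hprojP | apply: allcT].
  rewrite hproj_iota -e hproj_id; last by do 2!apply: homdZ.
  by rewrite scalerA subrr; apply: allc0.
have [] := @chase C s alpha U (fun _ _ => True) U1 UM (fun _ _ => I) (fun _ => I)
  (fun _ _ _ _ _ => I) (fun _ _ _ => I) (fun _ _ _ _ _ _ => I) (fun _ _ => I)
  C M M' 1 (fun _ _ _ _ => I) (fun _ _ _ _ => I) MMe MM' Mlo (leqnn 1) (fun _ => True)
  (fun _ _ _ _ _ _ => I) split zs zero_ideal p 0 (fun v => v = 0) g
  (@zero_idealP C) I (reg _ _ zreg) ex _ (conj hg (allcT _)) tors.
  by apply: ce => //; lia.
move=> u [w [_ [Uu -> /allc_zero uE]]]; apply: Uu; exists 0%N, w.
by apply/eqP; rewrite expr0 scale1r -subr_eq0 -[X in X == _]subr0 uE.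
Qed.

End KoszulTorsion.

(** * Graded exactness *)

Section Homogeneous.
Variables (B : comNzRingType) (r : nat).
Local Notation C := {mpoly B[r]}.

Lemma pihomog_mul e d (a x : C) : a \is e.-homog ->
  pihomog mdeg (e + d) (a * x) = a * pihomog mdeg d x.
Proof.
move=> ha; have [k xk] : exists k, x = \sum_(i < k) pihomog mdeg i x.
  by exists (mmeasure mdeg x); apply: pihomog_partitionE.
rewrite [in LHS]xk mulr_sumr raddf_sum [in RHS]xk raddf_sum mulr_sumr /=.
apply: eq_bigr => i _; have hi := pihomogP mdeg i x.
have hai : a * pihomog mdeg i x \is (e + i).-homog by apply: dhomogM.
case: (eqVneq (i : nat) d) => [<-|ne].
  by rewrite pihomog_dE // pihomog_id.
rewrite (pihomog_ne0 (d := (e + i)%N)) //; last by rewrite eqn_add2l.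
by rewrite (pihomog_ne0 (d := i)) // mulr0.
Qed.

Lemma pihomog_mul_lt e d (a x : C) : a \is e.-homog -> (d < e)%N ->
  pihomog mdeg d (a * x) = 0.
Proof.
move=> ha lt; have [k xk] : exists k, x = \sum_(i < k) pihomog mdeg i x.
  by exists (mmeasure mdeg x); apply: pihomog_partitionE.
rewrite xk mulr_sumr raddf_sum big1 //= => i _.
rewrite (pihomog_ne0 (d := (e + i)%N)) //; first by rewrite gtn_eqF // ltn_addr.
by apply: dhomogM => //; apply: pihomogP.
Qed.

Lemma homogXn (l : 'I_r) e : ('X_l : C) ^+ e \is e.-homog.
Proof.
have := @dhomogMn r B mdeg 1 'X_l e; rewrite mul1n; apply.
by rewrite dhomogX /= mdeg1.
Qed.

(** The ideal generated by the powers ['X_l ^+ e] with [(l, e)] in [sg]. Described by supports,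
    membership and regularity are read off coefficients. *)
Definition mono (sg : seq ('I_r * nat)) (p : C) : Prop :=
  forall m : 'X_{1..r}, m \in msupp p -> exists le, le \in sg /\ (le.2 <= m le.1)%N.

Lemma mono_coef sg (p : C) : mono sg p <->
  forall m : 'X_{1..r}, (forall le, le \in sg -> (m le.1 < le.2)%N) -> p@_m = 0.
Proof.
split=> H m; last first.
  rewrite mcoeff_msupp => /eqP pm; apply: NNPP => nn; apply: pm; apply: H => le lein.
  by rewrite ltnNge; apply/negP => lem; apply: nn; exists le.
move=> mlt; apply: NNPP => /eqP; rewrite -mcoeff_msupp => /H[le [/mlt]].
by rewrite ltnNge => /negP.
Qed.

Lemma monoP sg : is_ideal (mono sg).
Proof.
split=> [|x y|a x]; rewrite ?mono_coef.
- by move=> m _; rewrite mcoeff0.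
- by move=> Hx Hy m mlt; rewrite mcoeffD Hx // Hy // addr0.
move=> Hx m mlt; rewrite mcoeffM big1 // => k mE.
rewrite Hx ?mulr0 // => le /mlt; apply: leq_ltn_trans.
have -> : m le.1 = (k.1 + k.2)%MM le.1 by rewrite -(eqP mE).
by rewrite mnmDE leq_addl.
Qed.

Lemma monoX sg (m : 'X_{1..r}) le c : le \in sg -> (le.2 <= m le.1)%N -> mono sg (c *: 'X_[m]).
Proof.
move=> lein lem; rewrite -mul_mpolyC; apply: (idealMl (monoP sg)) => m'.
by rewrite msuppX inE => /eqP->; exists le.
Qed.

Lemma XnE (l : 'I_r) e : ('X_l : C) ^+ e = 'X_[U_(l) *+ e].
Proof. by rewrite mpolyXn. Qed.

Lemma mono_adj sg l e :
  same_ideal (ideal_adj (mono sg) (('X_l : C) ^+ e)) (mono ((l, e) :: sg)).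
Proof.
have iM := monoP ((l, e) :: sg).
move=> p; split; move: p.
  apply: ideal_adj_sub => // [p Hp m /Hp[le [lein lem]]|].
    by exists le; rewrite inE lein orbT.
  rewrite XnE -[X in mono _ X]scale1r; apply: (@monoX _ _ (l, e)); first by rewrite inE eqxx.
  by rewrite /= mulmnE mnm1E eqxx mul1n.
move=> p Hp.
exists (\sum_(m <- msupp p | (e <= m l)%N) p@_m *: 'X_[m - U_(l) *+ e]).
rewrite mulr_sumr {1}[p]mpolyE (bigID (fun m : 'X_{1..r} => (e <= m l)%N)) /=.
set s1 := \sum_(m <- _ | _) _ *: _; set s2 := \sum_(m <- _ | ~~ _) _; set s3 := \sum_(m <- _ | _) _ * _.
have -> : s3 = s1.
  apply: eq_bigr => m em; rewrite -scalerAr XnE -mpolyXD [X in 'X_[X]](_ : _ = m) //.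
  rewrite addmC submK //; apply/mnm_lepP => i; rewrite mulmnE mnm1E.
  by case: eqP => [<-|]; rewrite ?mul1n ?mul0n.
rewrite addrAC subrr add0r; rewrite /s2 big_seq_cond.
apply: (ideal_bigsum (monoP sg)) => m /andP[/Hp[le [lein lem]] nm].
move: lein; rewrite inE => /predU1P[leE|lein]; first by rewrite leE /= (negPf nm) in lem.
exact: monoX lein lem.
Qed.

Lemma mono_nzd sg l e (p : C) : (forall le, le \in sg -> le.1 != l) ->
  mono sg (('X_l : C) ^+ e * p) -> mono sg p.
Proof.
move=> nl /mono_coef H; apply/mono_coef => m mlt.
rewrite -(mcoeffMX p (U_(l) *+ e)%MM m) mulrC -XnE; apply: H => le lein.
by rewrite mnmDE mulmnE mnm1E eq_sym (negPf (nl _ lein)) mul0n add0n; apply: mlt.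
Qed.

Lemma mono_nil : same_ideal (@zero_ideal C) (mono [::]).
Proof.
move=> p; split=> [->|/mono_coef H]; first exact: (ideal0 (monoP _)).
by apply/mpolyP => m; rewrite mcoeff0; apply: H.
Qed.

Definition graded_ideal (J : C -> Prop) := forall x, J x -> forall d, J (pihomog mdeg d x).

Lemma graded_ideal_adj J mu e : is_ideal J -> graded_ideal J -> mu \is e.-homog ->
  graded_ideal (ideal_adj J mu).
Proof.
move=> iJ gJ hmu x [g Jg] d; case: (leqP e d) => [le|lt].
  exists (pihomog mdeg (d - e) g); rewrite -(pihomog_mul _ _ hmu) subnKC // -pihomogB.
  exact: gJ.
exists 0; rewrite mulr0 -(pihomog_mul_lt g hmu lt) -pihomogB; exact: gJ.
Qed.

Lemma graded_ideal_split J mu e d x : is_ideal J -> graded_ideal J -> mu \is e.-homog ->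
  x \is d.-homog -> ideal_adj J mu x ->
  J x \/ exists d' g, [/\ d = (d' + e)%N, g \is d'.-homog & J (x - mu * g)].
Proof.
move=> iJ gJ hmu hx [g Jg]; case: (leqP e d) => [le|lt]; [right|left].
  exists (d - e)%N, (pihomog mdeg (d - e) g); split; [by rewrite subnK | exact: pihomogP |].
  rewrite -(pihomog_mul _ _ hmu) subnKC // -[x in x - _](pihomog_dE hx) -pihomogB.
  exact: gJ.
have := gJ _ Jg d; rewrite pihomogB (pihomog_dE hx) (pihomog_mul_lt g hmu lt) subr0 //.
Qed.

Lemma graded_zero : graded_ideal zero_ideal.
Proof. by move=> x -> d; rewrite pihomog0. Qed.

End Homogeneous.

Section GradedKoszul.
Variables (B : comNzRingType) (r s : nat) (alpha : nat -> {mpoly B[r]}).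
Local Notation C := {mpoly B[r]}.
Local Notation d_ := (@contr C alpha s).
Hypothesis halpha : forall j, (j < s)%N -> alpha j \is 1.-homog.
Hypothesis tor : forall p (v : ext C s), (0 < p)%N -> homd p v -> d_ v = 0 ->
  forall l : 'I_r, exists t w, homd p.+1 w /\ ('X_l : C) ^+ t *: v = d_ w.

Let U (x : C) := x = 1.
Let H (d : nat) (x : C) : Prop := x \is d.-homog.
Let bihom := @bihom C s H.

(** Projection to one bidegree. It commutes with the differential up to the degree shift, so
    preimages can be made bihomogeneous. *)
Definition hcomp p d (v : ext C s) : ext C s := mapc (pihomog mdeg d) (hproj p v).

Lemma hcompP p d v : bihom p d (hcomp p d v).
Proof.
split; first exact: (mapc_homd (pihomog mdeg d)) (hprojP p v).
by apply: mapc_all => x; exact: pihomogP.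
Qed.

Lemma hcomp_id p d v : bihom p d v -> hcomp p d v = v.
Proof.
move=> [hv Hv]; rewrite /hcomp hproj_id //.
by apply: mapc_id Hv => x hx; exact: pihomog_dE.
Qed.

Lemma hcomp_d p d v : d_ (hcomp p.+1 d v) = hcomp p d.+1 (d_ v).
Proof.
rewrite /hcomp -hproj_iota; apply: (mapc_iota (h := pihomog mdeg d) (h' := pihomog mdeg d.+1)).
by move=> j x lt; rewrite -add1n; apply: pihomog_mul; apply: halpha.
Qed.

Let U1 : U 1. Proof. by []. Qed.
Let UM x y : U x -> U y -> U (x * y). Proof. by move=> -> ->; rewrite /U mulr1. Qed.
Let UH x : U x -> H 0 x. Proof. by move=> ->; exact: dhomog1. Qed.
Let H0 e : H e 0. Proof. exact: dhomog0. Qed.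
Let HD e x y : H e x -> H e y -> H e (x + y). Proof. exact: dhomogD. Qed.
Let HN e x : H e x -> H e (- x). Proof. by rewrite /H dhomogN. Qed.
Let HM e d x y : H e x -> H d y -> H (e + d)%N (x * y). Proof. exact: dhomogM. Qed.

Section Regularity.
Variable M : 'I_r -> C -> nat -> Prop.
Hypothesis MX : forall l mu e, M l mu e -> mu = 'X_l ^+ e.+1.

Lemma regular_mono ls sg (J : C -> Prop) : uniq ls -> same_ideal J (mono sg) ->
  (forall le, le \in sg -> le.1 \notin ls) -> regular U M J ls.
Proof.
elim: ls sg J => //= l ls IH sg J /andP[nl ul] JE nsg mu e /MX->; split.
  move=> x /JE Jx; exists 1; split=> //; rewrite mul1r; apply/JE; apply: mono_nzd Jx => le lein.
  by apply: contraNneq (nsg _ lein) => ->; rewrite inE eqxx.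
apply: (IH ((l, e.+1) :: sg)) => // [x|le].
  rewrite -mono_adj; split=> -[g Jg]; exists g; exact/JE.
rewrite inE => /predU1P[->//|/nsg]; by rewrite inE negb_or => /andP[].
Qed.

Lemma graded_split_M (J : C -> Prop) l mu e d x : graded_ideal J -> is_ideal J -> M l mu e ->
  H d.+1 x -> ideal_adj J mu x ->
  J x \/ exists d' g, [/\ d.+1 = (d' + e.+1)%N, H d' g & J (x - mu * g)].
Proof.
move=> gJ iJ /MX-> hx Jx; apply: graded_ideal_split => //; exact: homogXn.
Qed.

End Regularity.

Let M (l : 'I_r) (mu : C) (e : nat) := mu = 'X_l ^+ e.+1.
Let M' (l : 'I_r) (mu : C) (e : nat) := mu = 'X_l ^+ e.
Let graded (J : C -> Prop) := is_ideal J /\ graded_ideal J.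

(** When a power of exponent [e_l] of every variable ['X_l] has been adjoined, each form of degree
    above the sum of the [e_l - 1] is in the ideal. Adjoining ['X_l ^+ e.+1] adds [e] to both sides
    of the inequality, so it persists along the chase. *)
Lemma chase_end_degree ls sg (J : C -> Prop) p d : same_ideal J (mono sg) ->
  (forall l, l \in ls \/ exists e, (l, e) \in sg) ->
  (\sum_(le <- sg) le.2.-1 < d)%N -> (forall le, le \in sg -> 0 < le.2)%N ->
  chase_end alpha U H M ls J p d (fun v : ext C s => v = 0).
Proof.
elim: ls sg J p d => [|l ls IH] sg J p d JE cov lt pos.
  split=> [u v _ ->|v [hv Hv]]; first by rewrite scaler0.
  exists 1, 0; split=> //; rewrite scale1r subr0; apply: allc_sub Hv => x hx.
  apply/JE/mono_coef => m mlt; apply: (dhomog_nemf_coeff hx).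
  apply: contraTneq lt => <-; rewrite -leqNgt /= mdegE.
  have cov' (l : 'I_r) : exists e, (l, e) \in sg by case: (cov l).
  have := cov'; move/fin_all_exists => [e eP].
  apply: (@leq_trans (\sum_l (e l).-1)).
    by apply: leq_sum => l _; have := mlt _ (eP l) => /=; lia.
  have -> : (\sum_l (e l).-1 = \sum_(le <- [seq (l, e l) | l <- enum 'I_r]) le.2.-1)%N.
    by rewrite big_map big_enum.
  have us : uniq [seq (l, e l) | l <- enum 'I_r].
    by rewrite map_inj_uniq ?enum_uniq // => x1 x2 [].
  have sub : {subset [seq (l, e l) | l <- enum 'I_r] <= sg} by move=> _ /mapP[l' _ ->]; apply: eP.
  elim: [seq (l, e l) | l <- enum 'I_r] (sg) us sub => [|y ys IHy] sg' us sub; first by rewrite big_nil.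
  have yin : y \in sg' by apply: sub; rewrite inE eqxx.
  rewrite big_cons (perm_big _ (perm_to_rem yin)) /= big_cons leq_add2l; apply: IHy.
    by case/andP: us.
  move=> z zin; case/andP: us => ny _.
  have := sub z; rewrite inE zin orbT (perm_mem (perm_to_rem yin)) inE => /(_ isT)/predU1P[zy|//].
  by rewrite -zy zin in ny.
split=> [u v _ ->|mu e ->]; first by rewrite scaler0.
exists (fun v => v = 0); split; last first.
  move=> _ ->; exists 0; rewrite iota0 scaler0 subr0; split=> //; apply: allc0.
  by apply/JE; exact: (ideal0 (monoP _ sg)).
apply: (IH ((l, e.+1) :: sg)).
- by move=> x; rewrite -mono_adj; split=> -[g Jg]; exists g; exact/JE.
- move=> l'; case: (cov l') => [|[e' e'in]].
    by rewrite inE => /predU1P[->|]; [right; exists e.+1; rewrite inE eqxx | left].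
  by right; exists e'; rewrite inE e'in orbT.
- by rewrite big_cons /=; lia.
- by move=> le; rewrite inE => /predU1P[->|/pos].
Qed.

(** The chase along powers of all variables. However large these powers are, the coefficient degree
    grows in step with them, and a positive initial degree suffices for the final class to
    vanish. *)
Theorem graded_exact p d (v : ext C s) : bihom p d.+1 v ->
  (forall l : 'I_r, exists t w, ('X_l : C) ^+ t *: v = d_ w) ->
  exists w, bihom p.+1 d w /\ v = d_ w.
Proof.
move=> Kv tv.
have ex : koszul_exact s alpha U H M' 0 zero_ideal (enum 'I_r) p.
  move=> p' d' w pp' _ [hw Hw] /allc_zero dw l _.
  have [t [w' [hw' wE]]] := tor (leq_ltn_trans (leq0n p) pp') hw dw l.
  (* The extra factor ['X_l] keeps the exponent positive, so that the degree [d' + t] of the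
     preimage is one less than that of the multiple even when [d'] and [t] are zero. *)
  exists ('X_l ^+ t.+1), t.+1, 1, (hcomp p'.+1 (d' + t) ('X_l *: w')), (d' + t)%N.
  split=> //; first by rewrite addnS.
    exact: hcompP.
  rewrite hcomp_d iotaZ -wE scalerA -exprS hcomp_id; first by rewrite mul1r subrr; apply: allc0.
  have -> : ((d' + t).+1 = t.+1 + d')%N by lia.
  by apply: bihom_scale => //; apply: homogXn.
have tors : torsion alpha U H M zero_ideal (enum 'I_r) p d.+1 v.
  move=> l _; have [t [w wE]] := tv l.
  exists ('X_l ^+ t.+1), t, 1, (hcomp p.+1 (d.+1 + t) ('X_l *: w)); split=> //.
    exact: hcompP.
  rewrite hcomp_d iotaZ -wE scalerA -exprS hcomp_id; first by rewrite mul1r subrr; apply: allc0.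
  have -> : ((d.+1 + t).+1 = t.+1 + d.+1)%N by lia.
  by apply: bihom_scale => //; apply: homogXn.
have MH l mu e : M l mu e -> H e.+1 mu by move=> ->; apply: homogXn.
have MH' l mu e : M' l mu e -> H e mu by move=> ->; apply: homogXn.
have MM l mu mu' e e' : M l mu e -> M' l mu' e' -> M l (mu' * mu) (e' + e).
  by move=> -> ->; rewrite /M -exprD addnS.
have MM' l mu mu' e e' : M' l mu e -> M' l mu' e' -> M' l (mu' * mu) (e' + e).
  by move=> -> ->; rewrite /M' -exprD.
have Mlo l mu e : M l mu e -> e = 0%N \/ 0%N = 0%N by right.
have gadj (J : C -> Prop) (l : 'I_r) mu e : graded J -> M l mu e -> graded (ideal_adj J mu).
  move=> [iJ gJ] Mmu; split; first exact: ideal_adjP.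
  by apply: graded_ideal_adj (MH _ _ _ Mmu).
have gsplit (J : C -> Prop) (l : 'I_r) mu e d0 x : graded J -> is_ideal J -> M l mu e ->
  H d0.+1 x -> ideal_adj J mu x ->
  J x \/ exists d' g, [/\ d0.+1 = (d' + e.+1)%N, H d' g & J (x - mu * g)].
  by move=> [_ gJ] iJ; apply: (@graded_split_M M) => // l' mu' e' ->.
have g0 : graded zero_ideal by split=> //; exact: graded_zero.
have reg : regular U M zero_ideal (enum 'I_r).
  apply: (@regular_mono M _ _ [::]) => //; [exact: enum_uniq | exact: mono_nil].
have ce : chase_end alpha U H M (enum 'I_r) zero_ideal p d.+1 (fun v : ext C s => v = 0).
  apply: (@chase_end_degree _ [::]) => //; [exact: mono_nil | | by rewrite big_nil].
  by move=> l; left; rewrite mem_enum.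
have [u [w [_ [-> -> /allc_zero vE]]]] := chase U1 UM UH H0 HD HN HM halpha MH MH' MM MM' Mlo
  (leq0n 1) gadj gsplit (@zero_idealP C) g0 reg ex ce Kv tors.
exists (hcomp p.+1 d w); split; first exact: hcompP.
rewrite hcomp_d -[LHS](hcomp_id Kv); congr hcomp.
by apply/eqP; rewrite -subr_eq0 -[X in X == _]subr0 -[v]scale1r vE.
Qed.

End GradedKoszul.

(** * Iterated contractions and maximal minors *)

Section Contraction.
Variable A : comNzRingType.

Fixpoint contract n (phi : nat -> nat -> A) s (w : ext A s) : ext A s :=
  if n is n'.+1 then contr (phi 0%N) (contract n' (fun i => phi i.+1) w) else w.

Lemma contract_ext n phi chi s (w : ext A s) :
  (forall i j, (i < n)%N -> (j < s)%N -> phi i j = chi i j) ->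
  contract n phi w = contract n chi w.
Proof.
elim: n phi chi => //= n IH phi chi e; rewrite (iota_ext (chi := chi 0%N)).
  by congr contr; apply: IH => i j lt; apply: e.
by move=> j lt; apply: e.
Qed.

Lemma contract2 n phi s (w : ext A s.+1) :
  (contract n phi w).2 = (-1) ^+ n *: contract n (fun i j => phi i j.+1) w.2.
Proof.
elim: n phi => [|n IH] phi /=; first by rewrite scale1r.
by rewrite IH iotaZ exprS mulN1r scaleNr.
Qed.

(** Laplace expansion along the first column: in each term of the sum, row [i] takes the first basis
    vector, and the other rows, listed by [bump i], contract the rest. *)
Lemma contract1 n phi s (w : ext A s.+1) :
  (contract n.+1 phi w).1 = contract n.+1 (fun i j => phi i j.+1) w.1
    + (-1) ^+ n *: \sum_(i < n.+1) ((-1) ^+ i * phi i 0%N) *: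
        contract n (fun i' j => phi (bump i i') j.+1) w.2.
Proof.
elim: n phi => [|n IH] phi; first by rewrite big_ord1 /= expr0 mul1r scale1r addrC.
set psi := fun i => phi i.+1.
rewrite -[LHS]/(phi 0%N 0%N *: (contract n.+1 psi w).2 +
  contr (fun j => phi 0%N j.+1) (contract n.+1 psi w).1).
rewrite contract2 IH iotaD iotaZ addrCA; congr (_ + _).
rewrite [in RHS]big_ord_recl /= mul1r. rewrite scalerDr !scalerA; congr (_ + _).
  by rewrite mulrC; congr (_ *: _); apply: contract_ext.
have iota_sum (I : Type) (l : seq I) (F : I -> ext A s) ph :
    contr ph (\sum_(i <- l) F i) = \sum_(i <- l) contr ph (F i).
  by elim/big_rec2: _ => [|i y x _ <-]; rewrite ?iota0 ?iotaD.
rewrite iota_sum !scaler_sumr; apply: eq_bigr => i _; rewrite iotaZ !scalerA.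
rewrite {1 2}/bump /= add1n; congr (_ *: _); first by rewrite /psi !exprS; ring.
congr contr; apply: contract_ext => i' j _ _.
by rewrite /psi /bump /= add1n ltnS addnS.
Qed.

Lemma contract_minors s n (w : ext A s) : exists ks : seq (A * ('I_n -> 'I_s)),
  (forall cg, InP cg ks -> injective cg.2) /\
  forall phi, ecoef [::] (contract n phi w) =
    \sum_(cg <- ks) cg.1 * \det (\matrix_(i, j) phi i (cg.2 j)).
Proof.
elim: s n w => [|s IH] [|n] w.
- exists [:: (w, id)]; split=> [cg [<-|[]] x y //|phi].
  by rewrite big_cons big_nil det_mx00 mulr1 addr0.
- by exists [::]; split=> // phi; rewrite big_nil.
- have [ks [_ kE]] := IH 0%N w.1.
  exists [seq (cg.1, fun i : 'I_0 => widen_ord (leq0n _) i) | cg <- ks].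
  split=> [cg _ []//|phi]; rewrite big_map; have := kE phi; rewrite /= => ->.
  by apply: eq_bigr => cg _; rewrite !det_mx00.
have [k1 [i1 E1]] := IH n.+1 w.1; have [k2 [i2 E2]] := IH n w.2.
pose g2 (g : 'I_n -> 'I_s) (j : 'I_n.+1) : 'I_s.+1 := oapp (fun j' => lift ord0 (g j')) ord0 (unlift ord0 j).
exists ([seq (cg.1, fun i => lift ord0 (cg.2 i)) | cg <- k1] ++ [seq ((-1) ^+ n * cg.1, g2 cg.2) | cg <- k2]).
split=> [cg|phi].
  have InP_map (T T' : Type) (h : T -> T') x l : InP x (map h l) -> exists y, InP y l /\ x = h y.
    elim: l => //= y l IHl [<-|/IHl[z [zl ->]]]; first by exists y; split; [left|].
    by exists z; split; [right|].
  move=> inc0; case: (proj1 (InP_cat _ _ _) inc0) => inc; have [[c g] [cgin ->]] := InP_map _ _ _ _ _ inc; move=> x y /=.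
    by move=> e; exact: (i1 (c, g) cgin x y (lift_inj e)).
  rewrite /g2; case: (unliftP ord0 x) => [x'|] ->; case: (unliftP ord0 y) => [y'|] -> //= e.
  by rewrite (i2 (c, g) cgin x' y' (lift_inj e)).
rewrite -[LHS]/(ecoef [::] (contract n.+1 phi w).1) contract1 ecoefD ecoefZ big_cat !big_map /=.
congr (_ + _).
  rewrite -[LHS]/(ecoef [::] (contract n.+1 (fun i j => phi i j.+1) w.1)) E1.
  by apply: eq_bigr => cg _; congr (_ * \det _); apply/matrixP => i j; rewrite !mxE.
have ecoef_sum (I : Type) (l : seq I) (F : I -> ext A s) b :
    ecoef b (\sum_(i <- l) F i) = \sum_(i <- l) ecoef b (F i).
  by elim/big_rec2: _ => [|i y x _ <-]; rewrite ?ecoef0 ?ecoefD.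
rewrite ecoef_sum (eq_bigr (fun i : 'I_n.+1 => \sum_(cg <- k2)
  cg.1 * (phi i 0%N * ((-1) ^+ i * \det (\matrix_(i', j) phi (bump i i') (cg.2 j).+1))))); last first.
  move=> i _; rewrite ecoefZ (E2 (fun i' j => phi (bump i i') j.+1)) mulr_sumr.
  by apply: eq_bigr => cg _; ring.
rewrite exchange_big /= mulr_sumr; apply: eq_bigr => cg _; rewrite -mulrA; congr (_ * _).
rewrite -mulr_sumr; congr (_ * _); rewrite (expand_det_col _ ord0); apply: eq_bigr => i _.
rewrite mxE /cofactor addn0 /g2 unlift_none /=; congr (_ * (_ * \det _)).
by apply/matrixP => i' j; rewrite !mxE liftK.
Qed.

End Contraction.

(** * The torsion in degree zero with respect to the variables *)

Section DegreeZero.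
Variables (B : comNzRingType) (r s : nat) (phi : nat -> nat -> {mpoly B[r]}).
Local Notation C := {mpoly B[r]}.
Local Notation E := (ext C s).
Hypothesis hphi : forall i j, phi i j \is 0.-homog.
Let alpha j := \sum_(l < r) 'X_l * phi l j.
Local Notation d_ := (@contr C alpha s).
Hypothesis tor : forall p (v : E), (0 < p)%N -> homd p v -> d_ v = 0 ->
  forall l : 'I_r, exists t w, homd p.+1 w /\ ('X_l : C) ^+ t *: v = d_ w.

Let halpha j : (j < s)%N -> alpha j \is 1.-homog.
Proof.
move=> _; apply: rpred_sum => l _; rewrite -[1%N]/(1 + 0)%N; apply: dhomogM => //.
by rewrite -[X in X \is _]expr1; apply: homogXn.
Qed.

Let U (x : C) := x = 1.
Let H (d : nat) (x : C) : Prop := x \is d.-homog.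
Let bihom := @bihom C s H.
Let M (l : 'I_r) (mu : C) (e : nat) := mu = 'X_l /\ e = 0%N.
Let M' (l : 'I_r) (mu : C) (e : nat) := mu = 1 /\ e = 0%N.
Let graded (J : C -> Prop) := is_ideal J /\ graded_ideal J.

Let fold (ls : seq 'I_r) (w : E) : E := foldr (fun l : 'I_r => @contr C (phi l) s) w ls.

Let UH x : U x -> H 0 x. Proof. by move=> ->; exact: dhomog1. Qed.
Let UM x y : U x -> U y -> U (x * y). Proof. by move=> -> ->; rewrite /U mulr1. Qed.
Let H0 e : H e 0. Proof. exact: dhomog0. Qed.
Let HD e x y : H e x -> H e y -> H e (x + y). Proof. exact: dhomogD. Qed.
Let HN e x : H e x -> H e (- x). Proof. by rewrite /H dhomogN. Qed.
Let HM e d x y : H e x -> H d y -> H (e + d)%N (x * y). Proof. exact: dhomogM. Qed.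

Lemma fold_repeat (ls : seq 'I_r) (l : 'I_r) (w : E) : l \in ls -> contr (phi l) (fold ls w) = 0.
Proof.
rewrite /fold; elim: ls => [|l' ls IH] //=.
rewrite inE => /predU1P[->|/IH e]; last by rewrite iota_anti e iota0 oppr0.
exact: iota_sq.
Qed.

Lemma fold_bihom (ls : seq 'I_r) p (w : E) : bihom (p + size ls) 0 w -> bihom p 0 (fold ls w).
Proof.
rewrite /fold; elim: ls p => [|l ls IH] p /=; first by rewrite addn0.
rewrite addnS -addSn => /IH[h1 h2]; split; first exact: homd_iota h1.
apply: (@allc_iota _ (H 0%N) (H 0%N) (phi l) s _ (H0 0%N) (@HD 0%N) (@HN 0%N) _ h2).
by move=> j x _ Hx; exact: (HM (hphi l j) Hx).
Qed.

Let Phi (ls : seq 'I_r) p (v : E) := exists w, bihom (p + size ls) 0 w /\ v = fold ls w.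

(** The differential of [fold ls w] is, modulo [J], reduced to its ['X_l] term: variables outside
    the list are in [J], and rows in [ls] contract [fold ls w] to zero. So each step of the chase
    contracts with one more row. *)
Lemma chase_end_fold (ls : seq 'I_r) (J : C -> Prop) p : is_ideal J -> uniq ls ->
  (forall l : 'I_r, l \in ls \/ J 'X_l) ->
  chase_end alpha U H M ls J p 0 (Phi ls p).
Proof.
elim: ls J p => [|l ls IH] J p iJ /= uls cov.
  split=> [u v -> Pv|v Kv]; first by rewrite scale1r.
  exists 1, v; split=> //; first by exists v; rewrite addn0.
  by rewrite scale1r subrr; apply: allc0; apply: ideal0.
split=> [u v -> Pv|mu e [-> ->]]; first by rewrite scale1r.
case/andP: uls => nl uls.
exists (Phi ls p.+1); split.
  rewrite addn0; apply: IH => //; first exact: ideal_adjP.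
  move=> l'; case: (cov l') => [|Jl']; last by right; exact: ideal_adjl.
  rewrite inE => /predU1P[->|]; last by left.
  by right; apply: (ideal_adj_id 'X_l iJ).
move=> v' [w [Kw ->]]; exists (contr (phi l) (fold ls w)); split.
  by exists w; rewrite /= addnS.
rewrite /alpha (iota_sum_phi (index_enum 'I_r) (fun l : 'I_r => 'X_l) (fun l : 'I_r => phi l)).
rewrite (bigD1 l) //= addrAC subrr add0r.
elim/big_rec: _ => [|l' x nll' Jx]; first by apply: allc0; apply: ideal0.
apply: (allc_add iJ _ Jx).
case: (cov l') => [|Jl']; last first.
  apply: (allcZ (X := fun=> True)); last exact: allcT.
  by move=> z _; rewrite mulrC; apply: idealMl.
rewrite inE (negPf nll') => /= l'in; rewrite fold_repeat // scaler0.
by apply: allc0; apply: ideal0.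
Qed.

(** Here the variables themselves are the multipliers: ['X_l *: v] has degree one, so it is a
    boundary from degree zero, and the chase never leaves degree zero. *)
Theorem torsion_degree0 (v : E) : bihom 0 0 v ->
  (forall l : 'I_r, exists t w, ('X_l : C) ^+ t *: v = d_ w) ->
  exists w, bihom r 0 w /\ v = fold (enum 'I_r) w.
Proof.
move=> Kv tv.
have ex : koszul_exact s alpha U H M' 1 zero_ideal (enum 'I_r) 0.
  move=> p' [|d'] w // pp' _ Kw /allc_zero dw l _.
  have [|w' [Kw' wE]] := graded_exact halpha tor Kw; first by move=> l'; have [t [w' [_ e]]] := tor pp' (proj1 Kw) dw l'; exists t, w'.
  exists 1, 0%N, 1, w', d'; split=> //; first by rewrite addn0.
  by rewrite mulr1 scale1r wE subrr; apply: allc0.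
have hX (l : 'I_r) : ('X_l : C) \is 1.-homog.
  by rewrite -[X in X \is _]expr1; apply: homogXn.
have tors : torsion alpha U H M zero_ideal (enum 'I_r) 0 0 v.
  move=> l _; have [||w [Kw wE]] := @graded_exact _ r s alpha halpha tor 0 0 ('X_l *: v).
  - exact: (bihom_scale HM (hX l) Kv).
  - move=> l'; have [t [w wE]] := tv l'; exists t, ('X_l *: w).
    by rewrite iotaZ -wE !scalerA mulrC.
  exists 'X_l, 0%N, 1, w; split=> //.
  by rewrite mul1r wE subrr; apply: allc0.
have MH l mu e : M l mu e -> H e.+1 mu by move=> [-> ->]; exact: hX.
have MH' l mu e : M' l mu e -> H e mu by move=> [-> ->]; exact: dhomog1.
have MM l mu mu' e e' : M l mu e -> M' l mu' e' -> M l (mu' * mu) (e' + e).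
  by move=> [-> ->] [-> ->]; rewrite mul1r.
have MM' l mu mu' e e' : M' l mu e -> M' l mu' e' -> M' l (mu' * mu) (e' + e).
  by move=> [-> ->] [-> ->]; rewrite mul1r.
have Mlo l mu e : M l mu e -> e = 0%N \/ 1%N = 0%N by move=> [_ ->]; left.
have gadj (J : C -> Prop) (l : 'I_r) mu e : graded J -> M l mu e -> graded (ideal_adj J mu).
  move=> [iJ gJ] Mmu; split; first exact: ideal_adjP.
  by apply: graded_ideal_adj (MH _ _ _ Mmu).
have MX l mu e : M l mu e -> mu = 'X_l ^+ e.+1 by move=> [-> ->].
have gsplit (J : C -> Prop) (l : 'I_r) mu e d0 x : graded J -> is_ideal J -> M l mu e ->
  H d0.+1 x -> ideal_adj J mu x ->
  J x \/ exists d' g, [/\ d0.+1 = (d' + e.+1)%N, H d' g & J (x - mu * g)].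
  by move=> [_ gJ] iJ; apply: (@graded_split_M _ _ M).
have g0 : graded zero_ideal by split=> //; exact: graded_zero.
have reg : regular U M zero_ideal (enum 'I_r).
  by apply: (regular_mono MX (sg := [::])) => //; [exact: enum_uniq | exact: mono_nil].
have ce : chase_end alpha U H M (enum 'I_r) zero_ideal 0 0 (Phi (enum 'I_r) 0).
  by apply: chase_end_fold => //; [exact: enum_uniq | move=> l; left; rewrite mem_enum].
have U1 : U 1 by [].
have [u [w [_ [-> [w0 [Kw0 ->]] /allc_zero vE]]]] := chase U1 UM UH H0 HD HN HM halpha MH MH' MM MM' Mlo
  (leqnn 1) gadj gsplit (@zero_idealP C) g0 reg ex ce Kv tors.
have {}Kw0 : bihom r 0 w0 by rewrite add0n size_enum_ord in Kw0.
exists w0; split=> //; apply/eqP; rewrite -subr_eq0; apply/eqP/allc_zero.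
have e : v - fold (enum 'I_r) w0 = d_ w.
  by apply/eqP; rewrite -subr_eq0 -vE scale1r addrAC.
(* The difference has degree zero and is a boundary; boundaries have no component of degree zero,
   since [alpha] is linear in the variables. *)
have A1 : allc (H 0) (v - fold (enum 'I_r) w0).
  have [_ h1] := Kv; have [_ h2] : bihom 0 0 (fold (enum 'I_r) w0) by apply: fold_bihom; rewrite add0n size_enum_ord.
  by apply: (allcD (HD (e := 0%N)) h1); apply: allcN h2; apply: HN.
have A2 : allc (fun x : C => pihomog mdeg 0 x = 0) (v - fold (enum 'I_r) w0).
  rewrite e; apply: (@allc_iota _ (fun=> True)); last exact: allcT.
  - exact: pihomog0.
  - by move=> x y ex0 ey0; rewrite pihomogD ex0 ey0 addr0.
  - by move=> x ex0; rewrite pihomogN ex0 oppr0.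
  - by move=> j x lt _; apply: pihomog_mul_lt (halpha lt) _.
elim: (s) (v - fold _ _) A1 A2 => /= [x hx|s0 IH x [? ?] [? ?]]; last by split; apply: IH.
by rewrite (pihomog_dE hx).
Qed.

Lemma fold_contract (w : E) : fold (enum 'I_r) w = contract r phi w.
Proof.
have gen n k : foldr (fun i : nat => @contr C (phi i) s) w (iota k n) = contract n (fun i => phi (k + i)%N) w.
  elim: n k => //= n IH k; rewrite addn0 IH; congr contr.
  by apply: contract_ext => i j _ _; rewrite addSnnS.
rewrite -[RHS](gen r 0%N) -val_enum_ord /fold.
by elim: (enum 'I_r) => //= l ls ->.
Qed.

End DegreeZero.

Section ExteriorUnit.
Variable A : comNzRingType.

Fixpoint ext1 s : ext A s := if s is s'.+1 then (ext1 s', 0) else (1 : A).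

Lemma ext1_homd s : homd 0 (ext1 s).
Proof. by elim: s => //= ; left. Qed.

Lemma ext1_allc (X : A -> Prop) s : X 0 -> X 1 -> allc X (ext1 s).
Proof. by move=> X0 X1; elim: s => //= s IH; split=> //; apply: allc0. Qed.

Lemma iota_ext1 phi s : contr phi (ext1 s) = 0.
Proof. by elim: s phi => //= s IH phi; rewrite scaler0 add0r IH iota0 oppr0. Qed.

Lemma ecoef_ext1 s : ecoef [::] (ext1 s) = 1.
Proof. by elim: s. Qed.

Lemma allc_ecoef (X : A -> Prop) s (v : ext A s) : allc X v -> X (ecoef [::] v).
Proof. by elim: s v => //= s IH v [/IH]. Qed.

Lemma wedge0 chi s : wedge chi (0 : ext A s) = 0.
Proof. by elim: s chi => //= s IH chi; rewrite scaler0 !IH subr0. Qed.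

Lemma scale_ext1_boundary alpha s x :
  (exists w : ext A s, x *: ext1 s = contr alpha w) <->
  ideal_of (fun j : 'I_s => alpha j) x.
Proof.
split=> [[w e]|/ideal_of_lin[c ->]].
  rewrite -[x]mulr1 -(ecoef_ext1 s) -ecoefZ e.
  have iI := ideal_ofP (fun j : 'I_s => alpha j).
  apply: allc_ecoef; apply: (@allc_iota _ (fun=> True)); last exact: allcT.
  - exact: ideal0.
  - by move=> y z; apply: idealD.
  - by move=> y; apply: idealN.
  move=> j y lt _; apply: (idealMr iI).
  exact: (@ideal_of_gen A s (fun j : 'I_s => alpha j) (Ordinal lt)).
pose chi j := if insub j is Some j' then c j' else 0.
exists (wedge chi (ext1 s)); have := wedge_iota alpha chi (ext1 s).
rewrite iota_ext1 wedge0 addr0 => ->; congr (_ *: _); apply: eq_bigr => j _.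
by rewrite /chi valK mulrC.
Qed.

End ExteriorUnit.

(** * Torsion modulo the generic linear forms *)

Section TorsionMinors.
Variables (B : comNzRingType) (r s : nat) (psi : 'M[B]_(r, s)).
Local Notation C := {mpoly B[r]}.
Let lin (j : 'I_s) : C := \sum_(i < r) 'X_i * (psi i j)%:MP.
Hypothesis noeC : noetherian C.
Hypothesis deep : forall (l : 'I_r) (N : C -> Prop), prime_ideal N -> (forall j, N (lin j)) ->
  ~ N 'X_l -> exists zs : seq C, [/\ (s <= size zs)%N, {in zs, forall z, N z} &
    lreg (fun u => ~ N u) zero_ideal zs].

(** The exterior algebra is indexed by natural numbers, so [psi] is extended by zero. *)
Let phi (i j : nat) : C :=
  if insub i is Some i' then if insub j is Some j' then (psi i' j')%:MP else 0 else 0.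
Let alpha j : C := \sum_(l < r) 'X_l * phi l j.

Let phiE (i : 'I_r) (j : 'I_s) : phi i j = (psi i j)%:MP.
Proof. by rewrite /phi !valK. Qed.

Let alphaE (j : 'I_s) : alpha j = lin j.
Proof. by apply: eq_bigr => l _; rewrite phiE. Qed.

Let hphi i j : phi i j \is 0.-homog.
Proof.
rewrite /phi; case: insub => [i'|]; last exact: dhomog0.
case: insub => [j'|]; last exact: dhomog0.
rewrite -[_%:MP]mulr1 mul_mpolyC; apply: rpredZ; exact: dhomog1. Qed.

Let halpha j : (j < s)%N -> alpha j \is 1.-homog.
Proof.
move=> _; apply: rpred_sum => l _; rewrite -[1%N]/(1 + 0)%N; apply: dhomogM => //.
by rewrite -[X in X \is _]expr1; apply: homogXn.
Qed.

Let tor p (v : ext C s) : (0 < p)%N -> homd p v -> contr alpha v = 0 ->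
  forall l : 'I_r, exists t w, homd p.+1 w /\ ('X_l : C) ^+ t *: v = contr alpha w.
Proof.
move=> p0 hv dv l; apply: koszul_torsion => // N pN Na; apply: (@deep l) => // j.
by rewrite -alphaE; apply: Na.
Qed.

Lemma graded_ideal_lin : graded_ideal (ideal_of lin).
Proof.
move=> x /ideal_of_lin[c ->] d; have iI := ideal_ofP lin.
rewrite raddf_sum; apply: (ideal_bigsum iI) => j _ /=; rewrite mulrC.
have hj : lin j \is 1.-homog by rewrite -alphaE; apply: halpha.
case: d => [|d]; first by rewrite (pihomog_mul_lt (e := 1%N)) //; apply: (ideal0 iI).
by rewrite -add1n (pihomog_mul _ _ hj); apply: (idealMr iI); apply: ideal_of_gen.
Qed.

(** Components of [g] of positive degree are boundaries, hence combinations of the linear forms; the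
    component of degree zero is an iterated contraction with the rows of [psi], hence a combination
    of minors. [J] is arbitrary so that it can be the preimage of an ideal of [S]. *)
Theorem torsion_minors (g : C) (J : C -> Prop) : is_ideal J -> (forall j, J (lin j)) ->
  (forall h : 'I_r -> 'I_s, injective h -> J (\det (colsub h psi))%:MP) ->
  (forall l : 'I_r, exists t, ideal_of lin ('X_l ^+ t * g)) -> J g.
Proof.
move=> iJ Jlin Jdet tg.
have tgd d l : exists t w, ('X_l : C) ^+ t *: (pihomog mdeg d g *: ext1 C s) = contr alpha w.
  have [t Lt] := tg l; exists t.
  have : ideal_of (fun j : 'I_s => alpha j) ('X_l ^+ t * pihomog mdeg d g).
    rewrite -(pihomog_mul d g (homogXn B l t)).
    apply: (ideal_of_sub (ideal_ofP _) _ (graded_ideal_lin Lt _)) => j.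
    by rewrite -alphaE; apply: (@ideal_of_gen C s (fun j : 'I_s => alpha j) j).
  by move/scale_ext1_boundary => [w e]; exists w; rewrite scalerA.
have Kd d : bihom (fun d (x : C) => x \is d.-homog) 0 d (pihomog mdeg d g *: ext1 C s).
  split; first by apply: homdZ; apply: ext1_homd.
  apply: (allcZ (X := fun x : C => x \is 0.-homog)).
    by move=> x hx; rewrite -[X in X.-homog]addn0; apply: dhomogM => //; apply: pihomogP.
  by apply: ext1_allc; rewrite ?dhomog0 ?dhomog1.
have [n ->] : exists n, g = \sum_(i < n) pihomog mdeg i g.
  by exists (mmeasure mdeg g); apply: pihomog_partitionE.
apply: (ideal_bigsum iJ) => -[[|d] /= _] _; last first.
  have [w [_ e]] := graded_exact halpha tor (Kd d.+1) (tgd d.+1).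
  have /scale_ext1_boundary : exists w, pihomog mdeg d.+1 g *: ext1 C s = contr alpha w by exists w.
  by apply: ideal_of_sub => // j; rewrite alphaE.
have [w [_]] := torsion_degree0 hphi tor (Kd 0%N) (tgd 0%N).
rewrite fold_contract => /(congr1 (fun v : ext C s => ecoef [::] v)).
have [ks [inj ->]] := contract_minors r w; rewrite ecoefZ ecoef_ext1 mulr1 => ->.
have {inj} : forall cg, InP cg ks -> J (cg.1 * \det (\matrix_(i, j) phi i (cg.2 j))).
  move=> [c h] /inj /= injh; apply: idealMl => //.
  suff -> : \det (\matrix_(i, j) phi i (h j)) = (\det (colsub h psi))%:MP by apply: Jdet.
  rewrite -det_map_mx; congr (\det _); apply/matrixP => i j; rewrite !mxE; exact: phiE.
elim: ks => [|cg ks IH] Jk; first by rewrite big_nil; apply: ideal0.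
rewrite big_cons; apply: idealD => //; first by apply: Jk; left.
by apply: IH => cg' cgin; apply: Jk; right.
Qed.

End TorsionMinors.

(** * Powers of a regular sequence *)

Section RegularPowers.
Variable A : comNzRingType.
Implicit Types (J : A -> Prop) (zs : seq A).

Local Notation regular_list := (lreg (fun u => u = 1)).
Local Notation nonzerodivisor J c := (forall p, J (c * p) -> J p).

Lemma gens_split J zs x : is_ideal J -> gens J zs x ->
  exists y, gens zero_ideal zs y /\ J (x - y).
Proof.
move=> iJ /(gens_lin _ _ iJ)[h Jh]; exists (\sum_(t < size zs) zs`_t * h t); split=> //.
by apply/(gens_lin _ _ (@zero_idealP A)); exists h; rewrite /zero_ideal subrr.
Qed.

Lemma gens_join J zs x y : is_ideal J -> gens zero_ideal zs y -> J (x - y) -> gens J zs x.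
Proof.
move=> iJ gy Jxy; have iG := gensP zs iJ; apply: (@idealBl _ _ _ y iG).
  move: gy; apply: gens_sub => // [|z zin]; first exact: zero_ideal_sub.
  exact: gens_mem.
exact: gensl.
Qed.

Lemma nonzerodivisor_lreg J z zs :
  regular_list J (z :: zs) <-> nonzerodivisor J z /\ regular_list (ideal_adj J z) zs.
Proof.
by split=> -[nz reg]; split=> // p /nz; [case=> u [->]; rewrite mul1r | exists 1; rewrite mul1r].
Qed.

(** A vanishing Tor: as [zs] is regular modulo [J + (c)], the coefficients of a combination of [zs]
    that is zero there can be made divisible by [c], one element of the list at a time. *)
Lemma gens_cap J c zs y : is_ideal J -> regular_list (ideal_adj J c) zs ->
  gens zero_ideal zs y -> ideal_adj J c y -> exists y', gens zero_ideal zs y' /\ J (y - c * y').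
Proof.
move=> iJ; have iJc := ideal_adjP c iJ; have i0 := @zero_idealP A.
elim/last_ind: zs y => [|zs z IH] y.
  by move=> _ -> _; exists 0; rewrite mulr0 subr0; split; [|apply: ideal0].
move=> /lreg_rcons[reg nz]; have iG := gensP zs i0.
rewrite -cats1 gens_cat /= => -[b gb] Jy.
have [|_ [-> ]] := nz b.
  apply: (@gens_join _ _ _ (z * b - y)) => //; last by rewrite opprB addrC subrK.
  by rewrite -opprB; apply: (idealN iG).
rewrite mul1r => /(gens_split iJc)[c0 [gc [v Jv]]].
have [|||y1 [gy1 Jy1]] := IH (y - z * (b - c0)) => //.
- have -> : y - z * (b - c0) = (y - z * b) + z * c0 by ring.
  by apply: (idealD iG) => //; apply: (idealMl iG).
- by apply: (idealB iJc) => //; apply: (idealMl iJc); exists v.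
exists (y1 + z * v); split; first by exists v; rewrite addrK.
have -> : y - c * (y1 + z * v) = (y - z * (b - c0) - c * y1) + z * (b - c0 - c * v) by ring.
by apply: (idealD iJ) => //; apply: (idealMl iJ).
Qed.

Lemma gens_cancel J c n zs w : is_ideal J -> nonzerodivisor J c ->
  regular_list (ideal_adj J c) zs ->
  gens (ideal_adj J (c ^+ n.+1)) zs (c ^+ n * w) -> gens (ideal_adj J c) zs w.
Proof.
move=> iJ nz reg; elim: n => [|n IH]; first by rewrite mul1r.
move=> H; apply: IH; have iJn := ideal_adjP (c ^+ n.+1) iJ.
have [b [gb [v Jv]]] := gens_split (ideal_adjP _ iJ) H.
have [b' [gb' Jb']] : exists y', gens zero_ideal zs y' /\ J (b - c * y').
  apply: gens_cap => //; exists (c ^+ n * w - c ^+ n.+1 * v).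
  rewrite -opprB; apply: (idealN iJ); rewrite !exprS in Jv *.
  by move: Jv; congr J; ring.
apply: (gens_join iJn gb'); exists v; apply: nz.
have -> : c * (c ^+ n * w - b' - c ^+ n.+1 * v) =
  (c ^+ n.+1 * w - b - c ^+ n.+2 * v) + (b - c * b') by rewrite !exprS; ring.
exact: (idealD iJ).
Qed.

(** Modulo [J], the powers of [c] filter the quotient by [c ^+ n.+1] with factors isomorphic to the
    quotient by [c], on which [zs] is regular. *)
Lemma lreg_expl J c zs n : is_ideal J -> nonzerodivisor J c ->
  regular_list (ideal_adj J c) zs -> regular_list (ideal_adj J (c ^+ n.+1)) zs.
Proof.
elim: zs J n => // z zs IH J n iJ nz /nonzerodivisor_lreg[zJc reg].
apply/nonzerodivisor_lreg; split.
  elim: n => [|n IHn] y //= Jy; rewrite ?expr1 in Jy *; first exact: zJc.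
  have [g Jg] : ideal_adj J c y.
    apply: zJc; case: Jy => h Jh; exists (c ^+ n.+1 * h).
    by rewrite exprS -mulrA in Jh.
  have [|h Jh] := IHn g.
    case: Jy => h Jh; exists h; apply: nz.
    have -> : c * (z * g - c ^+ n.+1 * h) = (z * y - c ^+ n.+2 * h) - z * (y - c * g).
      by rewrite !exprS; ring.
    by apply: (idealB iJ) => //; apply: (idealMl iJ).
  exists h; have -> : y - c ^+ n.+2 * h = (y - c * g) + c * (g - c ^+ n.+1 * h).
    by rewrite !exprS; ring.
  by apply: (idealD iJ) => //; apply: (idealMl iJ).
have adjC a b : same_ideal (ideal_adj (ideal_adj J a) b) (ideal_adj (ideal_adj J b) a).
  by move=> x; split=> -[g [h Jgh]]; exists h, g; rewrite addrAC.
apply: (lreg_ext (adjC _ _)); apply: IH => [|y|]; first exact: ideal_adjP.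
- move=> [w Jw]; have [v Jv] : ideal_adj J c w.
    by apply: zJc; exists y; rewrite -opprB; apply: (idealN iJ).
  exists v; apply: nz; have -> : c * (y - z * v) = (c * y - z * w) + z * (w - c * v) by ring.
  by apply: (idealD iJ) => //; apply: (idealMl iJ).
by apply: (lreg_ext (adjC _ _)).
Qed.

Lemma lreg_exp J zs n : is_ideal J -> regular_list J zs ->
  regular_list J [seq z ^+ n.+1 | z <- zs].
Proof.
elim: zs J => // c zs IH J iJ /nonzerodivisor_lreg[nz reg].
apply/nonzerodivisor_lreg; split.
  clear IH; elim: n => [|n IHn] y; first by rewrite expr1; apply: nz.
  by rewrite exprS -mulrA => /nz/IHn.
by apply: IH; [apply: ideal_adjP | apply: lreg_expl].
Qed.

(** The powers of the remaining elements are regular modulo [c], so [c ^+ n] cancels against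
    [c ^+ n.+1]; then the next element is treated. *)
Lemma gens_exp_colon J zs n w : is_ideal J -> regular_list J zs ->
  gens J [seq z ^+ n.+1 | z <- zs] (\prod_(z <- zs) z ^+ n * w) -> gens J zs w.
Proof.
elim: zs J => [|c zs IH] J iJ; first by rewrite big_nil mul1r.
move=> /nonzerodivisor_lreg[nz reg]; rewrite big_cons -mulrA /= => H.
have iJc := ideal_adjP c iJ; apply: IH => //.
by apply: gens_cancel H => //; apply: lreg_exp.
Qed.

(** Quasi-regularity, for coefficients in a set meeting [(a)] only in zero. Let [n] be the degree of
    [M], lower coefficients being zero already. The relation is multiplied by the monomial that
    turns [M] into the product of all [a i ^+ n]; any other surviving monomial then has an exponent
    above [n], and [gens_exp_colon] puts the coefficient of [M] into [(a)]. *)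
Theorem regular_coef_zero r (a : 'I_r -> A) (Z : {mpoly A[r]}) (W : A -> Prop) N :
  regular_list zero_ideal [seq a i | i <- enum 'I_r] -> Z.@[a] = 0 ->
  (forall x, W x -> gens zero_ideal [seq a i | i <- enum 'I_r] x -> x = 0) ->
  (forall M : 'X_{1..r}, (mdeg M < N)%N -> W Z@_M) ->
  forall M : 'X_{1..r}, (mdeg M < N)%N -> Z@_M = 0.
Proof.
move=> reg Za W0 ZW M; have i0 := @zero_idealP A.
have [d] := ubnP (mdeg M); elim: d M => // d IH M; rewrite ltnS => Md MN.
set zs := [seq a i | i <- enum 'I_r] in reg W0 *; set n := mdeg M.
have leM i : (M i <= n)%N by rewrite /n mdegE (bigD1 i) //= leq_addr.
apply: (W0 _ (ZW _ MN)); apply: (gens_exp_colon (n := n)) => //.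
set G := gens _ _; have iG : is_ideal G by apply: gensP.
have Gsub (i : 'I_r) e : (n < e)%N -> G (a i ^+ e).
  move=> lt; rewrite -(subnK lt) exprD; apply: (idealMl iG).
  by apply: gens_mem => //; apply/mapP; exists (a i) => //; apply: map_f; rewrite mem_enum.
rewrite big_map big_enum /=.
pose t (M' : 'X_{1..r}) := Z@_M' * \prod_i a i ^+ (n - M i + M' i).
have tE M' : t M' = (\prod_i a i ^+ (n - M i)) * (Z@_M' * \prod_i a i ^+ M' i).
  rewrite /t mulrCA -big_split /=; congr (_ * _); apply: eq_bigr => i _.
  by rewrite exprD.
have e : \sum_(M' <- msupp Z) t M' = 0.
  by rewrite (eq_bigr _ (fun M' _ => tE M')) -mulr_sumr -mevalE Za mulr0.
have tM : t M = (\prod_i a i ^+ n) * Z@_M.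
  rewrite /t mulrC; congr (_ * _); apply: eq_bigr => i _.
  by rewrite subnK.
have Gt M' : M' != M -> G (t M').
  move=> ne; case: (ltnP (mdeg M') n) => [lt|le].
    by rewrite /t IH ?mul0r; [apply: (ideal0 iG) | apply: leq_trans Md | apply: ltn_trans MN].
  have [i lti] : exists i, (M i < M' i)%N.
    apply/existsP; apply: contraNT ne; rewrite negb_exists => /forallP H.
    have {}H i : (M' i <= M i)%N by rewrite leqNgt H.
    apply/eqP/mnmP => i; apply/eqP; rewrite eqn_leq H /=.
    move: le; rewrite /n !mdegE (bigD1 i) //= [in X in (_ <= X)%N](bigD1 i) //=.
    have : (\sum_(j < r | j != i) M' j <= \sum_(j < r | j != i) M j)%N by apply: leq_sum.
    move=> H1 H2; rewrite -(leq_add2r (\sum_(j < r | j != i) M j)).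
    by apply: (leq_trans H2); rewrite leq_add2l.
  rewrite /t (bigD1 i) //=; apply: (idealMl iG); apply: (idealMr iG); apply: Gsub.
  by have := leM i; lia.
rewrite -tM; case: (boolP (M \in msupp Z)) => [Min|nin]; last first.
  by rewrite /t memN_msupp_eq0 // mul0r; apply: ideal0.
move: e; rewrite (bigD1_seq M) ?msupp_uniq //= => /eqP; rewrite addr_eq0 => /eqP->.
by apply: (idealN iG); apply: (ideal_bigsum iG) => M'; apply: Gt.
Qed.

End RegularPowers.

(** * Krull's intersection theorem *)

Section EvalPower.
Variables (A : comNzRingType) (r : nat) (a : 'I_r -> A).
Local Notation Ax := {mpoly A[r]}.

(* The [n]-th power of the ideal [(a)], as values of homogeneous polynomials of degree [n]. *)
Definition eval_power n (x : A) := exists P : Ax, P \is n.-homog /\ x = P.@[a].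

Lemma eval_powerM e n x y : eval_power e x -> eval_power n y -> eval_power (e + n) (x * y).
Proof.
by move=> [P [hP ->]] [Q [hQ ->]]; exists (P * Q); rewrite mevalM; split=> //; apply: dhomogM.
Qed.

Lemma eval_power0 x : eval_power 0 x.
Proof.
exists x%:MP; rewrite mevalC; split=> //.
rewrite -[_%:MP]mulr1 mul_mpolyC; apply: rpredZ; exact: dhomog1.
Qed.

Lemma eval_powerP n : is_ideal (eval_power n).
Proof.
split=> [|x y [P [hP ->]] [Q [hQ ->]]|x y]; last exact: (eval_powerM (eval_power0 x)).
  by exists 0; rewrite meval0; split=> //; apply: dhomog0.
by exists (P + Q); rewrite mevalD; split=> //; apply: dhomogD.
Qed.

Lemma eval_power1 i : eval_power 1 (a i).
Proof.
exists 'X_i; rewrite mevalXU; split=> //.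
by rewrite -[X in X \is _]expr1; apply: homogXn.
Qed.

Lemma eval_powerS_ind n (I : A -> Prop) : is_ideal I ->
  (forall i x, eval_power n x -> I (a i * x)) -> forall x, eval_power n.+1 x -> I x.
Proof.
move=> iI aI _ [P [/dhomogP hP ->]]; rewrite mevalE big_seq; apply: (ideal_bigsum iI) => M Min.
apply: (idealMl iI); have Mn := hP _ Min; rewrite -mevalX.
have [i Mi] : exists i, (0 < M i)%N.
  apply/existsP; apply: contraT; rewrite negb_exists => /forallP M0.
  move: Mn; rewrite /= mdegE big1 // => i _; apply/eqP; rewrite -leqn0 leqNgt; exact: M0.
have ME : M = (U_(i) + (M - U_(i)))%MM.
  rewrite addmC submK //; apply/mnm_lepP => j; rewrite mnm1E.
  by case: eqP => [<-|].
move: Mn; rewrite ME; set M' := (M - _)%MM => /=; rewrite mdegD mdeg1 add1n => -[e].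
rewrite mpolyXD mevalM mevalXU; apply: aI; exists 'X_[M']; split=> //.
by rewrite dhomogX /= e.
Qed.

Lemma eval_powerS n x : eval_power n.+1 x -> eval_power n x.
Proof. by apply: eval_powerS_ind; [exact: eval_powerP | move=> i y; apply: (idealMl (eval_powerP n))]. Qed.

Lemma eval_power_le n d x : (n <= d)%N -> eval_power d x -> eval_power n x.
Proof.
move=> /subnK <-; elim: (d - n)%N => //= e IH /eval_powerS; exact: IH.
Qed.

Lemma eval_power_ideal n x : eval_power n.+1 x -> ideal_of a x.
Proof.
apply: eval_powerS_ind; first exact: ideal_ofP.
by move=> i y _; apply: (idealMr (ideal_ofP a)); apply: ideal_of_gen.
Qed.

(** In place of the Artin-Rees lemma, forms [P n] of degree [n] are chosen with [u] congruent to
    their values at [a]. Noetherianity makes some [P N] a combination of earlier ones, with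
    homogeneous cofactors of positive degree; the values of these cofactors add up to [e]. *)
Theorem krull_intersection (I : A -> Prop) u : noetherian Ax -> is_ideal I ->
  (forall n, exists y, eval_power n y /\ I (u - y)) ->
  exists e, ideal_of a e /\ I ((1 - e) * u).
Proof.
move=> noe iI uI.
have exP n : exists P : Ax, P \is n.-homog /\ I (u - P.@[a]).
  by have [_ [[P [hP ->]] Iy]] := uI n; exists P.
pose P n := sval (constructive_indefinite_description _ (exP n)).
have PP n : P n \is n.-homog /\ I (u - (P n).@[a]).
  exact: (svalP (constructive_indefinite_description _ (exP n))).
pose L n := gens (@zero_ideal Ax) [seq P t | t <- iota 0 n].
have iL n : is_ideal (L n) by apply: gensP.
have [|M [iM [N MN] maxM]] := noeth_max noe (F := fun I0 => exists N, same_ideal I0 (L N)) (iL 0%N).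
  by exists 0%N.
have /(gens_lin _ _ (@zero_idealP Ax))[h] : L N (P N).
  apply/MN/(maxM (L N.+1)); [exact: iL | by exists N.+1 | move=> x /MN |].
    apply: gens_sub => // [|z]; first exact: zero_ideal_sub.
    by move=> /mapP[t tin ->]; apply: gens_mem => //; apply: map_f; move: tin; rewrite !mem_iota /= !add0n => /ltnW.
  by apply: gens_mem => //; apply: map_f; rewrite mem_iota /=.
rewrite size_map size_iota => /eqP; rewrite subr_eq0 => /eqP hE.
pose Q t := pihomog mdeg (N - t) (h t).
have PN : P N = \sum_(t < N) P t * Q t.
  rewrite -[LHS](pihomog_dE (proj1 (PP N))) hE raddf_sum; apply: eq_bigr => t _.
  have lt := ltn_ord t; rewrite /= (nth_map 0%N) ?size_iota // nth_iota // add0n.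
  by rewrite -[X in pihomog _ X](subnKC (ltnW lt)) (pihomog_mul _ _ (proj1 (PP t))).
have ia := ideal_ofP a.
exists (\sum_(t < N) (Q t).@[a]); split.
  apply: (ideal_bigsum ia) => t _; apply: (@eval_power_ideal (N - t).-1).
  by exists (Q t); split=> //; rewrite prednK ?subn_gt0 //; apply: pihomogP.
have -> : (1 - \sum_(t < N) (Q t).@[a]) * u = (u - (P N).@[a])
    - \sum_(t < N) (Q t).@[a] * (u - (P t).@[a]).
  have -> : (P N).@[a] = \sum_(t < N) (P t).@[a] * (Q t).@[a].
    by rewrite PN raddf_sum; apply: eq_bigr => t _; rewrite /= mevalM.
  rewrite mulrBl mul1r mulr_suml -!addrA; congr (_ + _).
  rewrite -!sumrN -big_split /=; apply: eq_bigr => t _; ring.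
apply: (idealB iI); first exact: (proj2 (PP N)).
by apply: (ideal_bigsum iI) => t _; apply: (idealMl iI); exact: (proj2 (PP t)).
Qed.

End EvalPower.

(** * Expansions along a regular sequence *)

Lemma gens_ideal_of (A : comNzRingType) r (a : 'I_r -> A) :
  same_ideal (gens zero_ideal [seq a i | i <- enum 'I_r]) (ideal_of a).
Proof. by move=> x; split=> /ideal_of_gens. Qed.

Lemma mcoeff_mul_homog0 (A : comNzRingType) r N (P Q : {mpoly A[r]}) (M : 'X_{1..r}) :
  P \is N.-homog -> (mdeg M < N)%N -> (Q * P)@_M = 0.
Proof.
move=> hP lt; rewrite mcoeffM big1 // => k /eqP kE.
have {}kE : mdeg M = (mdeg k.1 + mdeg k.2)%N by rewrite {1}kE mdegD.
rewrite [X in _ * X](dhomog_nemf_coeff hP) ?mulr0 //= neq_ltn.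
have le : (mdeg k.2 <= mdeg M)%N := leq_trans (leq_addl (mdeg k.1) _) (eq_leq (esym kE)).
by rewrite (leq_ltn_trans le lt).
Qed.

Section Expansion.
Variables (R : comNzRingType) (k : fieldType) (f : {rmorphism k -> R}) (r m : nat).
Variable a : 'I_r -> R.
Local Notation B := {mpoly k[m]}.
Local Notation S := {mpoly R[m]}.
Local Notation C := {mpoly B[r]}.
Local Notation Sx := {mpoly S[r]}.
Local Notation F := (map_mpoly f : {rmorphism B -> S}).
Local Notation Fx := (map_mpoly F : {rmorphism C -> Sx}).
Let aS : 'I_r -> S := fun i => (a i)%:MP.
Let J : R -> Prop := gens zero_ideal [seq a i | i <- enum 'I_r].
Let iJ : is_ideal J := gensP _ (@zero_idealP R).

Definition combC (e : seq R) (G : nat -> C) : Sx := \sum_(i < size e) ((e`_i)%:MP)%:MP * Fx (G i).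

Lemma coef_ideal_lin (g : S) : coef_ideal J g -> exists z : 'I_r -> S, g = \sum_i z i * aS i.
Proof.
move=> Jg; apply/ideal_of_lin; apply/gens_ideal_of.
rewrite /aS (map_comp (@mpolyC m R)); exact/gens_aS.
Qed.

Lemma combC_cat e e' G :
  combC e G = combC (e ++ e') (fun i => if (i < size e)%N then G i else 0).
Proof.
rewrite /combC size_cat big_split_ord /= [X in _ = _ + X]big1 ?addr0.
  by apply: eq_bigr => i _; rewrite nth_cat ltn_ord.
by move=> i _; rewrite ltnNge leq_addr /= rmorph0 mulr0.
Qed.

Lemma combC_mull e G c : Fx c * combC e G = combC e (fun i => c * G i).
Proof. by rewrite mulr_sumr; apply: eq_bigr => i _; rewrite rmorphM mulrCA. Qed.

Lemma combCD e G G' : combC e G + combC e G' = combC e (fun i => G i + G' i).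
Proof. by rewrite -big_split; apply: eq_bigr => i _; rewrite rmorphD mulrDr. Qed.

Lemma combC_sum e n (G : 'I_n -> nat -> C) :
  \sum_(t < n) combC e (G t) = combC e (fun i => \sum_(t < n) G t i).
Proof.
rewrite exchange_big; apply: eq_bigr => i _.
by rewrite rmorph_sum mulr_sumr.
Qed.

Lemma mcoeff_combC e G M : (combC e G)@_M = combS f e (fun i => (G i)@_M).
Proof.
rewrite raddf_sum /=; apply: eq_bigr => i _.
by rewrite mcoeffCM mcoeff_map_mpoly.
Qed.

Lemma combC_const e b : (combC e (fun i => (b i)%:MP)).@[aS] = combS f e b.
Proof.
rewrite raddf_sum /=; apply: eq_bigr => i _.
by rewrite mevalM mevalC map_mpolyC mevalC.
Qed.

(** Each round expands modulo [(a)], writes the remainder as a combination of the [aS i], and passes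
    its coefficients to the next round; the family grows but stays independent. *)
Lemma expand_power N e (ys : seq S) : indep f J e -> exists e', indep f J (e ++ e') /\
  {in ys, forall y, exists G, eval_power aS N (y - (combC (e ++ e') G).@[aS])}.
Proof.
elim: N e ys => [|N IH] e ys ie.
  exists [::]; rewrite cats0; split=> // y _; exists (fun=> 0); exact: eval_power0.
have [e1 [ie1 ex1]] := expandS iJ ys ie.
have exz y : exists bz : (nat -> B) * ('I_r -> S), y \in ys ->
    y - combS f (e ++ e1) bz.1 = \sum_i bz.2 i * aS i.
  case: (boolP (y \in ys)) => [yin|nin]; last by exists (fun=> 0, fun=> 0).
  have [b Jb] := ex1 y yin; have [z zE] := coef_ideal_lin Jb.
  by exists (b, z).
pose bz y := sval (constructive_indefinite_description _ (exz y)).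
have bzP y : y \in ys -> y - combS f (e ++ e1) (bz y).1 = \sum_i (bz y).2 i * aS i.
  exact: (svalP (constructive_indefinite_description _ (exz y))).
have [e2 [ie2 ex2]] := IH (e ++ e1) (flatten [seq [seq (bz y).2 i | i <- enum 'I_r] | y <- ys]) ie1.
exists (e1 ++ e2); rewrite catA; split=> // y yin.
have exH (i : 'I_r) : exists H, eval_power aS N ((bz y).2 i - (combC ((e ++ e1) ++ e2) H).@[aS]).
  apply: ex2; apply/flattenP; exists [seq (bz y).2 i | i <- enum 'I_r]; first exact: map_f.
  by apply: map_f; rewrite mem_enum.
have /fin_all_exists[H HP] := exH.
exists (fun i => (if (i < size (e ++ e1))%N then ((bz y).1 i)%:MP else 0) + \sum_l 'X_l * H l i).
rewrite -combCD -combC_cat mevalD combC_const opprD addrA bzP //.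
rewrite -(combC_sum _ (fun l i => 'X_l * H l i)) (raddf_sum (meval aS)).
rewrite -sumrB.
apply: (ideal_bigsum (eval_powerP aS N.+1)) => l _.
rewrite -combC_mull /= mevalM map_mpolyX mevalXU mulrC -mulrBr -add1n.
exact: eval_powerM (eval_power1 _ _) (HP l).
Qed.

End Expansion.

Lemma dhomog_map (A D : comNzRingType) (h : {rmorphism A -> D}) r d (p : {mpoly A[r]}) :
  p \is d.-homog -> map_mpoly h p \is d.-homog.
Proof.
move=> /dhomogP hp; apply/dhomogP => M; rewrite mcoeff_msupp mcoeff_map_mpoly => nz.
by apply: hp; rewrite mcoeff_msupp; apply/eqP => p0; move: nz; rewrite p0 raddf0 eqxx.
Qed.

Lemma pihomog_eq0 (A : comNzRingType) r d (p : {mpoly A[r]}) :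
  (forall M : 'X_{1..r}, mdeg M = d -> p@_M = 0) -> pihomog mdeg d p = 0.
Proof.
move=> p0; rewrite pihomogE big1 // => M /eqP Md.
by rewrite p0 ?scale0r.
Qed.

(** * The saturation modulo powers of the regular sequence *)

Section SaturationOrder.
Variables (R : comNzRingType) (k : fieldType) (f : {rmorphism k -> R}) (r m s : nat).
Variables (a : 'I_r -> R) (psi : 'M[{mpoly k[m]}]_(r, s)).
Local Notation B := {mpoly k[m]}.
Local Notation S := {mpoly R[m]}.
Local Notation C := {mpoly B[r]}.
Local Notation Sx := {mpoly S[r]}.
Local Notation F := (map_mpoly f : {rmorphism B -> S}).
Local Notation Fx := (map_mpoly F : {rmorphism C -> Sx}).
Let aS : 'I_r -> S := fun i => (a i)%:MP.
Let apsi : 'I_s -> S := fun j => \sum_(i < r) aS i * F (psi i j).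
Let lin (j : 'I_s) : C := \sum_(i < r) 'X_i * (psi i j)%:MP.
Hypothesis reg : regular_seq a.
Hypothesis deep : forall (l : 'I_r) (N : C -> Prop), prime_ideal N -> (forall j, N (lin j)) ->
  ~ N 'X_l -> exists zs : seq C, [/\ (s <= size zs)%N, {in zs, forall z, N z} &
    lreg (fun u => ~ N u) zero_ideal zs].
Variable I : S -> Prop.
Hypotheses (iI : is_ideal I) (Iapsi : forall j, I (apsi j)).
Hypothesis Idet : forall h : 'I_r -> 'I_s, injective h -> I (F (\det (colsub h psi))).

Let theta (g : C) : S := (Fx g).@[aS].

Let theta_lin j : theta (lin j) = apsi j.
Proof.
rewrite /theta /lin (rmorph_sum Fx) (raddf_sum (meval aS)); apply: eq_bigr => i _.
by rewrite /= rmorphM /= mevalM map_mpolyX mevalXU map_mpolyC mevalC.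
Qed.

(** [u] and the cofactors of all [aS l ^+ t * u] are expanded along one independent family. By
    quasi-regularity the lifted relations [D l i] vanish in low degree, coordinate by coordinate, so
    the low components of the coordinates of [u] are torsion modulo [lin]. *)
Lemma saturation_order u t : (forall l, ideal_of apsi (aS l ^+ t * u)) ->
  forall n, exists y, eval_power aS n y /\ I (u - y).
Proof.
(* Multiplication by ['X_l ^+ t] raises degrees by [t], so components below degree [n] are
   controlled by an expansion of order [n + t]. *)
move=> tu n; set N := (n + t)%N.
have noeC : noetherian C := noetherian_mpoly (noetherian_mpoly (@noetherian_field k)).
have /fin_all_exists[c cP] : forall l, exists c : 'I_s -> S, aS l ^+ t * u = \sum_j c j * apsi j.
  by move=> l; apply/ideal_of_lin.
pose J := gens zero_ideal [seq a i | i <- enum 'I_r].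
have iJ : is_ideal J by apply: gensP.
have aSE : [seq aS i | i <- enum 'I_r] = [seq c%:MP | c <- [seq a i | i <- enum 'I_r]].
  exact: (map_comp (@mpolyC m R) a (enum 'I_r)).
have i0 : indep f J [::] by [].
have [e [ie ex]] := @expand_power R k f r m a N [::]
   (u :: [seq c lj.1 lj.2 | lj <- enum {: 'I_r * 'I_s}]) i0.
rewrite cat0s in ie ex.
have [U [Pu [hPu uE]]] := ex u (mem_head _ _).
have /fin_all_exists[GP GPE] : forall lj : 'I_r * 'I_s, exists GP : (nat -> C) * Sx,
    GP.2 \is N.-homog /\ c lj.1 lj.2 - (combC f e GP.1).@[aS] = GP.2.@[aS].
  move=> lj; have [|G [P [hP cE]]] := ex (c lj.1 lj.2); last by exists (G, P).
  by rewrite inE; apply/orP; right; apply/mapP; exists lj => //; rewrite mem_enum.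
pose D l i : C := 'X_l ^+ t * U i - \sum_j lin j * (GP (l, j)).1 i.
(* The lifted relation with its remainders of order [N]: its value at [aS] is zero, and below degree
   [N] only the part along the family remains. *)
pose Z l : Sx := combC f e (D l) + ('X_l ^+ t * Pu - \sum_j Fx (lin j) * (GP (l, j)).2).
have Z0 l : (Z l).@[aS] = 0.
  have -> : Z l = 'X_l ^+ t * (combC f e U + Pu)
      - \sum_j Fx (lin j) * (combC f e (GP (l, j)).1 + (GP (l, j)).2).
    rewrite /Z (_ : combC f e (D l) = 'X_l ^+ t * combC f e U
        - \sum_j Fx (lin j) * combC f e (GP (l, j)).1).
      rewrite mulrDr addrACA -opprD -big_split /=; congr (_ - _).
      by apply: eq_bigr => j _; rewrite mulrDr.
    rewrite (eq_bigr (fun j => combC f e (fun i => lin j * (GP (l, j)).1 i))); last first.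
      by move=> j _; rewrite combC_mull.
    rewrite (combC_sum f e (fun j i => lin j * (GP (l, j)).1 i)).
    have -> : 'X_l ^+ t = Fx ('X_l ^+ t) by rewrite rmorphXn /= map_mpolyX.
    rewrite combC_mull /combC -sumrB; apply: eq_bigr => i _.
    by rewrite -mulrBr -rmorphB.
  rewrite mevalB mevalM mevalD -uE (addrC _ (u - _)) subrK rmorphXn /= mevalXU cP.
  rewrite (raddf_sum (meval aS)) -sumrB big1 // => j _.
  have e1 : (combC f e (GP (l, j)).1).@[aS] + (GP (l, j)).2.@[aS] = c l j.
    by rewrite -(proj2 (GPE (l, j))) /= addrC subrK.
  have tl : (map_mpoly F (lin j)).@[aS] = apsi j := theta_lin j.
  by rewrite /= mevalM mevalD e1 tl mulrC subrr.
have D0 l i (M : 'X_{1..r}) : (i < size e)%N -> (mdeg M < N)%N -> (D l i)@_M = 0.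
  move=> ilt; move: M.
  have ZW (M : 'X_{1..r}) : (mdeg M < N)%N -> (Z l)@_M = combS f e (fun i => (D l i)@_M).
    move=> lt; rewrite mcoeffD mcoeff_combC mcoeffB (mcoeff_mul_homog0 _ hPu lt) sub0r.
    rewrite raddf_sum big1 ?oppr0 ?addr0 // => j _.
    by rewrite /= (mcoeff_mul_homog0 _ (proj1 (GPE (l, j))) lt).
  have Zreg := @regular_coef_zero S r aS (Z l) (fun x => exists b, x = combS f e b) N _ (Z0 l).
  move=> M lt; have : combS f e (fun i => (D l i)@_M) = 0.
    rewrite -ZW //; apply: Zreg lt.
    - rewrite aSE; apply: (@lreg_mpolyC R m zero_ideal zero_ideal) => [//||]; last exact: regular_seq_lreg.
      move=> g; split=> [-> mm|g0]; first by rewrite /zero_ideal mcoeff0.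
      by apply/mpolyP => mm; rewrite mcoeff0; apply: g0.
    - move=> _ [b ->] Gb; have Jb : coef_ideal J (combS f e b).
        by apply/gens_aS; rewrite -aSE.
      rewrite /combS big1 // => i' _; rewrite (combS_indep ie Jb) // rmorph0 mulr0.
      by [].
    by move=> M' /ZW->; exists (fun i => (D l i)@_M').
  move=> c0; apply: (combS_indep ie (b := fun i => (D l i)@_M)) ilt.
  by rewrite c0; move=> mm; rewrite mcoeff0; apply: (ideal0 iJ).
pose I' x := exists y, eval_power aS n y /\ I (x - y).
have iE := eval_powerP aS n.
have iI' : is_ideal I'.
  split=> [|x y [x' [Ex Ix]] [y' [Ey Iy]]|x y [y' [Ey Iy]]].
  - by exists 0; rewrite subrr; split; [apply: (ideal0 iE) | apply: (ideal0 iI)].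
  - exists (x' + y'); split; first exact: (idealD iE).
    by rewrite opprD addrACA; apply: (idealD iI).
  by exists (x * y'); rewrite -mulrBr; split; [apply: (idealMl iE) | apply: (idealMl iI)].
rewrite -/(I' u); have -> : u = (combC f e U).@[aS] + Pu.@[aS] by rewrite -uE addrC subrK.
apply: (idealD iI'); last first.
  exists Pu.@[aS]; rewrite subrr; split; last exact: (ideal0 iI).
  by apply: (@eval_power_le _ _ _ _ N); [rewrite leq_addr | exists Pu].
rewrite /combC (raddf_sum (meval aS)); apply: (ideal_bigsum iI') => i _.
rewrite /= mevalM; apply: (idealMl iI').
have [K UK] : exists K, U i = \sum_(d < K) pihomog mdeg d (U i).
  by exists (mmeasure mdeg (U i)); apply: pihomog_partitionE.
rewrite UK (rmorph_sum Fx) (raddf_sum (meval aS)); apply: (ideal_bigsum iI') => d _ /=.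
case: (ltnP d n) => [lt|le]; last first.
  exists (Fx (pihomog mdeg d (U i))).@[aS]; rewrite subrr; split; last exact: (ideal0 iI).
  apply: (eval_power_le le); exists (Fx (pihomog mdeg d (U i))); split=> //.
  by apply: dhomog_map; apply: pihomogP.
exists 0; split; first exact: (ideal0 iE).
rewrite subr0 -/(theta _); apply: (torsion_minors noeC deep (J := fun g => I (theta g))).
- exact: (preim_ideal [the {rmorphism C -> S} of (meval aS \o Fx)] iI).
- by move=> j; rewrite theta_lin.
- by move=> h injh; rewrite /theta /= map_mpolyC mevalC; apply: Idet.
move=> l; exists t; rewrite -(pihomog_mul _ _ (homogXn B l t)).
have : pihomog mdeg (t + d) (D l i) = 0.
  by apply: pihomog_eq0 => M Md; apply: D0; rewrite ?ltn_ord // Md addnC ltn_add2r.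
rewrite /D raddfB /= => /eqP; rewrite subr_eq0 => /eqP->.
apply: graded_ideal_lin; apply: (ideal_bigsum (ideal_ofP lin)) => j _.
by apply: (idealMr (ideal_ofP lin)); apply: ideal_of_gen.
Qed.

End SaturationOrder.

(** * Homogeneous ideals over a local ring *)

Section GradedLocal.
Variables (R : comNzRingType) (mm : R -> Prop) (r m : nat) (a : 'I_r -> R).
Hypotheses (locR : local_ring_with mm) (noeR : noetherian R) (na1 : ~ ideal_of a 1).
Local Notation S := {mpoly R[m]}.
Let aS : 'I_r -> S := fun i => (a i)%:MP.

Lemma dhomog0_const (p : S) : p \is 0.-homog -> p = (p@_0%MM)%:MP.
Proof.
move=> hp; apply/mpolyP => M; rewrite mcoeffC; case: eqP => [<-|ne]; first by rewrite mulr1.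
rewrite mulr0; apply: (dhomog_nemf_coeff hp) => /=; rewrite mdeg_eq0.
by apply/eqP => e; apply: ne.
Qed.

(** [S] need not be local, so a unit is found in degree zero: the component of [1 - e] there is
    [1 - w] with [w] in the maximal ideal of [R]. By increasing degree, the components of
    [(1 - e) * u] then put those of [u] into [I]. *)
Lemma graded_local_closed (I : S -> Prop) u : is_ideal I -> graded_ideal I ->
  (forall n, exists y, eval_power aS n y /\ I (u - y)) -> I u.
Proof.
move=> iI gI uI; have [imm mm1 unitR] := locR.
have [e [/ideal_of_lin[c eE] Ieu]] :=
  krull_intersection (@noetherian_mpoly _ r (@noetherian_mpoly _ m noeR)) iI uI.
have amm i : mm (a i).
  apply: NNPP => /unitR[y ay]; apply: na1; rewrite -ay.
  by apply: (idealMr (ideal_ofP a)); apply: ideal_of_gen.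
have haS i : aS i \is 0.-homog.
  by rewrite -[aS i]mulr1 mul_mpolyC; apply: rpredZ; exact: dhomog1.
have [y y1] : exists y : R, pihomog mdeg 0 (1 - e) * y%:MP = 1.
  have [w [mw ->]] : exists w, mm w /\ pihomog mdeg 0 (1 - e) = (1 - w)%:MP.
    exists (\sum_i a i * (pihomog mdeg 0 (c i))@_0%MM); split.
      by apply: (ideal_bigsum imm) => i _; apply: (idealMr imm).
    rewrite pihomogB (pihomog_dE (dhomog1 _ _)) mpolyCB; congr (_ - _).
    rewrite eE raddf_sum raddf_sum; apply: eq_bigr => i _ /=.
    rewrite mulrC (pihomog_mul 0 (c i) (haS i)) mpolyCM; congr (_ * _).
    exact/dhomog0_const/pihomogP.
  have [|y wy] := unitR (1 - w).
    by move=> m1w; apply: mm1; rewrite -(subrK w 1); apply: (idealD imm).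
  by exists y; rewrite -mpolyCM wy.
have Id d : I (pihomog mdeg d u).
  have [n] := ubnP d; elim: n d => // n IH d; rewrite ltnS => dn.
  rewrite -[pihomog _ _ _]mulr1 -y1 mulrA; apply: (idealMr iI).
  pose K := maxn (mmeasure mdeg u) d.+1.
  have ltK : (d < K)%N by rewrite leq_max ltnSn orbT.
  have uK : u = \sum_(i < K) pihomog mdeg i u.
    by apply: pihomog_partitionE; rewrite leq_maxl.
  have : I (pihomog mdeg d ((1 - e) * u)) by apply: gI.
  rewrite {1}uK mulr_sumr raddf_sum (bigD1 (Ordinal ltK)) //= mulrC.
  have hu i := pihomogP mdeg i u.
  rewrite -[X in pihomog _ X _ + _]addn0 (pihomog_mul _ _ (hu d)); set rest := \sum_(i < K | _) _.
  suff Irest : I rest by move=> Isum; rewrite -[X in I X](addrK rest); apply: (idealB iI).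
  apply: (ideal_bigsum iI) => i /eqP ne; rewrite mulrC; case: (ltngtP i d) => [lt|lt|e0].
  - rewrite -(subnKC (ltnW lt)) (pihomog_mul _ _ (hu i)); apply: (idealMr iI).
    by apply: IH; apply: leq_trans lt dn.
  - by rewrite (pihomog_mul_lt _ (hu i) lt); apply: (ideal0 iI).
  by case: ne; apply: val_inj.
have [K ->] : exists K, u = \sum_(i < K) pihomog mdeg i u.
  by exists (mmeasure mdeg u); apply: pihomog_partitionE.
by apply: (ideal_bigsum iI) => i _; apply: Id.
Qed.

End GradedLocal.

(** * The residual ideal *)

Lemma graded_ideal_gen (A : comNzRingType) n (G : {mpoly A[n]} -> Prop) :
  (forall g, G g -> exists d, g \is d.-homog) -> graded_ideal (ideal_gen G).
Proof.
move=> hG; have iI := ideal_genP G.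
pose I' x := forall d, ideal_gen G (pihomog mdeg d x).
suff iI' : is_ideal I' /\ subid G I' by move=> x; case: iI' => iI' GI'; exact: (ideal_gen_sub iI' GI').
split; last first.
  move=> g Gg d; have [e he] := hG g Gg; case: (eqVneq e d) => [<-|ne].
    by rewrite pihomog_dE //; apply: ideal_gen_incl.
  by rewrite (pihomog_ne0 ne) //; apply: (ideal0 iI).
split=> [d|x y Ix Iy d|x y Iy d].
- by rewrite pihomog0; apply: (ideal0 iI).
- by rewrite pihomogD; apply: (idealD iI).
have [K ->] : exists K, x = \sum_(i < K) pihomog mdeg i x.
  by exists (mmeasure mdeg x); apply: pihomog_partitionE.
rewrite mulr_suml raddf_sum; apply: (ideal_bigsum iI) => i _ /=.
have hi := pihomogP mdeg i x; case: (leqP i d) => [le|lt]; last first.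
  by rewrite (pihomog_mul_lt _ hi lt); apply: (ideal0 iI).
by rewrite -(subnKC le) (pihomog_mul _ _ hi); apply: (idealMl iI).
Qed.

Lemma dhomog_det (A : comNzRingType) n r (M : 'M[{mpoly A[n]}]_r) (d : 'I_r -> nat) :
  (forall i j, M i j \is (d j).-homog) -> \det M \is (\sum_j d j).-homog.
Proof.
move=> hM; apply: rpred_sum => g _.
have -> : (\sum_j d j = \sum_i d (g i))%N by rewrite (reindex_inj (@perm_inj _ g)).
have hp : \prod_i M i (g i) \is (\sum_i d (g i)).-homog.
  by elim/big_rec2: _ => [|i e p _ hp]; [exact: dhomog1 | exact: dhomogM].
by rewrite mulr_sign; case: (odd_perm g); rewrite ?dhomogN.
Qed.

Section ResidualIdeal.
Variables (R : comNzRingType) (k : fieldType) (f : {rmorphism k -> R}) (r m s : nat).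
Variables (mm : R -> Prop) (a : 'I_r -> R) (psi : 'M[{mpoly k[m]}]_(r, s)).
Local Notation B := {mpoly k[m]}.
Local Notation S := {mpoly R[m]}.
Local Notation C := {mpoly B[r]}.
Local Notation F := (map_mpoly f : {rmorphism B -> S}).
Let aS : 'I_r -> S := fun i => (a i)%:MP.
Let apsi : 'I_s -> S := fun j => \sum_(i < r) aS i * F (psi i j).
Let sat := saturation (ideal_of apsi) (ideal_of aS).
Let col := colon (ideal_of apsi) (ideal_of aS).
Let lin (j : 'I_s) : C := \sum_(i < r) 'X_i * (psi i j)%:MP.
Hypotheses (locR : local_ring_with mm) (noeR : noetherian R) (reg : regular_seq a).
Hypothesis height_sat : height_ge sat s.
Hypothesis homog_psi : forall j : 'I_s, exists d : nat, forall i : 'I_r, psi i j \is d.-homog.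

Lemma prime_over_lin (l : 'I_r) (N : C -> Prop) : prime_ideal N -> (forall j, N (lin j)) ->
  ~ N 'X_l -> forall h : 'I_r -> 'I_s, N (\det (colsub h psi))%:MP.
Proof.
move=> pN Nlin nX h; have iN := prime_is_ideal pN.
have Nmap j : N (\sum_(i < r) 'X_i * map_mx (@mpolyC r B) psi i j).
  rewrite (_ : \sum_i _ = lin j); first exact: Nlin.
  by apply: eq_bigr => i _; rewrite mxE.
have := ideal_of_sub iN Nmap (@cramer_ideal C r s (fun i => 'X_i) (map_mx (@mpolyC r B) psi) l h).
by rewrite -map_mxsub det_map_mx => /(primeM pN)[].
Qed.

(** The rank modulo the contraction [q] of [N] enters both height estimates, so it cancels and
    leaves [s]. *)
Lemma lin_deep (l : 'I_r) (N : C -> Prop) : prime_ideal N -> (forall j, N (lin j)) ->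
  ~ N 'X_l -> exists zs : seq C, [/\ (s <= size zs)%N, {in zs, forall z, N z} &
    lreg (fun u => ~ N u) zero_ideal zs].
Proof.
move=> pN Nlin nX; pose q b := N b%:MP.
have pq : prime_ideal q := preim_prime (@mpolyC r B) pN.
have minq : subid (minors_ideal psi) q.
  apply: ideal_gen_sub; first exact: prime_is_ideal.
  by move=> _ [h [_ ->]]; apply: (prime_over_lin pN Nlin nX).
have [K [p [pE pfrac]]] := residue_field pq.
have [h [hq sh]] := rank_bound noeR reg height_sat pq pE minq.
have hN := prime_height_fibre pq pE pfrac pN (fun=> iff_refl _) Nlin hq.
have noeC : noetherian C := noetherian_mpoly (noetherian_mpoly (@noetherian_field k)).
have rC : regular_primes C := regular_primes_mpoly (regular_primes_mpoly (@regular_primes_field k)).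
have [zs [szs zN zreg _]] := regular_at_height noeC pN (rC N pN) hN.
by exists zs; split=> //; apply: leq_trans szs.
Qed.

Definition residual_ideal : S -> Prop := ideal_sum (ideal_of apsi)
  (ideal_gen (fun x => exists y, minors_ideal psi y /\ x = F y)).
Local Notation I := residual_ideal.

Lemma residual_idealP : is_ideal I. Proof. exact: ideal_genP. Qed.

Lemma residual_ideal_apsi : subid (ideal_of apsi) I.
Proof. by move=> x Ax; apply: ideal_gen_incl; left. Qed.

Lemma residual_ideal_minors y : minors_ideal psi y -> I (F y).
Proof. by move=> My; apply: ideal_gen_incl; right; apply: ideal_gen_incl; exists y. Qed.

Lemma residual_ideal_sub (Q : S -> Prop) : is_ideal Q -> (forall j, Q (apsi j)) ->
  (forall h : 'I_r -> 'I_s, injective h -> Q (F (\det (colsub h psi)))) -> subid I Q.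
Proof.
move=> iQ Qa Qd; apply: ideal_gen_sub => // x [|]; first exact: ideal_of_sub.
apply: ideal_gen_sub => // {}x [y [My ->]]; move: y My.
apply: ideal_gen_sub; first exact: preim_ideal.
by move=> _ [h [injh ->]]; apply: Qd.
Qed.

Lemma residual_ideal_graded : graded_ideal I.
Proof.
have /fin_all_exists[d hd] := homog_psi.
have iI := residual_idealP.
pose G (x : S) := (exists j, x = apsi j) \/
  exists h : 'I_r -> 'I_s, injective h /\ x = F (\det (colsub h psi)).
have IG : same_ideal I (ideal_gen G).
  move=> x; split; move: x.
    apply: residual_ideal_sub => [|j|h injh]; first exact: ideal_genP.
    - by apply: ideal_gen_incl; left; exists j.
    - by apply: ideal_gen_incl; right; exists h.
  apply: ideal_gen_sub => // x [[j ->]|[h [injh ->]]].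
    by apply: residual_ideal_apsi; apply: ideal_of_gen.
  by apply: residual_ideal_minors; apply: ideal_gen_incl; exists h.
have haS i : aS i \is 0.-homog.
  by rewrite -[aS i]mulr1 mul_mpolyC; apply: rpredZ; exact: dhomog1.
move=> x /IG Gx e; apply/IG; apply: graded_ideal_gen Gx e => _ [[j ->]|[h [_ ->]]].
  exists (d j); apply: rpred_sum => i _; rewrite -[d j]add0n.
  by apply: dhomogM => //; apply: dhomog_map.
exists (\sum_j d (h j))%N; apply: dhomog_map; apply: dhomog_det => i j.
by rewrite mxE.
Qed.

Lemma saturation_residual : subid sat I.
Proof.
have na1 : ~ ideal_of a 1 by case: reg.
have iI := residual_idealP.
move=> u [t colu]; apply: (graded_local_closed locR noeR na1 iI residual_ideal_graded).
apply: (@saturation_order R k f r m s a psi reg lin_deep I iI _ _ u t) => [j|h injh|l].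
- by apply: residual_ideal_apsi; apply: ideal_of_gen.
- by apply: residual_ideal_minors; apply: ideal_gen_incl; exists h.
by rewrite mulrC; apply: colu; apply: ideal_pow_exp; apply: ideal_of_gen.
Qed.

Lemma residual_colon : subid I col.
Proof.
have icol : is_ideal col.
  have iA := ideal_ofP apsi; split=> [y _|x x' cx cx' y Jy|x x' cx y Jy].
  - by rewrite mul0r; apply: (ideal0 iA).
  - by rewrite mulrDl; apply: (idealD iA); [apply: cx | apply: cx'].
  - by rewrite -mulrA; apply: (idealMl iA); apply: cx.
apply: residual_ideal_sub => // [j y _|h _].
  by apply: (idealMr (ideal_ofP apsi)); apply: ideal_of_gen.
have iQ : is_ideal (fun y => ideal_of apsi (F (\det (colsub h psi)) * y)).
  have iA := ideal_ofP apsi; split=> [|x y Ax Ay|x y Ay].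
  - by rewrite mulr0; apply: (ideal0 iA).
  - by rewrite mulrDr; apply: (idealD iA).
  - by rewrite mulrCA; apply: (idealMl iA).
apply: (ideal_of_sub iQ) => i.
have := @cramer_ideal S r s aS (map_mx F psi) i h; rewrite -map_mxsub det_map_mx mulrC.
apply: ideal_of_sub; first exact: ideal_ofP.
move=> j; rewrite (eq_bigr (fun i => aS i * F (psi i j))); first exact: ideal_of_gen.
by move=> i' _; rewrite mxE.
Qed.

Lemma colon_saturation : subid col sat.
Proof.
move=> x cx; exists 1%N => y Jy; apply: cx; move: y Jy.
apply: ideal_gen_sub; first exact: ideal_ofP.
by move=> _ [b [c [_ Jc ->]]]; apply: (idealMl (ideal_ofP aS)).
Qed.

End ResidualIdeal.

(** * The height of the ideal of minors *)

Lemma low_degree_eq0 (A : comNzRingType) n (G : {mpoly A[n]} -> Prop) delta :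
  (forall g, G g -> g = 0 \/ exists2 d, (delta <= d)%N & g \is d.-homog) ->
  forall x e, ideal_gen G x -> (e < delta)%N -> x \is e.-homog -> x = 0.
Proof.
move=> hG x e Gx lt hx; rewrite -(pihomog_dE hx).
pose I' (x : {mpoly A[n]}) := forall e, (e < delta)%N -> pihomog mdeg e x = 0.
suff iI' : is_ideal I' /\ subid G I' by case: iI' => iI' GI'; exact: (ideal_gen_sub iI' GI').
split; last first.
  move=> g Gg e' lt'; case: (hG g Gg) => [->|[d le hd]]; first by rewrite pihomog0.
  by apply: pihomog_ne0 hd; rewrite gtn_eqF // (leq_trans lt').
split=> [e' _|y z Iy Iz e' lt'|y z Iz e' lt'].
- by rewrite pihomog0.
- by rewrite pihomogD Iy ?Iz ?addr0.
have [K ->] : exists K, y = \sum_(i < K) pihomog mdeg i y.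
  by exists (mmeasure mdeg y); apply: pihomog_partitionE.
rewrite mulr_suml raddf_sum big1 // => i _ /=.
have hi := pihomogP mdeg i y; case: (leqP i e') => [le|lt1]; last first.
  exact: (pihomog_mul_lt _ hi lt1).
rewrite -(subnKC le) (pihomog_mul _ _ hi) Iz ?mulr0 //.
by apply: leq_ltn_trans lt'; apply: leq_subr.
Qed.

(** Induction on the degree of the minor. Once the minors of smaller degree vanish, the ideal is
    generated by forms of at least this degree. The cofactors along the first column are in the
    ideal by the rank bound; being of smaller degree, they are zero. *)
Lemma minors_eq0 (k K : fieldType) m r s (psi : 'M[{mpoly k[m]}]_(r.+1, s))
    (p : {rmorphism {mpoly k[m]} -> K}) :
  (forall j : 'I_s, exists d : nat, (0 < d)%N /\ forall i, psi i j \is d.-homog) ->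
  (forall b, p b = 0 -> minors_ideal psi b) -> (\rank (map_mx p psi) < r)%N ->
  forall h : 'I_r.+1 -> 'I_s, \det (colsub h psi) = 0.
Proof.
move=> /fin_all_exists[d hd] pE rk h.
have hdet n (g : 'I_n -> 'I_r.+1) (h' : 'I_n -> 'I_s) :
    \det (mxsub g h' psi) \is (\sum_j d (h' j)).-homog.
  by apply: dhomog_det => i j; rewrite mxE; case: (hd (h' j)).
have [delta] := ubnP (\sum_j d (h j)); elim: delta h => // delta IH h; rewrite ltnS => hdelta.
rewrite (expand_det_col _ ord0) big1 // => i _; rewrite /cofactor.
have -> : row' i (col' ord0 (colsub h psi)) = mxsub (lift i) (h \o lift ord0) psi.
  by apply/matrixP => i' j; rewrite !mxE.
suff -> : \det (mxsub (lift i) (h \o lift ord0) psi) = 0 by rewrite !mulr0.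
(* The deleted column has positive degree, which makes the inequality strict. *)
have lt : (\sum_j d ((h \o lift ord0) j) < \sum_j d (h j))%N.
  rewrite [X in (_ < X)%N]big_ord_recl /= -[X in (X < _)%N]add0n ltn_add2r.
  by case: (hd (h ord0)).
apply: (low_degree_eq0 (delta := (\sum_j d (h j))%N) _ _ lt (hdet _ _ _)); last first.
  by apply: pE; apply: minor_rank_lt.
move=> _ [h' [_ ->]]; case: (ltnP (\sum_j d (h' j)) (\sum_j d (h j))) => [lt'|le].
  by left; apply: IH; apply: leq_trans lt' hdelta.
by right; exists (\sum_j d (h' j))%N.
Qed.

Section MinorsHeight.
Variables (k : fieldType) (r m s : nat) (psi : 'M[{mpoly k[m]}]_(r, s)).
Local Notation B := {mpoly k[m]}.
Local Notation C := {mpoly B[r]}.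
Local Notation q := (minors_ideal psi).
Hypothesis homog_psi : forall j : 'I_s, exists d : nat, (0 < d)%N /\
  forall i : 'I_r, psi i j \is d.-homog.
Hypothesis pq : prime_ideal q.
Let lin (j : 'I_s) : C := \sum_(i < r) 'X_i * (psi i j)%:MP.

(** A nonzero vector killing [psi] over the residue field is a point over [q] at which all linear
    forms vanish and some variable does not. A prime below this point and minimal over the [s] forms
    still contracts to [q]; its height is at least [n] plus the rank, and at most [s]. *)
Lemma minors_height_rank n (K : fieldType) (p : {rmorphism B -> K}) :
  (forall b, p b = 0 <-> q b) ->
  (forall x : K, exists a b, ~ q b /\ x * p b = p a) ->
  prime_height_ge q n -> (n + \rank (map_mx p psi) <= s)%N.
Proof.
move=> pE pfrac hq.
have lt : (\rank (map_mx p psi) < r)%N by apply: rank_lt_minors => x /pE.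
have [v v0 vpsi] : exists2 v : 'rV[K]_r, v != 0 & v *m map_mx p psi = 0.
  have : kermx (map_mx p psi) != 0 by rewrite kermx_eq0 /row_free neq_ltn lt.
  by case/rowV0Pn => v /sub_kermxP vp v0; exists v.
have [l vl] : exists l, v 0 l != 0.
  by apply/rV0Pn.
pose ev := [the {rmorphism C -> K} of (meval (v 0) \o map_mpoly p)].
have evX i : ev 'X_i = v 0 i by rewrite /= map_mpolyX mevalXU.
have evC b : ev b%:MP = p b by rewrite /= map_mpolyC mevalC.
pose L g := zero_ideal (ev g).
have pL : prime_ideal L := preim_prime ev (@zero_prime K).
have Llin j : L (lin j).
  transitivity ((v *m map_mx p psi) 0 j); last by rewrite vpsi mxE.
  rewrite mxE /lin (rmorph_sum ev); apply: eq_bigr => i _.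
  by rewrite rmorphM evX evC mxE.
have noeC : noetherian C := noetherian_mpoly (noetherian_mpoly (@noetherian_field k)).
pose zs := [seq lin j | j <- enum 'I_s].
have iG : is_ideal (gens zero_ideal zs) by apply: gensP.
have GL : subid (gens zero_ideal zs) L.
  apply: gens_sub => [||_ /mapP[j _ ->] //]; first exact: prime_is_ideal.
  by apply: zero_ideal_sub; exact: prime_is_ideal.
have [N [minN NL]] := minimal_prime_below noeC iG pL GL.
have [pN GN _] := minN; have iN := prime_is_ideal pN.
have Nlin j : N (lin j).
  by apply: GN; apply: gens_mem => //; apply: map_f; rewrite mem_enum.
have nX : ~ N 'X_l by move=> /NL; rewrite /L /zero_ideal evX => /eqP; rewrite (negPf vl).
(* One inclusion holds because [N] is below [L]; the other is Cramer's rule, as ['X_l] is outside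
   [N]. *)
have Nq b : N b%:MP <-> q b.
  split=> [/NL|qb]; first by rewrite /L /zero_ideal evC => /pE.
  move: b qb; apply: ideal_gen_sub; first exact: (preim_ideal (@mpolyC r B)).
  by move=> _ [h [_ ->]]; apply: (prime_over_lin pN Nlin nX).
have hN := prime_height_fibre pq pE pfrac pN Nq Nlin hq.
have szs : size zs = s by rewrite size_map size_enum_ord.
rewrite -[X in (_ <= X)%N]szs; apply: (krull_height noeC _ hN).
apply: minimal_over_ext minN => P' pP'.
by apply: gens_mem_sub; apply: prime_is_ideal.
Qed.

(** If all maximal minors vanish, the ideal is zero and no prime is strictly smaller. Otherwise the
    rank modulo it is at least [r - 1], and the preceding estimate excludes one more step, also when
    [s.+1 - r] truncates to zero. *)
Lemma minors_height_le : (0 < r)%N -> ~ prime_height_ge q (s.+1 - r).+1.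
Proof.
move=> r0 hq; case: (classic (forall h : 'I_r -> 'I_s, \det (colsub h psi) = 0)) => [d0|nd0].
  have [Q [/prime_height_ge_prime pQ Qq nqQ]] := prime_height_ge_pred hq.
  apply: nqQ; apply: ideal_gen_sub; first exact: prime_is_ideal.
  by move=> _ [h [_ ->]]; rewrite d0; apply: ideal0; exact: prime_is_ideal.
have [K [p [pE pfrac]]] := residue_field pq.
have := minors_height_rank pE pfrac hq.
suff : (r <= (\rank (map_mx p psi)).+1)%N by move: (\rank _) => rho; lia.
rewrite leqNgt; apply/negP => lt; apply: nd0.
move: homog_psi pE lt => {hq}; clear -r0; case: r psi r0 => // r' psi' _ hom pE lt.
by apply: (minors_eq0 hom _ lt) => b /pE.
Qed.

End MinorsHeight.

(** * Contraction of the residual ideal to the polynomial ring over the field *)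

Section MinorsContraction.
Variables (R : comNzRingType) (k : fieldType) (f : {rmorphism k -> R}) (r m s : nat).
Variables (a : 'I_r -> R) (psi : 'M[{mpoly k[m]}]_(r, s)).
Local Notation B := {mpoly k[m]}.
Local Notation S := {mpoly R[m]}.
Local Notation F := (map_mpoly f : {rmorphism B -> S}).
Hypothesis na1 : ~ ideal_of a 1.

(** Modulo [(a)] only the extension of the ideal of minors survives, and extended ideals contract
    back. *)
Lemma residual_ideal_contract y : residual_ideal f a psi (F y) -> minors_ideal psi y.
Proof.
have [n [g gE]] := @noetherian_mpoly k m (@noetherian_field k) _ (ideal_genP _) : 
  exists n (g : 'I_n -> B), same_ideal (minors_ideal psi) (ideal_of g).
pose zs := [seq g i | i <- enum 'I_n].
have zE x : minors_ideal psi x <-> gens zero_ideal zs x.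
  by split=> [/gE/gens_ideal_of|/gens_ideal_of/gE].
pose J := gens zero_ideal [seq a i | i <- enum 'I_r].
have iJ : is_ideal J by apply: gensP.
have nJ1 : ~ J 1 by move=> /gens_ideal_of.
have iC : is_ideal (coef_ideal (m := m) J) := coef_idealP _ iJ.
have iQ := gensP [seq F z | z <- zs] iC.
move=> Iy; apply/zE; apply: (base_change_contract iJ nJ1).
apply: residual_ideal_sub Iy => // [j|h injh].
  apply: (gensl _ iC); apply: (ideal_bigsum iC) => i _; apply: (idealMr iC) => mm.
  by rewrite mcoeffC; apply: (idealMr iJ); apply: gens_mem => //; apply: map_f; rewrite mem_enum.
have : gens zero_ideal zs (\det (colsub h psi)).
  by apply/zE; apply: ideal_gen_incl; exists h.
move: (\det _); apply: gens_sub; first exact: (preim_ideal F iQ).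
  by move=> _ ->; rewrite rmorph0; apply: (ideal0 iQ).
by move=> z zin; apply: gens_mem => //; apply: map_f.
Qed.

End MinorsContraction.

Theorem theorem2p3 (R : comRingType) (k : fieldType) (f : {rmorphism k -> R})
  (r m s : nat) (a : 'I_r -> R) (psi : 'M[{mpoly k[m]}]_(r, s)) :
  CM_local R ->
  regular_seq a ->
  (0 < r)%N ->
  (forall j : 'I_s, exists d : nat, (0 < d)%N /\
      forall i : 'I_r, psi i j \is ishomog1 d mdeg) ->
  let aS : 'I_r -> {mpoly R[m]} := fun i => (a i)%:MP in
  let apsi : 'I_s -> {mpoly R[m]} :=
    fun j => \sum_(i < r) aS i * map_mpoly f (psi i j) in
  let sat := saturation (ideal_of apsi) (ideal_of aS) in
  let col := colon (ideal_of apsi) (ideal_of aS) in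
  prime_ideal sat -> height sat s ->
  [/\ prime_ideal (minors_ideal psi),
      height (minors_ideal psi) (s.+1 - r)%N,
      geometric_residual_intersection col (ideal_of aS) s,
      same_ideal sat col &
      same_ideal col (ideal_sum (ideal_of apsi)
         (ideal_gen (fun x => exists y, minors_ideal psi y /\ x = map_mpoly f y)))].
Proof.
move=> [noeR [mm [locR _]]] reg r0 hom aS apsi sat col psat [hsat _].
have psi_homog j : exists d : nat, forall i, psi i j \is d.-homog.
  by have [d [_ hd]] := hom j; exists d.
have na1 : ~ ideal_of a 1 by case: reg.
have satI := saturation_residual locR noeR reg hsat psi_homog.
have Icol := @residual_colon R k f r m s a psi.
have colsat := @colon_saturation R k f r m s a psi.
have satcol : subid sat col by move=> x /satI/Icol.
have pq : prime_ideal (minors_ideal psi).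
  have Fsat y : minors_ideal psi y -> sat (map_mpoly f y).
    move=> My; exact: (colsat _ (Icol _ (residual_ideal_minors My))).
  have Fq y : sat (map_mpoly f y) -> minors_ideal psi y.
    by move=> /satI Iy; exact: (residual_ideal_contract na1 Iy).
  split; first exact: ideal_genP.
    by move=> /Fsat; rewrite rmorph1; apply: prime1.
  by move=> x y /Fsat; rewrite rmorphM => /(primeM psat)[/Fq|/Fq]; [left | right].
split=> //.
- split=> [Q pQ minQ|/(_ _ pq (fun _ => id))]; last exact: minors_height_le.
  have [K [p [pE _]]] := residue_field pQ.
  (* The rank modulo a prime over the minors is at most [r - 1], so the same inequality bounds the
     height of [Q] from below. *)
  have [h [hQ]] := rank_bound noeR reg hsat pQ pE minQ.
  have : (\rank (map_mx p psi) < r)%N by apply: rank_lt_minors => x /minQ/pE.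
  move: (\rank _) => rho lt sh; apply: prime_height_ge_le hQ; lia.
- have iA := ideal_ofP aS.
  exists apsi; split=> //.
  + apply: ideal_of_sub => // j; apply: (ideal_bigsum iA) => i _.
    by apply: (idealMr iA); apply: ideal_of_gen.
  + by move=> Q pQ colQ; apply: hsat => // x /satcol/colQ.
  move=> Q pQ sumQ; apply: (@prime_height_geS _ _ sat) => //.
  + by move=> x /satcol cx; apply: sumQ; apply: ideal_gen_incl; right.
  (* If [Q] were inside the saturation, so would be [(a)], hence [(a)] would lie in the colon ideal;
     its square would then be in [(apsi)], and the saturation would contain 1. *)
  + move=> Qsat; apply: (prime1 psat); exists 2%N => y; rewrite mul1r; move: y.
    apply: ideal_gen_sub; first exact: ideal_ofP.
    move=> _ [b [c [b1 Jc ->]]]; have bA : ideal_of aS b.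
      move: b b1; apply: ideal_gen_sub => //.
      by move=> _ [b [c' [_ Jc' ->]]]; apply: (idealMl iA).
    have Qb : Q b by apply: sumQ; apply: ideal_gen_incl; left.
    exact: (satcol _ (Qsat _ Qb) _ Jc).
  exact: hsat.
by move=> x; split=> [/satcol|/colsat].
by move=> x; split=> [/colsat/satI|/Icol].
Qed.
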